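(* Fix $m\ge 1$ (an integer) and $\beta\ge 0$. Consider the continuous time branching process $\{\mathcal{B}^{(m-1+\beta)}(t):t\ge 0\}$ with root $\emptyset$ born at time $0$, in which each individual $\mathbf{i}\in\mathcal{I}$, born at time $\sigma_{\mathbf{i}}$, reproduces independently according to $\xi_{\sigma_{\mathbf{i}}}(t)=Y_{\mathbf{i}}(t-\sigma_{\mathbf{i}})$, $t\ge\sigma_{\mathbf{i}}$, where $\{Y_{\mathbf{i}}(\cdot):\mathbf{i}\in\mathcal{I}\}$ is an i.i.d. collection of $(m-1+\beta)$-Yule processes. Then $$ \mathcal{G}^*(m)\ \stackrel{\mathrm{d}}{=}\ \mathbb{T}\left(\mathcal{B}^{(m-1+\beta)}(\tau)\right) $$ (equality in distribution of random directed rooted trees), where $\tau$ is an $\operatorname{Exp}(2+\beta/m)$ random variable (rate $2+\beta/m$) independent of $\mathcal{B}^{(m-1+\beta)}(\cdot)$, and $\mathcal{G}^*(m)$ is the local weak limit tree of the directed preferential attachment model $\operatorname{DPA}(m,\beta)$ defined in the context.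
   Context: **Labels.** Individuals in branching processes are labelled by $\mathcal{I}=\cup_{k\ge 0}\mathbb{N}^k$, with $\mathbb{N}^0=\{\emptyset\}$; the children of $\mathbf{i}\in\mathcal{I}$ are $(\mathbf{i},j)$, $j\in\mathbb{N}$; $\sigma_{\mathbf{i}}$ is the birth time of $\mathbf{i}$. **Yule process.** For $\alpha\ge 0$, an $\alpha$-Yule process is a pure birth (counting) process $\{Y_\alpha(t):t\ge 0\}$ with $Y_\alpha(0)=0$ that jumps from $y$ to $y+1$ at rate $y+1+\alpha$. **Continuous time branching process (CTBP).** Given a family of independent point processes $\{\xi_x(t):t\ge x\}$ indexed by $x\ge\sigma_\emptyset$, a CTBP with root born at $\sigma_\emptyset$ starts from the single individual $\emptyset$, and each individual $\mathbf{i}$ born at time $\sigma_{\mathbf{i}}$ produces offspring $(\mathbf{i},1),(\mathbf{i},2),\dots$, independently of other individuals, at the successive points of $\xi_{\sigma_{\mathbf{i}}}$. For a CTBP $\mathcal{B}$, $\mathbb{T}(\mathcal{B}(t))$ is the directed tree rooted at $\emptyset$ whose vertices are the individuals born up to time $t$, with an edge directed from each non-root individual to its parent. **$\mathcal{G}^*(1)$ (case $m=1$).** $\mathcal{G}^*(1)=\mathbb{T}(\mathcal{B}^{(\beta)}(\tau))$, where $\mathcal{B}^{(\beta)}$ is the CTBP with root born at time $0$ in which each individual reproduces according to an independent $\beta$-Yule process started at its birth time, and $\tau\sim\operatorname{Exp}(2+\beta)$ is independent of $\mathcal{B}^{(\beta)}$. **$\mathcal{G}^*(m)$ (case $m\ge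 2$; Pólya point graph).** Set $\chi=(m+\beta)/(2m+\beta)$ and $\psi=(1-\chi)/\chi$. The root $\emptyset$ has birth time $\sigma_\emptyset\sim U^\chi$, with $U\sim\operatorname{Uniform}(0,1)$. Each individual $\mathbf{i}$ with birth time $\sigma_{\mathbf{i}}\le 1$ (including the root) independently reproduces at the points of a nonhomogeneous Poisson point process on $[\sigma_{\mathbf{i}},1]$ with random intensity $\gamma_{\sigma_{\mathbf{i}}}\,\psi v^{\psi-1}/\sigma_{\mathbf{i}}^{\psi}$, $v\in[\sigma_{\mathbf{i}},1]$, where $\{\gamma_x:x>0\}$ are i.i.d. $\operatorname{Gamma}(m+\beta,1)$ random variables (so distinct individuals have i.i.d. gamma variables). $\mathcal{G}^*(m)$ is the resulting rooted tree, with an edge directed from each non-root individual to its parent. *)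

(* Defs.v *)
From HB Require Import structures.
From mathcomp Require Export all_boot all_order all_algebra.
From mathcomp Require Export all_classical all_reals all_analysis.
From mathcomp Require Export measurable_realfun.

Set Implicit Arguments.
Unset Strict Implicit.
Unset Printing Implicit Defensive.

Import Order.TTheory GRing.Theory Num.Theory.
Import numFieldNormedType.Exports.

Local Open Scope classical_set_scope.
Local Open Scope ring_scope.

(* The root is [::] and the child (i, j), j >= 1, of the mathematical notation
   is [rcons i j.-1]: offspring are numbered from 0. *)
Definition label : Type := seq nat.

(* All graphs considered are countable, so labels serve as a universe of
   vertices. Arcs outside [gvertex] are ignored. *)
Record drgraph : Type := DRGraph {
  gvertex : set label;
  groot : label;
  garc : label -> label -> Prop }.

Definition dr_iso (G H : drgraph) : Prop :=
  exists f : label -> label,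
    [/\ set_bij (gvertex G) (gvertex H) f,
        f (groot G) = groot H
      & forall u v, gvertex G u -> gvertex G v ->
          (garc G u v <-> garc H (f u) (f v))].

(* Vertices at distance at most r from the root, arcs being traversed in
   either direction. *)
Fixpoint ball_vertex (G : drgraph) (r : nat) : set label :=
  match r with
  | 0%N => gvertex G `&` [set groot G]
  | r'.+1 => ball_vertex G r' `|`
      [set v | gvertex G v /\
               exists2 u, ball_vertex G r' u & garc G u v \/ garc G v u]
  end.

Definition dr_ball (r : nat) (G : drgraph) : drgraph :=
  DRGraph (ball_vertex G r) (groot G) (garc G).

(* The Borel sets of the local topology on directed rooted graphs modulo
   isomorphism, pulled back to [drgraph]: they are generated by the events
   "the ball of radius r around the root is isomorphic to H", H finite. *)
Definition local_borel : set (set drgraph) :=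
  <<s [set A | exists r (H : drgraph), finite_set (gvertex H) /\
                 A = [set G | dr_iso (dr_ball r G) H] ] >>.

Definition eq_in_distribution (R : realType)
    d (T : measurableType d) (P : probability T R) (G : T -> drgraph)
    d' (T' : measurableType d') (P' : probability T' R) (G' : T' -> drgraph) :
    Prop :=
  forall A, local_borel A ->
    [/\ measurable (G @^-1` A), measurable (G' @^-1` A)
      & P (G @^-1` A) = P' (G' @^-1` A)].

Section probability_preliminaries.
Context (R : realType) d (T : measurableType d) (P : probability T R).

Definition sigma_of d' (T' : measurableType d') (X : T -> T') : set (set T) :=
  preimage_set_system setT X measurable.

Definition independent2 (F G : set (set T)) : Prop :=
  forall A B, F A -> G B -> P (A `&` B) = (P A * P B)%E.

Definition mutually_independent (I : eqType) (F : I -> set (set T)) : Prop :=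
  forall (s : seq I) (A : I -> set T), uniq s ->
    (forall i, i \in s -> F i (A i)) ->
    P [set w | forall i, i \in s -> A i w] = (\prod_(i <- s) P (A i))%E.

Definition has_law (X : T -> R) (mu : set R -> \bar R) : Prop :=
  forall B : set R, measurable B -> P (X @^-1` B) = mu B.

End probability_preliminaries.

Definition gamma_fun (R : realType) (a : R) : R :=
  \int[lebesgue_measure]_(x in `]0%R, +oo[) (x `^ (a - 1) * expR (- x)).

Definition gamma_prob (R : realType) (a : R) (B : set R) : \bar R :=
  (\int[lebesgue_measure]_(x in B `&` `]0%R, +oo[)
     (x `^ (a - 1) * expR (- x) / gamma_fun a)%:E)%E.

Section yule.
Context (R : realType) d (T : measurableType d) (P : probability T R).

(* The time of the k-th jump (0 for k = 0), +oo if it never occurs. *)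
Definition jump_time (Y : R -> T -> nat) (k : nat) (w : T) : \bar R :=
  ereal_inf [set t%:E | t in [set t | 0 <= t /\ (k <= Y t w)%N] ].

Definition holding_time (Y : R -> T -> nat) (k : nat) (w : T) : \bar R :=
  (jump_time Y k.+1 w - jump_time Y k w)%E.

(* The sojourn times in the states 0, 1, 2, ... are independent and
   exponential with rates [rate 0], [rate 1], ...; being almost surely
   positive, they force all jumps to have size one almost surely. Only the
   values of Y at nonnegative times matter. *)
Definition pure_birth_process (rate : nat -> R) (Y : R -> T -> nat) : Prop :=
  [/\ forall t, 0 <= t -> measurable_fun setT (Y t),
      forall w, Y 0 w = 0%N,
      forall w s t, 0 <= s -> s <= t -> (Y s w <= Y t w)%N,
      forall w t, 0 <= t -> \forall s \near t^'+, Y s w = Y t w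
    & mutually_independent P (fun k => sigma_of (holding_time Y k)) /\
      forall k (B : set R), measurable B ->
        P (holding_time Y k @^-1` (EFin @` B)) = exponential_prob (rate k) B].

Definition yule_process (alpha : R) (Y : R -> T -> nat) : Prop :=
  pure_birth_process (fun y => y%:R + 1 + alpha) Y.

Definition sigma_of_process (Y : R -> T -> nat) : set (set T) :=
  <<s \bigcup_(t in [set t | 0 <= t]) sigma_of (Y t) >>.

End yule.

Section ctbp.
Context (R : realType) d (T : measurableType d) (P : probability T R).

(* [xi i w t] is the number of points up to time t of the point process
   according to which individual i reproduces, and [b i w] is the birth time of
   i (+oo if i is never born): the j-th child of i is born at the j-th point. *)
Definition ctbp_births (root : T -> R) (xi : label -> T -> R -> \bar R)
    (b : label -> T -> \bar R) : Prop :=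
  (forall w, b [::] w = (root w)%:E) /\
  (forall i j w, b (rcons i j) w =
     ereal_inf [set t%:E | t in
       [set t : R | (b i w <= t%:E)%E /\ (j.+1%:R%:E <= xi i w t)%E] ]).

(* Arcs point from a child to its parent. If t w < b [::] w then the root is not
   a vertex; this has probability zero for the clocks used below. *)
Definition tree_at (b : label -> T -> \bar R) (t : T -> R) (w : T) : drgraph :=
  let V := [set i | (b i w <= (t w)%:E)%E] in
  DRGraph V [::] (fun u v => [/\ V u, V v & exists j, u = rcons v j]).

(* The [fine] is harmless: [ctbp_births] evaluates the reproduction of i only
   at real times t with b i w <= t, and b i w is never -oo. *)
Definition yule_ctbp (alpha : R) (Y : label -> R -> T -> nat)
    (b : label -> T -> \bar R) : Prop :=
  [/\ forall i, yule_process P alpha (Y i),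
      mutually_independent P (fun i : seq nat => sigma_of_process (Y i))
    & ctbp_births (fun=> 0)
        (fun i w t => (Y i (t - fine (b i w)) w)%:R%:E) b].

Definition exp_clock (rate : R) (Y : label -> R -> T -> nat)
    (tau : {RV P >-> R}) : Prop :=
  has_law P tau (exponential_prob rate) /\
  independent2 P (sigma_of tau) (<<s \bigcup_i sigma_of_process (Y i) >>).

(* Conditionally on the sigma-algebra F, the random measures [Xi i], i in D,
   are independent Poisson point processes with (random) mean measures
   [Lambda i], assumed finite.
   The library's [poisson_prob r] ignores its first natural number argument.
   It is used in place of [poisson_pmf], whose value at rate 0 is always 1. *)
Definition conditionally_poisson (F : set (set T)) (D : set label)
    (Xi : label -> T -> {measure set (measurableTypeR R) -> \bar R})
    (Lambda : label -> T -> set R -> \bar R) : Prop :=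
  forall (A : set T) (s : seq (seq nat)) (n : nat)
    (B : label -> 'I_n -> set R) (c : label -> 'I_n -> nat),
    F A -> uniq s -> (forall i, i \in s -> D i) ->
    (forall i q, measurable (B i q)) -> (forall i, trivIset setT (B i)) ->
    P (A `&` [set w | forall i q, i \in s ->
                        Xi i w (B i q) = (c i q)%:R%:E]) =
    (\int[P]_(w in A) \prod_(i <- s) \prod_(q < n)
       poisson_prob (fine (Lambda i w (B i q))) 0%N [set c i q])%E.

(* The measure on [s, 1] with density g psi v ^ (psi - 1) / s ^ psi; it vanishes
   for s > 1, in particular for s = +oo. *)
Definition polya_mean (psi : R) (g : R) (s : \bar R) (B : set R) : \bar R :=
  (\int[lebesgue_measure]_(v in B `&` [set v | s <= v%:E /\ v%:E <= 1])
     (g * (psi * v `^ (psi - 1)) / fine s `^ psi)%:E)%E.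

(* Birth times of the generations 0, ..., n and all gamma marks. Given these, the
   individuals of generation n reproduce independently. *)
Definition history (gam : label -> T -> R) (b : label -> T -> \bar R)
    (n : nat) : set (set T) :=
  <<s (\bigcup_i sigma_of (gam i)) `|`
      (\bigcup_(i in [set i : label | (size i <= n)%N]) sigma_of (b i)) >>.

Definition polya_ctbp (m : nat) (beta : R) (U : {RV P >-> R})
    (gam : label -> {RV P >-> R})
    (Xi : label -> T -> {measure set (measurableTypeR R) -> \bar R})
    (b : label -> T -> \bar R) : Prop :=
  let chi := (m%:R + beta) / (2 * m%:R + beta) in
  let psi := (1 - chi) / chi in
  [/\ has_law P U (@uniform_prob R 0 1 ltr01) /\
      (forall i, has_law P (gam i) (gamma_prob (m%:R + beta))),
      mutually_independent P (fun o : option (seq nat) =>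
        if o is Some i then sigma_of (gam i) else sigma_of U),
      forall i (B : set R), measurable B ->
        measurable_fun setT (fun w => Xi i w B),
      forall n, conditionally_poisson (history gam b n)
        [set i : label | size i = n] Xi
        (fun i w B => polya_mean psi (gam i w) (b i w) B)
    & ctbp_births (fun w => U w `^ chi)
        (fun i w t => Xi i w [set x | x <= t]) b].

(* G is a version, on the probability space (T, P), of the local weak limit of
   the directed preferential attachment model DPA(m, beta); m >= 1. *)
Definition is_Gstar (m : nat) (beta : R) (G : T -> drgraph) : Prop :=
  if m == 1%N then
    exists Y b (tau : {RV P >-> R}),
      [/\ yule_ctbp beta Y b, exp_clock (2 + beta) Y tau & G = tree_at b tau]
  else
    exists U gam Xi b, polya_ctbp m beta U gam Xi b /\ G = tree_at b (fun=> 1).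

End ctbp.

(* Main.v *)
From HB Require Import structures.
From mathcomp Require Import ring lra zify.
Require Import Defs.

Set Implicit Arguments.
Unset Strict Implicit.
Unset Printing Implicit Defensive.

Import Order.TTheory GRing.Theory Num.Theory.
Import numFieldNormedType.Exports.

Local Open Scope classical_set_scope.
Local Open Scope ring_scope.

(** The two trees become the same once time is measured on a suitable scale.
    Write [a = m + beta] and [r = 2 + beta / m].

    In the Yule tree run until the clock [tau], give an individual born at time
    [b] the position [z = exp (b - tau)]; in the Polya tree give an individual
    born at time [v] the position [z = v ^ psi]. On both sides an individual
    belongs to the tree when its position is at most 1. The root sits at
    [exp (- tau)], respectively [U ^ (chi psi)]; as [tau] is exponential of
    rate [r] and [chi psi = 1 / r], both have distribution function [c ^ r] on
    [0, 1] ([yule_root_law], [polya_root_law]).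

    Consider an individual at position [u <= 1]. In the Yule tree the logarithms
    of the positions of its children are separated by independent exponential
    spacings of rates [a], [a + 1], [a + 2], ... In the Polya tree its
    children form a Poisson process of intensity [(g / u) dz] on [u, 1], with
    [g] of law Gamma of parameter [a]. In both cases the probability of having
    [n_q] children in the [q]-th cell of a subdivision of [0, 1], for all [q], is
    [u ^ a * a (a + 1) ... (a + N - 1) * prod_q (L_q ^ n_q / n_q!)], where [N] is
    the sum of the [n_q] and [L_q] is the length of the part of cell [q] above [u]:
    for the Yule process by induction on [N], integrating over the position of
    the first child ([visits_law]), and for the mixed Poisson process by
    integrating over [g] ([polya_kernel_mean]). A Yule process is a mixed
    Poisson process up to a change of time; [offspring_law] is the common law.

    It remains to pass from individuals to trees. The structure [branching] says
    that, given the generations up to [n], the broods of generation [n] have a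
    prescribed conditional law that depends on the positions of the parents and
    on independent marks: the spacings on the Yule side, the gamma variables on
    the Polya side. Integrating the marks out, one generation after the other,
    shows that the law of all positions depends only on the law of the root and
    on the mean of the conditional law over the marks ([branching_unique]). To
    keep all events elementary, a brood is described by the list of dyadic cells
    that its members occupy ([code]); refining the subdivision recovers the
    positions. Finally the tree is a measurable function of the set of
    labels with position at most 1 ([eq_in_distribution_trees]).

    For [m = 1] the left-hand tree is itself a Yule tree, and the same uniqueness
    theorem compares two Yule trees living on different spaces. *)

(** * Laws, independence and integration *)

Section image_law.
Context (R : realType) d (T : measurableType d) d' (S : measurableType d').

(** The measure structure of the image depends on the proof [mX], so that it has
    to be named. *)
Definition image_law (m : {measure set T -> \bar R}) (X : T -> S)
    (mX : measurable_fun setT X) : {measure set S -> \bar R} :=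
  measure_function_pushforward__canonical__measure_function_Measure m mX.

Lemma ge0_integral_image_law (m : {measure set T -> \bar R}) (X : T -> S)
    (mX : measurable_fun setT X) (f : S -> \bar R) :
  measurable_fun setT f -> (forall x, 0 <= f x)%E ->
  (\int[image_law m mX]_x f x = \int[m]_w f (X w))%E.
Proof.
move=> mf f0.
by rewrite [LHS](ge0_integral_pushforward mX)// => x _.
Qed.

End image_law.

Section uniqueness.
Context (R : realType) (S : pointedType) (G : set (set S)).
Hypotheses (GI : setI_closed G) (GT : G setT).

Lemma finite_measure_unique
    (m1 m2 : {measure set (g_sigma_algebraType G) -> \bar R}) :
  (m1 setT < +oo)%E -> (forall E, G E -> m1 E = m2 E) ->
  forall E, <<s G >> E -> m1 E = m2 E.
Proof.
move=> m1oo m12 E mE.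
apply: (@measure_unique _ R (g_sigma_algebraType G) G (fun=> setT)) => //.
by rewrite bigcup_const //; exists 0%N.
Qed.

Lemma measurable_fun_generated d (T : measurableType d) (X : T -> S) :
  (forall E, G E -> measurable (X @^-1` E)) ->
  measurable_fun setT (X : T -> g_sigma_algebraType G).
Proof.
move=> mX.
apply: (@measurability _ _ T (g_sigma_algebraType G) setT X G) => //.
by move=> _ [F GF <-]; rewrite setTI; exact: mX.
Qed.

(** Dynkin's lemma in a form that covers both equality of two laws ([B] the whole
    space and [c = 1]) and independence of [X1 = X2] from an event [B] ([c] the
    probability of [B]). *)
Lemma laws_agree d1 (T1 : measurableType d1) (m1 : {measure set T1 -> \bar R})
    d2 (T2 : measurableType d2) (m2 : {measure set T2 -> \bar R})
    (X1 : T1 -> S) (X2 : T2 -> S) (B : set T1) (c : {nonneg R}) :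
  (m1 setT < +oo)%E -> measurable B ->
  (forall E, G E -> measurable (X1 @^-1` E)) ->
  (forall E, G E -> measurable (X2 @^-1` E)) ->
  (forall E, G E -> m1 (X1 @^-1` E `&` B) = (c%:num%:E * m2 (X2 @^-1` E))%E) ->
  forall E, <<s G >> E ->
  m1 (X1 @^-1` E `&` B) = (c%:num%:E * m2 (X2 @^-1` E))%E.
Proof.
move=> m1oo mB mX1 mX2 h E mE.
have := @finite_measure_unique (image_law (mrestr m1 mB) (measurable_fun_generated mX1))
  (mscale c (image_law m2 (measurable_fun_generated mX2))).
apply => //.
rewrite /image_law /= /pushforward /= /mrestr preimage_setT setTI.
by apply: le_lt_trans m1oo; apply: le_measure => //; rewrite inE.
Qed.

End uniqueness.

Lemma measurable_fun_comp2 d1 (S : measurableType d1) d2 (G : measurableType d2)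
    d3 (U : measurableType d3) d4 (V : measurableType d4)
    (f : S -> G -> V) (a : U -> S) (b : U -> G) :
  measurable_fun setT (fun xg : S * G => f xg.1 xg.2) ->
  measurable_fun setT a -> measurable_fun setT b ->
  measurable_fun setT (fun u => f (a u) (b u)).
Proof.
move=> mf ma mb.
rewrite (_ : (fun u => _) = (fun xg : S * G => f xg.1 xg.2) \o (fun u => (a u, b u)))//.
by apply: measurableT_comp => //; exact: measurable_fun_pair.
Qed.

Lemma measurable_exists d (T : measurableType d) (I : countType) (F : I -> set T) :
  (forall i, measurable (F i)) -> measurable [set x | exists i, F i x].
Proof.
move=> mF.
rewrite (_ : mkset _ = \bigcup_n (oapp F set0 (unpickle n))).
  apply: bigcupT_measurable => n; case: (unpickle n) => [i|] /=; [exact: mF|exact: measurable0].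
apply/seteqP; split=> [V [i Fi]|V [n _]].
  by exists (pickle i) => //; rewrite pickleK.
by case: (unpickle n) => //= i Fi; exists i.
Qed.

Lemma measurable_forall d (T : measurableType d) (I : countType) (F : I -> set T) :
  (forall i, measurable (F i)) -> measurable [set x | forall i, F i x].
Proof.
move=> mF.
rewrite (_ : mkset _ = ~` [set x | exists i, ~ F i x]).
  by apply: measurableC; apply: measurable_exists => i; exact: measurableC.
apply/seteqP; split=> [x Fx [i]//|x nex i]; exact: contra_notP (fun h => ex_intro _ i h) nex.
Qed.

Section integrate_out.
Context (R : realType) d (T : measurableType d) (P : probability T R).

Lemma prob_integral (E : set T) : measurable E -> P E = (\int[P]_w (\1_E w)%:E)%E.
Proof. by move=> mE; rewrite integral_indic// setIT. Qed.

Lemma integral_independent_pair d1 (S : measurableType d1) d2 (G : measurableType d2)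
    (X : T -> S) (Y : T -> G) (f : S * G -> \bar R) :
  measurable_fun setT X -> measurable_fun setT Y ->
  (forall E D, measurable E -> measurable D ->
    P (X @^-1` E `&` Y @^-1` D) = (P (X @^-1` E) * P (Y @^-1` D))%E) ->
  measurable_fun setT f -> (forall z, 0 <= f z)%E ->
  (\int[P]_w f (X w, Y w) = \int[P]_w \int[P]_w' f (X w, Y w'))%E.
Proof.
move=> mX mY ind mf f0.
pose X' : {mfun T >-> S} := HB.pack X (isMeasurableFun.Build _ _ _ _ _ mX).
pose Y' : {mfun T >-> G} := HB.pack Y (isMeasurableFun.Build _ _ _ _ _ mY).
have mXY : measurable_fun setT (fun w => (X w, Y w)).
  exact: measurable_fun_pair.
rewrite -(ge0_integral_image_law P mXY)//.
transitivity (\int[(distribution P X' \x distribution P Y')%E]_z f z)%E.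
  apply: eq_measure_integral => A mA _.
  by apply/esym; apply: product_measure_unique => // E D mE mD; rewrite /image_law /= /pushforward -ind.
rewrite fubini_tonelli1//.
rewrite /fubini_F.
rewrite (ge0_integral_pushforward mX) //; last 2 first.
  exact: measurable_fun_fubini_tonelli_F.
  by move=> x _; apply: integral_ge0 => y _; exact: f0.
apply: eq_integral => w _ /=.
rewrite (ge0_integral_pushforward mY) //.
exact: measurableT_comp.
Qed.

Lemma emeasurable_prod d1 (S : measurableType d1) (I : Type) (s : seq I) (f : I -> S -> \bar R) :
  (forall i, measurable_fun setT (f i)) ->
  measurable_fun setT (fun x => \prod_(i <- s) f i x)%E.
Proof.
move=> mf; elim: s => [|i s IH].
  by under eq_fun do rewrite big_nil; exact: measurable_cst.
by under eq_fun do rewrite big_cons; apply: emeasurable_funM.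
Qed.

Lemma measurable_integral_param d1 (S : measurableType d1) d2 (G : measurableType d2)
   (Y : T -> G) (f : S -> G -> \bar R) :
  measurable_fun setT Y -> measurable_fun setT (fun xg => f xg.1 xg.2) ->
  (forall x g, 0 <= f x g)%E ->
  measurable_fun setT (fun x => \int[P]_w f x (Y w))%E.
Proof.
move=> mY mf f0.
apply: (@measurable_fun_fubini_tonelli_F _ _ _ _ _ P (fun z => f z.1 (Y z.2))) => //.
by apply: (measurable_fun_comp2 mf) => //; exact: measurableT_comp.
Qed.

Definition jointly_independent (I : eqType) d1 (S : measurableType d1) d2 (G : measurableType d2)
   (X : T -> S) (g : I -> T -> G) (s : seq I) : Prop :=
  forall (E : set S) (D : I -> set G), measurable E -> (forall i, measurable (D i)) ->
  P (X @^-1` E `&` [set w | forall i, i \in s -> D i (g i w)]) =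
    (P (X @^-1` E) * \prod_(i <- s) P (g i @^-1` D i))%E.

Lemma measurable_forall_in (I : eqType) d2 (G : measurableType d2) (g : I -> T -> G)
   (s : seq I) (D : I -> set G) :
  (forall i, measurable_fun setT (g i)) -> (forall i, measurable (D i)) ->
  measurable [set w | forall i, i \in s -> D i (g i w)].
Proof.
move=> mg mD; elim: s => [|i s IH].
  by rewrite (_ : mkset _ = setT)//; apply/seteqP; split.
rewrite (_ : mkset _ = g i @^-1` D i `&` [set w | forall i, i \in s -> D i (g i w)]).
  by apply: measurableI => //; rewrite -[X in measurable X]setTI; exact: mg.
apply/seteqP; split => [w h|w [h1 h2] j] /=.
  by split=> [|j js]; apply: h; rewrite inE ?eqxx// js orbT.
by rewrite inE => /orP[/eqP->//|]; exact: h2.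
Qed.

Lemma prod_indic_marks (I : eqType) d2 (G : measurableType d2) (g : I -> T -> G)
   (s : seq I) (D : I -> set G) (w : T) :
  (\prod_(i <- s) (\1_(D i) (g i w))%:E =
   (\1_[set w | forall i, i \in s -> D i (g i w)] w)%:E :> \bar R)%E.
Proof.
have [h|/existsNP[i /not_implyP[si Di]]] := pselect (forall i, i \in s -> D i (g i w)).
  rewrite [in RHS]indicE mem_set// big1_seq// => i /= /h Di.
  by rewrite indicE mem_set.
rewrite (big_rem i)//= indicE memNset// mul0e indicE memNset//.
by move=> /(_ i si).
Qed.

(** Given [X], independent marks may be averaged one by one: after the first mark
    [g i] has been absorbed into the conditioning variable, the pair [(X, g i)] is
    still independent of the marks that remain. *)
Lemma integrate_out (I : eqType) d2 (G : measurableType d2) (g : I -> T -> G)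
   (s : seq I) : (forall i, measurable_fun setT (g i)) -> uniq s ->
  forall d1 (S : measurableType d1) (X : T -> S) (phi : S -> \bar R) (f : I -> S -> G -> \bar R),
  measurable_fun setT X -> jointly_independent X g s ->
  measurable_fun setT phi -> (forall x, 0 <= phi x)%E ->
  (forall i, measurable_fun setT (fun xg => f i xg.1 xg.2)) ->
  (forall i x g, 0 <= f i x g)%E ->
  (\int[P]_w (phi (X w) * \prod_(i <- s) f i (X w) (g i w)) =
   \int[P]_w (phi (X w) * \prod_(i <- s) \int[P]_w' f i (X w) (g i w')))%E.
Proof.
move=> mg; elim: s => [|i s IH] us d1 S X phi f mX ind mphi phi0 mf f0.
  by apply: eq_integral => w _; rewrite !big_nil.
have /= /andP[nis us'] := us.
(* The mark [i] joins the conditioning variable. *)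
pose X' w := (X w, g i w).
have mX' : measurable_fun setT X' by apply: measurable_fun_pair.
have indX E D : measurable E -> measurable D ->
    P (X @^-1` E `&` g i @^-1` D) = (P (X @^-1` E) * P (g i @^-1` D))%E.
  move=> mE mD.
  have := ind E (fun j => if j == i then D else setT) mE.
  rewrite big_cons eqxx big1_seq; last first.
    move=> j /= js; case: eqP => [ji|_]; first by rewrite ji (negbTE nis) in js.
    by rewrite preimage_setT probability_setT.
  rewrite mule1 => <-; last by move=> j; case: ifP.
  congr (P (_ `&` _)); apply/seteqP; split => [w /= Dw j|w /= /(_ i)].
    rewrite inE; case: eqP => [->//|_ _]; by [].
  by rewrite inE eqxx /=; apply.
have ind' : jointly_independent X' g s.
  move=> E D mE mD.
  have pE : (\prod_(j <- s) P (g j @^-1` D j))%E \is a fin_num.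
    rewrite prode_fin_num// => j _.
    by apply: fin_num_measure; rewrite -[X in measurable X]setTI; exact: mg.
  have p0 : (0 <= \prod_(j <- s) P (g j @^-1` D j))%E by exact: prode_ge0.
  have mB : measurable [set w | forall j, j \in s -> D j (g j w)].
    exact: measurable_forall_in.
  have c0 : 0 <= fine (\prod_(j <- s) P (g j @^-1` D j))%E by exact: fine_ge0.
  rewrite muleC -(fineK pE) -[fine _]/(NngNum c0)%:num.
  pose Rect : set (set (S * G)) := [set A `*` B | A in measurable & B in measurable].
  have ER : <<s Rect >> E by rewrite /Rect -measurable_prod_measurableType.
  apply: (laws_agree (G := Rect)) ER => //.
  - move=> _ _ [A1 mA1 [B1 mB1 <-]] [A2 mA2 [B2 mB2 <-]].
    exists (A1 `&` A2); first exact: measurableI.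
    by exists (B1 `&` B2); [exact: measurableI|rewrite setXI].
  - by exists setT => //; exists setT => //; rewrite setXTT.
  - by apply: (le_lt_trans (probability_le1 P measurableT)); rewrite ltry.
  - move=> _ [A mA [B mB' <-]].
    by rewrite -[X in measurable X]setTI; apply: mX' => //; exact: measurableX.
  - move=> _ [A mA [B mB' <-]].
    by rewrite -[X in measurable X]setTI; apply: mX' => //; exact: measurableX.
  - move=> _ [A mA [B mB' <-]].
    have := ind A (fun j => if j == i then B else D j) mA.
    rewrite big_cons eqxx => h.
    have -> : X' @^-1` (A `*` B) `&` [set w | forall j, j \in s -> D j (g j w)] =
      X @^-1` A `&`
      [set w | forall j, j \in i :: s -> (if j == i then B else D j) (g j w)].
      apply/seteqP; split => w /=.
        move=> [[Aw Bw] h']; split => // j; rewrite inE.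
        by case: eqP => [->//|_ /= js]; exact: h'.
      move=> [Aw h']; split.
        by split => //; have := h' i; rewrite inE eqxx; apply.
      move=> j js; have := h' j; rewrite inE js orbT.
      by case: eqP => [ji|_]; [rewrite -ji js in nis|apply].
    have -> : X' @^-1` (A `*` B) = X @^-1` A `&` g i @^-1` B by [].
    rewrite [LHS]h; last by move=> j; case: ifP.
    transitivity ((\prod_(j <- s) P (g j @^-1` D j)) *
      (P (X @^-1` A) * P (g i @^-1` B)))%E; last first.
      by congr (_ * _)%E; [rewrite /= fineK|rewrite [RHS]indX].
    rewrite muleA muleC; congr (_ * _)%E.
    apply: eq_big_seq => j js.
    by case: eqP => // ji; rewrite -ji js in nis.
pose phi' (z : S * G) := (phi z.1 * f i z.1 z.2)%E.
pose f' j (z : S * G) := f j z.1.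
transitivity (\int[P]_w (phi' (X' w) * \prod_(j <- s) f' j (X' w) (g j w)))%E.
  by apply: eq_integral => w _; rewrite big_cons muleA.
rewrite IH//; last 4 first.
- by apply: emeasurable_funM => //; exact: measurableT_comp.
- by move=> z; apply: mule_ge0.
- move=> j; rewrite /f'.
  by apply: (measurable_fun_comp2 (mf j)) => //; exact: measurableT_comp.
- by move=> j x y; rewrite /f'.
have mint j : measurable_fun setT (fun x : S => \int[P]_w' f j x (g j w'))%E.
  exact: measurable_integral_param.
have int0 j x : (0 <= \int[P]_w' f j x (g j w'))%E by apply: integral_ge0.
rewrite (integral_independent_pair (f := fun z : S * G =>
   (phi' z * \prod_(j <- s) \int[P]_w' f' j z (g j w'))%E) mX (mg i) indX); last 2 first.
- apply: emeasurable_funM.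
    by apply: emeasurable_funM => //; exact: measurableT_comp.
  by apply: emeasurable_prod => j; exact: (measurableT_comp (mint j)).
- by move=> z; apply: mule_ge0; [exact: mule_ge0|apply: prode_ge0 => j _; apply: integral_ge0 => *; exact: f0].
apply: eq_integral => w _ /=.
rewrite /phi' /f' /= big_cons.
under eq_integral => w' _ do rewrite -muleA [X in (_ * X)%E]muleC muleA.
rewrite ge0_integralZl//.
- by rewrite -muleA [X in (_ * X)%E]muleC.
- apply: (measurableT_comp (mf i) (g := fun w' : T => (X w, g i w'))).
  exact: measurable_fun_pair.
- by apply: mule_ge0 => //; apply: prode_ge0 => j _; exact: int0.
Qed.

End integrate_out.

Section density.
Context d (S : measurableType d) (R : realType).
Variables (m mu : {measure set S -> \bar R}) (p : S -> R).
Hypotheses (mp : measurable_fun setT p) (p0 : forall x, 0 <= p x).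
Hypothesis m_density : forall B, measurable B ->
  m B = (\int[mu]_(x in B) (p x)%:E)%E.

Let mpE : measurable_fun setT (EFin \o p). Proof. exact/measurable_EFinP. Qed.
Let p0E x : (0 <= (p x)%:E)%E. Proof. by rewrite lee_fin. Qed.

Import HBNNSimple.

Let nnsfun_density (h : {nnsfun S >-> R}) :
  (\int[m]_x (h x)%:E = \int[mu]_x ((h x)%:E * (p x)%:E))%E.
Proof.
under [LHS]eq_integral do rewrite fimfunE -fsumEFin//.
rewrite [LHS]ge0_integral_fsum//; last 2 first.
  - by move=> r; exact/measurable_EFinP/measurableT_comp.
  - by move=> n x _; rewrite EFinM nnfun_muleindic_ge0.
under [RHS]eq_integral.
  move=> x xD; rewrite fimfunE -fsumEFin// muleC ge0_mule_fsumr; last first.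
    by move=> r; rewrite EFinM nnfun_muleindic_ge0.
  over.
rewrite [RHS]ge0_integral_fsum//; last 2 first.
  - move=> r; apply: emeasurable_funM => //.
    by apply/measurable_EFinP; do 2 apply/measurableT_comp => //.
  - by move=> n x _; rewrite EFinM mule_ge0// nnfun_muleindic_ge0.
apply: eq_fsbigr => r rh.
rewrite integralZl_indic_nnsfun//= integral_indic// setIT m_density//.
have [y _ hy] : range h r by rewrite inE in rh.
have r0 : (0 <= r%:E)%E by rewrite lee_fin -hy.
transitivity (\int[mu]_x (r%:E * ((\1_(h @^-1` [set r]) x)%:E * (p x)%:E)))%E; last first.
  by apply: eq_integral => x _; rewrite EFinM muleA muleC.
rewrite ge0_integralZl//; last 2 first.
- by apply: emeasurable_funM => //; exact/measurable_EFinP.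
- by move=> x _; rewrite mule_ge0// lee_fin.
congr (_ * _)%E.
rewrite integral_mkcond; apply: eq_integral => x _.
by rewrite patchE indicE; case: ifPn => _; rewrite ?mul1e ?mul0e.
Qed.

(** A law that is known only through the values of a density on sets integrates
    functions against that density: simple functions, then monotone limits. *)
Lemma integral_density (f : S -> \bar R) :
  measurable_fun setT f -> (forall x, 0 <= f x)%E ->
  (\int[m]_x f x = \int[mu]_x (f x * (p x)%:E))%E.
Proof.
move=> mf f0.
pose f_ := nnsfun_approx measurableT mf.
transitivity (lim (\int[m]_x (f_ n x)%:E @[n --> \oo])%E).
  rewrite -monotone_convergence//=.
  - apply: eq_integral => ? /[!inE] xD; apply/esym/cvg_lim => //=.
    exact: cvg_nnsfun_approx.
  - by move=> n; exact/measurable_EFinP/measurable_funTS.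
  - by move=> n ? _; rewrite lee_fin.
  - by move=> ? _ ? ? mn; rewrite lee_fin; exact/lefP/nd_nnsfun_approx.
transitivity (lim (\int[mu]_x ((f_ n x)%:E * (p x)%:E) @[n --> \oo])%E).
  by apply: congr_lim; apply/funext => n /=; exact: nnsfun_density.
rewrite -monotone_convergence//=.
- apply: eq_integral => x /[!inE] xD; apply/cvg_lim => //.
  have := @cvg_nnsfun_approx _ _ _ _ measurableT _ mf (fun x _ => f0 x) x xD.
  move=> cf.
  exact: cvgeZr.
- by move=> n; apply: emeasurable_funM => //; exact/measurable_EFinP/measurable_funTS.
- by move=> n ? _; rewrite mule_ge0// lee_fin.
- by move=> ? _ ? ? ?; rewrite lee_wpmul2r// lee_fin; exact/lefP/nd_nnsfun_approx.
Qed.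

End density.

Section almost_surely.
Context (R : realType) d (T : measurableType d) (P : probability T R).

Lemma ae_forall_countable (I : countType) (Q : I -> T -> Prop) :
  (forall i, {ae P, forall w, Q i w}) -> {ae P, forall w, forall i, Q i w}.
Proof.
move=> Q1; have /ae_foralln : forall n, {ae P, forall w, oapp (fun i => Q i w) True (unpickle n)}.
  by move=> n; case: (unpickle n) => [i|] /=; [exact: Q1|exact: aeW].
apply: filterS => w h i; by have := h (pickle i); rewrite pickleK.
Qed.

Lemma ae_prob1 (A : set T) : measurable A -> P A = 1%E -> {ae P, forall w, A w}.
Proof.
move=> mA PA; exists (~` A); split; first exact: measurableC.
  by rewrite probability_setC// PA subee.
by [].
Qed.

Lemma prob_ae_eq (A B : set T) : measurable A -> measurable B ->
  {ae P, forall w, A w <-> B w} -> P A = P B.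
Proof.
move=> mA mB AB; rewrite !prob_integral//; apply: ge0_ae_eq_integral => //.
- by apply/measurable_EFinP; exact: measurable_indic.
- by apply/measurable_EFinP; exact: measurable_indic.
- apply: filterS AB => w AB _ /=; rewrite !indicE; congr ((nat_of_bool _)%:R%:E).
  by apply/idP/idP => /set_mem/AB h; exact/mem_set.
Qed.

End almost_surely.

(** * Trees as functions of their sets of vertices *)

Section trees.

(** [tree_at b t w] is [tree_of] of the set of labels born by time [t w]. *)
Definition tree_of (V : set label) : drgraph :=
  DRGraph V [::] (fun u v => [/\ V u, V v & exists j, u = rcons v j]).

Definition contains (s : seq (seq nat)) : set (set label) :=
  [set V | forall i, i \in s -> V i].

Definition cylinders : set (set (set label)) := range contains.

Local Notation subsets := (g_sigma_algebraType cylinders).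

Lemma measurable_member (i : label) : measurable ([set V | V i] : set subsets).
Proof.
apply: sub_sigma_algebra; exists [:: i] => //.
by apply/seteqP; split => V /=; [apply; rewrite inE|move=> Vi j; rewrite inE => /eqP ->].
Qed.

Lemma measurable_bool (Q : Prop) : measurable ([set V | Q] : set subsets).
Proof.
have [q|q] := pselect Q.
  by rewrite (_ : mkset _ = setT)//; apply/seteqP; split.
by rewrite (_ : mkset _ = set0)//; apply/seteqP; split.
Qed.

Lemma measurable_ball_vertex r (v : label) :
  measurable ([set V | ball_vertex (tree_of V) r v] : set subsets).
Proof.
elim: r v => [|r IH] v /=.
  rewrite (_ : mkset _ = [set V | V v] `&` [set V | v = [::]])//.
  by apply: measurableI; [exact: measurable_member|exact: measurable_bool].
pose F u : set subsets := [set V | ball_vertex (tree_of V) r u] `&`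
  ([set V | V u] `&` [set V | (exists j, u = rcons v j) \/ (exists j, v = rcons u j)]).
rewrite (_ : mkset _ = [set V | ball_vertex (tree_of V) r v] `|`
   ([set V | V v] `&` [set V | exists u, F u V])).
  apply: measurableU => //; apply: measurableI; first exact: measurable_member.
  apply: (measurable_exists (I := seq nat)) => u; apply: measurableI => //.
  by apply: measurableI; [exact: measurable_member|exact: measurable_bool].
apply/seteqP; split=> V /= [Vv|].
- by left.
- move=> [Vv [u ru uv]]; right; split => //; exists u; split => //.
  by case: uv => -[? ? h]; split => //; [left|right].
- by left.
- move=> [Vv [u [ru [Vu uv]]]]; right; split => //; exists u => //.
  by case: uv => h; [left|right].
Qed.

Lemma ball_vertex_sub r V : ball_vertex (tree_of V) r `<=` V.
Proof.
elim: r => [|r IH] v /= []; first by [].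
  exact: IH.
by move=> [].
Qed.

Definition fixed_tree (s : seq (seq nat)) : drgraph :=
  DRGraph [set` s] [::] (fun u v => exists j, u = rcons v j).

(** Since [V] induces all arcs between its elements, a finite ball is determined
    by the list of its vertices. There are countably many lists, which makes the
    events that generate [local_borel] countable unions. *)
Lemma dr_iso_ballE r V H : finite_set (gvertex H) ->
  dr_iso (dr_ball r (tree_of V)) H <->
  exists2 s : seq (seq nat), ball_vertex (tree_of V) r = [set` s] & dr_iso (fixed_tree s) H.
Proof.
move=> fH; split => [[f [bij froot arc]]|[s sE [f [bij froot arc]]]].
  have : finite_set (ball_vertex (tree_of V) r).
    have [fH' finj fsurj] := bij.
    rewrite -(eq_finite_set (inj_card_eq finj)); apply: sub_finite_set fH.
    by move=> _ [v Bv <-]; exact: fH'.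
  move=> /(finite_seqP (T := seq nat))[s sE].
  exists s => //; exists f; split => //=; first by rewrite -sE.
  move=> u v us vs; have := arc u v; rewrite /= sE => /(_ us vs) <-.
  split => [h|[]//]; split => //; apply: (@ball_vertex_sub r); by rewrite sE.
exists f; split => //=; first by rewrite sE.
move=> u v; rewrite sE => us vs; rewrite -(arc u v us vs) /=.
by split => [[]//|h]; split => //; apply: (@ball_vertex_sub r); rewrite sE.
Qed.

Lemma measurable_tree_of (A : set drgraph) : local_borel A ->
  measurable (tree_of @^-1` A : set subsets).
Proof.
pose F : set (set drgraph) := [set A | measurable (tree_of @^-1` A : set subsets)].
suff : local_borel `<=` F by move=> h /h.
apply: smallest_sub; first split.
- by rewrite /F /= preimage_set0.
- by move=> B FB; rewrite /F /= setTD preimage_setC; exact: measurableC.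
- by move=> B FB; rewrite /F /= preimage_bigcup; exact: bigcupT_measurable.
move=> _ [r [H [fH ->]]]; rewrite /F /=.
pose E (s : seq (seq nat)) : set subsets := [set V | forall v : seq nat,
  if v \in s then ball_vertex (tree_of V) r v else ~ ball_vertex (tree_of V) r v].
have mE s : measurable (E s).
  apply: (@measurable_forall _ subsets (seq nat) (fun v => [set V | if v \in s
    then ball_vertex (tree_of V) r v else ~ ball_vertex (tree_of V) r v])) => v.
  case: (v \in s).
    exact: measurable_ball_vertex.
  by apply: measurableC; exact: measurable_ball_vertex.
have EE s V : E s V <-> ball_vertex (tree_of V) r = [set` s].
  split => [EV|sE v]; last by case: ifPn => vs; rewrite sE //=; exact/negP.
  by apply/seteqP; split => v /= h; have := EV v; [case: ifP|rewrite h].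
rewrite [X in measurable X](_ : _ = [set V | exists s, (E s `&` [set V | dr_iso (fixed_tree s) H]) V]).
  apply: (@measurable_exists _ subsets) => s.
  by apply: measurableI; [exact: mE|exact: measurable_bool].
apply/seteqP; split => V /=.
  by move=> /(dr_iso_ballE _ _ fH)[s /EE Es iso]; exists s.
by move=> [s [/EE Es iso]]; apply/(dr_iso_ballE _ _ fH); exists s.
Qed.

(** The events that all labels of a finite list belong to [V] are stable under
    intersection and generate a sigma-algebra that makes [tree_of] measurable. *)
Lemma eq_in_distribution_trees (R : realType)
    d (T : measurableType d) (P : probability T R)
    (b : label -> T -> \bar R) (t : T -> R)
    d' (T' : measurableType d') (P' : probability T' R)
    (b' : label -> T' -> \bar R) (t' : T' -> R) :
  (forall i, measurable [set w | (b i w <= (t w)%:E)%E]) ->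
  (forall i, measurable [set w | (b' i w <= (t' w)%:E)%E]) ->
  (forall s : seq (seq nat), P [set w | forall i, i \in s -> (b i w <= (t w)%:E)%E] =
     P' [set w | forall i, i \in s -> (b' i w <= (t' w)%:E)%E]) ->
  eq_in_distribution P (tree_at b t) P' (tree_at b' t').
Proof.
move=> mb mb' PP' A lA.
pose X w : set label := [set i | (b i w <= (t w)%:E)%E].
pose X' w : set label := [set i | (b' i w <= (t' w)%:E)%E].
have mX E : cylinders E -> measurable (X @^-1` E).
  move=> [s _ <-].
  rewrite [X in measurable X](_ : _ = \bigcap_(i in [set` s]) [set w | (b i w <= (t w)%:E)%E]).
    by apply: fin_bigcap_measurable => // i _; exact: mb.
  by apply/seteqP; split.
have mX' E : cylinders E -> measurable (X' @^-1` E).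
  move=> [s _ <-].
  rewrite [X in measurable X](_ : _ = \bigcap_(i in [set` s]) [set w | (b' i w <= (t' w)%:E)%E]).
    by apply: fin_bigcap_measurable => // i _; exact: mb'.
  by apply/seteqP; split.
have mA := measurable_tree_of lA.
split.
- by have := measurable_fun_generated mX measurableT mA; rewrite setTI.
- by have := measurable_fun_generated mX' measurableT mA; rewrite setTI.
suff h : P (X @^-1` (tree_of @^-1` A) `&` setT) =
    (1%:E * P' (X' @^-1` (tree_of @^-1` A)))%E by move: h; rewrite setIT mul1e.
apply: (@laws_agree R (set label) cylinders _ _ d T P d' T' P' X X' setT 1%:nng _ _ _ _ _ _ mA) => //.
- move=> _ _ [s1 _ <-] [s2 _ <-]; exists (s1 ++ s2) => //.
  apply/seteqP; split => [V h|V [h1 h2] i].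
    by split => i si; apply: h; rewrite mem_cat si ?orbT.
  by rewrite mem_cat => /orP[/h1|/h2].
- by exists [::] => //; apply/seteqP; split.
- by apply: (le_lt_trans (probability_le1 P measurableT)); rewrite ltry.
- by move=> _ [s _ <-]; rewrite mul1e setIT; exact: PP'.
Qed.

End trees.

(** * Dyadic codes of broods *)

Section dyadic.
Context (R : realType).
Implicit Types (y : R) (l q : nat).

Definition dyad l q : R := q%:R / 2 ^+ l.

Lemma ler_dyad l : {mono dyad l : p q / (p <= q)%N >-> p <= q}.
Proof. by move=> p q; rewrite /dyad ler_pM2r ?invr_gt0 ?exprn_gt0// ler_nat. Qed.

Lemma dyad_refine l k q : dyad l q = dyad (l + k) (q * 2 ^ k).
Proof.
by rewrite /dyad exprD natrM natrX invfM; field; rewrite !expf_neq0.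
Qed.

Lemma dyad_top l : dyad l (2 ^ l) = 1.
Proof. by rewrite /dyad natrX divff// expf_neq0. Qed.

Lemma dyad_le1 l q : (q <= 2 ^ l)%N -> dyad l q <= 1.
Proof. by rewrite -(dyad_top l) ler_dyad. Qed.

Lemma dyad0 l : dyad l 0 = 0.
Proof. by rewrite /dyad mul0r. Qed.

Lemma dyad_ge0 l q : 0 <= dyad l q.
Proof. by rewrite -(dyad0 l) ler_dyad. Qed.

Definition in_cell l q y : bool := (dyad l q < y) && (y <= dyad l q.+1).

(** The [q] such that [q / 2 ^ l < y <= (q + 1) / 2 ^ l], for [y > 0]. Cells are
    closed on the right, because what matters in the end is whether [y <= 1]. *)
Definition cell l y : nat := (`|Num.ceil (y * 2 ^+ l)|).-1.

Lemma cell_ltE l q y : 0 < y -> (cell l y < q)%N = (y <= dyad l q).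
Proof.
move=> y0; rewrite /dyad ler_pdivlMr ?exprn_gt0//.
have c0 : 0 < Num.ceil (y * 2 ^+ l) by rewrite ceil_gt0 mulr_gt0// exprn_gt0.
rewrite -[q%:R]/(q%:Z%:~R) -ceil_le_int /cell.
by case: (Num.ceil _) c0 => // -[|n] // _; rewrite absz_nat lez_nat.
Qed.

Lemma in_cellE l q y : 0 < y -> in_cell l q y = (cell l y == q).
Proof.
move=> y0; rewrite /in_cell ltNge -!cell_ltE//.
by rewrite -leqNgt eqn_leq ltnS andbC.
Qed.

Lemma cell_coarsen l k y : 0 < y -> cell l y = (cell (l + k) y %/ 2 ^ k)%N.
Proof.
move=> y0; have h q : (cell l y < q)%N = (cell (l + k) y %/ 2 ^ k < q)%N.
  by rewrite cell_ltE// (dyad_refine l k) -cell_ltE// ltn_divLR// expn_gt0.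
by have := h (cell l y).+1; have := h (cell (l + k) y %/ 2 ^ k).+1; lia.
Qed.

Lemma cell_top l y : 0 < y -> (cell l y < 2 ^ l)%N = (y <= 1).
Proof. by move=> y0; rewrite cell_ltE// dyad_top. Qed.

Lemma dyad_dense x y : 0 <= x -> x < y -> y <= 1 ->
  exists l q, [/\ (q <= 2 ^ l)%N, x <= dyad l q & dyad l q < y].
Proof.
move=> x0 xy y1; have y0 : 0 < y by lra.
pose l := Num.bound (y - x)^-1; exists l, (cell l y).
split; first by apply/ltnW; rewrite cell_top.
- have : y <= dyad l (cell l y).+1 by rewrite -cell_ltE.
  rewrite /dyad -natr1 mulrDl mul1r.
  have : (2 ^+ l)^-1 < y - x.
    rewrite -[ltRHS]invrK ltf_pV2 ?posrE ?exprn_gt0 ?invr_gt0 ?subr_gt0//.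
    exact: upper_nthrootP.
  by lra.
- by rewrite ltNge -cell_ltE// ltnn.
Qed.

End dyadic.

Section births.
Context (R : realType).

(** Positions of all individuals, on the scale where the tree is observed at
    position 1; the value 2 stands for every individual that is not born by then.
    Each brood is finite up to position 1. *)
Record births := Births {
  bval :> label -> R;
  births_range : forall i, 0 < bval i <= 1 \/ bval i = 2;
  births_mono : forall i j, bval (rcons i j) <= bval (rcons i j.+1);
  births_late : forall i, exists j, bval (rcons i j) == 2 }.

(** Sigma-algebras are generated on pointed types. *)
Definition stillborn : births.
Proof.
exists (fun=> 2) => // [i|i]; first by right.
by exists 0%N.
Defined.

HB.instance Definition _ := gen_eqMixin births.
HB.instance Definition _ := gen_choiceMixin births.
HB.instance Definition _ := isPointed.Build births stillborn.

Implicit Types (x : births) (i : seq nat).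

Lemma births_gt0 x i : 0 < x i.
Proof. by have [/andP[]//|->] := births_range x i. Qed.

Lemma births_lt x i : (x i == 2) = (1 < x i).
Proof. by have [/andP[_ h]|->] := births_range x i; [apply/eqP/idP; lra|rewrite eqxx; lra]. Qed.

Lemma births_le x i j k : (j <= k)%N -> x (rcons i j) <= x (rcons i k).
Proof.
move=> /subnK <-; elim: (k - j)%N => // n IH.
exact: le_trans IH (births_mono _ _ _).
Qed.

Definition offspring x i : nat := ex_minn (births_late x i).

Lemma offspringP x i j : (j < offspring x i)%N = (x (rcons i j) <= 1).
Proof.
rewrite /offspring; case: ex_minnP => m xm mmin.
rewrite leNgt -births_lt.
apply/idP/idP => [jm|]; first by apply/negP => /mmin; rewrite leqNgt jm.
apply: contraR; rewrite -leqNgt => /(births_le x i).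
by rewrite (eqP xm) births_lt; lra.
Qed.

(** The cells of the children of [i] with position at most 1, in order of birth.
    Its length is their number. *)
Definition code l x i : seq nat :=
  [seq cell l (x (rcons i j)) | j <- iota 0 (offspring x i)].

Lemma size_code l x i : size (code l x i) = offspring x i.
Proof. by rewrite size_map size_iota. Qed.

Lemma nth_code l x i j : (j < offspring x i)%N ->
  nth 0%N (code l x i) j = cell l (x (rcons i j)).
Proof. by move=> jx; rewrite (nth_map 0%N) ?size_iota// nth_iota. Qed.

Definition valid_code l (s : seq nat) := sorted leq s && all (fun q => q < 2 ^ l)%N s.

Lemma cell_mono l (y z : R) : 0 < y -> y <= z -> (cell l y <= cell l z)%N.
Proof.
move=> y0 yz; rewrite -ltnS cell_ltE//; apply: (le_trans yz).
by rewrite -cell_ltE ?(lt_le_trans y0 yz).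
Qed.

Lemma code_valid l x i : valid_code l (code l x i).
Proof.
apply/andP; split.
  apply/(sortedP 0%N) => j; rewrite size_code => jx.
  rewrite !nth_code//; last exact: ltnW.
  by apply: cell_mono; [exact: births_gt0|exact: births_mono].
apply/(all_nthP 0%N) => j; rewrite size_code => jx.
by rewrite nth_code// cell_top ?births_gt0// -offspringP.
Qed.

(** Codes at all resolutions are nested, which makes events about codes stable
    under intersection. *)
Lemma code_coarsen l k x i :
  code l x i = [seq (q %/ 2 ^ k)%N | q <- code (l + k) x i].
Proof.
rewrite /code -map_comp; apply: eq_map => j /=.
by rewrite (cell_coarsen l k) ?births_gt0.
Qed.

(** Since children come in order, the first child outside the list decides that
    there are no more. *)
Lemma codeP l x i s : all (fun q => q < 2 ^ l)%N s ->
  reflect ((forall j, (j < size s)%N -> in_cell l (nth 0%N s j) (x (rcons i j))) /\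
    1 < x (rcons i (size s))) (code l x i == s).
Proof.
move=> /(all_nthP 0%N) sl; apply: (iffP eqP) => [<-|[h1 h2]].
  rewrite size_code; split; last by rewrite ltNge -offspringP ltnn.
  by move=> j jx; rewrite nth_code// in_cellE ?births_gt0.
have so : size (code l x i) = size s.
  rewrite size_code; apply/eqP; rewrite eqn_leq.
  rewrite leqNgt offspringP -ltNge h2 /=.
  case: (posnP (size s)) => [->//|s0]; rewrite -(prednK s0) offspringP.
  have := h1 (size s).-1; rewrite prednK// => /(_ (leqnn _)) /andP[_ h].
  by apply: le_trans h _; apply/dyad_le1/sl; rewrite prednK.
apply: (@eq_from_nth _ 0%N) => // j; rewrite size_code => jx.
rewrite nth_code//; apply/eqP; rewrite -in_cellE ?births_gt0//; apply: h1.
by rewrite -so size_code.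
Qed.

Lemma code_le l x i j q : (q <= 2 ^ l)%N -> (x (rcons i j) <= dyad R l q) =
  (j < size (code l x i))%N && (nth 0%N (code l x i) j < q)%N.
Proof.
move=> ql; rewrite size_code; have [jx|jx] := ltnP j (offspring x i); last first.
  apply/negbTE; rewrite -ltNge (le_lt_trans (dyad_le1 R ql))//.
  by rewrite ltNge -offspringP -leqNgt.
by rewrite nth_code//= cell_ltE ?births_gt0.
Qed.

Definition born_before (n : nat) : set (set births) :=
  [set E | exists i l q, [/\ (size (i : seq nat) <= n)%N, (q <= 2 ^ l)%N &
    E = [set x : births | x i <= dyad R l q]]].

Notation births_to n := (g_sigma_algebraType (born_before n)).

(** The events of [born_before] only test dyadic thresholds in [0, 1]; these
    suffice because the values lie in [0, 1] or equal 2. *)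
Lemma measurable_births n (i : seq nat) : (size i <= n)%N ->
  measurable_fun setT (fun x : births_to n => x i).
Proof.
move=> sin; apply: (measurability (@RGenOInfty.G R)).
  exact: RGenOInfty.measurableE.
move=> _ [_ [g ->] <-]; rewrite setTI.
have mq l q : (q <= 2 ^ l)%N ->
    measurable ([set x : births | dyad R l q < x i] : set (births_to n)).
  move=> ql; rewrite (_ : mkset _ = ~` [set x : births | x i <= dyad R l q]).
    apply: measurableC; apply: sub_sigma_algebra; by exists i, l, q.
  by apply/seteqP; split => x /=; rewrite ltNge => /negP.
have [g0|g0] := ltP g 0.
  rewrite (_ : _ @^-1` _ = setT)//; apply/seteqP; split => x //= _.
  by rewrite in_itv /= andbT (lt_trans g0)// births_gt0.
have [g2|g2] := leP 2 g.
  rewrite (_ : _ @^-1` _ = set0)//; apply/seteqP; split => x //=.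
  rewrite in_itv /= andbT; have [/andP[_]|->] := births_range x i; lra.
pose F (lq : nat * nat) : set (births_to n) :=
  if (lq.2 <= 2 ^ lq.1)%N && (g <= dyad R lq.1 lq.2)
  then [set x : births | dyad R lq.1 lq.2 < x i] else set0.
rewrite (_ : _ @^-1` _ = [set x : births | dyad R 0 (2 ^ 0) < x i] `|`
    [set x | exists lq, F lq x]).
  apply: measurableU; first exact: mq.
  apply: (@measurable_exists _ (births_to n)) => -[l q]; rewrite /F /=.
  case: ifP => [/andP[ql _]|_]; [exact: mq|exact: measurable0].
apply/seteqP; split => x /=; rewrite in_itv /= andbT dyad_top.
  move=> gx; have [/andP[x0 x1]|->] := births_range x i; last by left; lra.
  have [l [q [ql gl lx]]] := dyad_dense g0 gx x1.
  by right; exists (l, q); rewrite /F /= ql gl.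
move=> [|[[l q]]]; last by rewrite /F /=; case: ifP => // /andP[_ gl]; exact: le_lt_trans.
by rewrite -births_lt => /eqP ->.
Qed.

End births.

(** * The law of a branching structure *)

Section generations.
Context (R : realType).
Local Notation births := (births R).
Notation births_to n := (g_sigma_algebraType (@born_before R n)).
Implicit Types (x : births) (i : seq nat).

(** The individuals of generation [n] among the first [l] labels. The parameter
    [l] is also the resolution of the codes, so that both grow together and every
    statement about the next generation is seen for large [l]. *)
Definition individuals (n l : nat) : seq (seq nat) :=
  [seq i <- pmap pickle_inv (iota 0 l) | size (i : seq nat) == n].

Lemma individuals_uniq n l : uniq (individuals n l).
Proof.
apply: filter_uniq; apply: (pmap_uniq (g := pickle)); last exact: iota_uniq.
exact: pickle_invK.
Qed.

Lemma mem_individuals n l i :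
  (i \in individuals n l) = (size i == n) && (pickle i < l)%N.
Proof.
rewrite mem_filter; congr (_ && _); rewrite mem_pmap.
apply/mapP/idP => [[k]|il]; last by exists (pickle i); rewrite ?pickleK_inv ?mem_iota.
rewrite mem_iota add0n => /andP[_ kl] /esym ik.
by have := pickle_invK (T := seq nat) k; rewrite /ocancel ik /= => ->.
Qed.

Definition atom (n l : nat) (K : seq nat -> seq nat) : set births :=
  [set x | forall i, i \in individuals n l -> code l x i = K i].

Definition valid_codes n l (K : seq nat -> seq nat) : Prop :=
  forall i, i \in individuals n l -> valid_code l (K i).

Lemma valid_code_bound l (s : seq nat) : valid_code l s -> all (fun q => q < 2 ^ l)%N s.
Proof. by case/andP. Qed.

Lemma measurable_le n i (c : R) : (size i <= n)%N ->
  measurable ([set x : births | x i <= c] : set (births_to n)).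
Proof.
move=> sin; have := measurable_births sin measurableT (measurable_itv `]-oo, c]).
by rewrite setTI; congr measurable; apply/seteqP; split => x /=; rewrite in_itv.
Qed.

Lemma measurable_gt n i (c : R) : (size i <= n)%N ->
  measurable ([set x : births | c < x i] : set (births_to n)).
Proof.
move=> sin; rewrite (_ : mkset _ = ~` [set x : births | x i <= c]).
  by apply: measurableC; exact: measurable_le.
by apply/seteqP; split => x /=; rewrite ltNge => /negP.
Qed.

Lemma measurable_code n l i s : size i = n -> valid_code l s ->
  measurable ([set x : births | code l x i = s] : set (births_to n.+1)).
Proof.
move=> sin /valid_code_bound vs.
have sz j : (size (rcons i j) <= n.+1)%N by rewrite size_rcons sin.
rewrite (_ : mkset _ = [set x : births | forall j, ([set x : births | dyad R l (nth 0%N s j) < x (rcons i j)]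
  `&` [set x | x (rcons i j) <= dyad R l (nth 0%N s j).+1] `|` (if (j < size s)%N then set0 else setT)) x]
  `&` [set x | 1 < x (rcons i (size s))]).
  apply: measurableI; last exact: measurable_gt.
  apply: (@measurable_forall _ (births_to n.+1)) => j.
  apply: measurableU; last by case: ifP.
  by apply: measurableI; [exact: measurable_gt|exact: measurable_le].
apply/seteqP; split => x /=.
  move=> /eqP/(codeP _ _ vs)[h1 h2]; split => // j; case: ifP => js; last by right.
  by left; move: (h1 _ js) => /andP[].
move=> [h1 h2]; apply/eqP/codeP => //; split => // j js.
by move: (h1 j); rewrite js => -[[a b]|//]; rewrite /in_cell a b.
Qed.

Lemma measurable_atom n l K : valid_codes n l K ->
  measurable (atom n l K : set (births_to n.+1)).
Proof.
move=> vK.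
rewrite (_ : atom n l K = \bigcap_(i in [set` individuals n l]) [set x : births | code l x i = K i]).
  apply: fin_bigcap_measurable => // i /= il; apply: measurable_code; last exact: vK.
  by move: il; rewrite mem_individuals => /andP[/eqP].
by apply/seteqP; split.
Qed.

(** Events about the generations up to [n], together with the codes of finitely
    many broods of generation [n]. *)
Definition coded_events (n : nat) : set (set births) :=
  [set A | exists l K E, [/\ <<s @born_before R n >> E, valid_codes n l K &
    A = E `&` atom n l K]].

Lemma born_before_S n (E : set births) :
  <<s @born_before R n >> E -> <<s @born_before R n.+1 >> E.
Proof.
apply: smallest_sub; first exact: smallest_sigma_algebra.
move=> _ [i [l [q [si ql ->]]]]; apply: sub_sigma_algebra; exists i, l, q.
by split => //; exact: leqW.
Qed.

Lemma coded_events_measurable n E : coded_events n E -> <<s @born_before R n.+1 >> E.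
Proof.
move=> [l [K [A [mA vK ->]]]].
apply: (@measurableI _ (births_to n.+1)); first exact: born_before_S.
exact: measurable_atom.
Qed.

(** The coarser of two prescriptions of codes is either implied by the finer one or
    incompatible with it. *)
Lemma coded_events_setI n : setI_closed (coded_events n).
Proof.
suff main l K E l' K' E' : (l <= l')%N -> <<s @born_before R n >> E -> valid_codes n l K ->
    <<s @born_before R n >> E' -> valid_codes n l' K' ->
    coded_events n ((E `&` atom n l K) `&` (E' `&` atom n l' K')).
  move=> _ _ [l [K [E [mE vK ->]]]] [l' [K' [E' [mE' vK' ->]]]].
  by have [ll'|/ltnW l'l] := leqP l l'; [|rewrite setIC]; exact: main.
move=> ll' mE vK mE' vK'.
have mEE : <<s @born_before R n >> (E `&` E') by exact: (@measurableI _ (births_to n)).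
have sub i : i \in individuals n l -> i \in individuals n l'.
  by rewrite !mem_individuals => /andP[-> /= h]; exact: leq_trans ll'.
have [comp|ncomp] := pselect (forall i, i \in individuals n l ->
    K i = [seq (q %/ 2 ^ (l' - l))%N | q <- K' i]).
  exists l', K', (E `&` E'); split => //.
  apply/seteqP; split => x; first by move=> [[? _] [? ?]].
  move=> [[Ex E'x] ax]; split; split => // i il.
  by rewrite (code_coarsen l (l' - l)) subnKC// ax ?comp//; exact: sub.
exists l', K', set0; split => //; first exact: (@measurable0 _ (births_to n)).
rewrite set0I; apply/seteqP; split => // x [[_ ax] [_ ax']]; apply: ncomp => i il.
by rewrite -(ax _ il) (code_coarsen l (l' - l)) subnKC// ax' //; exact: sub.
Qed.

Lemma coded_events_old n E : <<s @born_before R n >> E -> coded_events n E.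
Proof.
move=> mE; exists 0%N, (fun=> [::]), E; split => //.
by rewrite (_ : atom _ _ _ = setT) ?setIT//; apply/seteqP; split.
Qed.

(** Whether the [j]-th child of [i] is below a dyadic level can be read off the code of
    [i] at a resolution fine enough to see both the level and [i]. *)
Lemma born_before_coded_events n E : <<s @born_before R n.+1 >> E -> <<s coded_events n >> E.
Proof.
apply: smallest_sub; first exact: smallest_sigma_algebra.
move=> _ [i [l [q [si ql ->]]]].
move: si; rewrite leq_eqVlt ltnS => /orP[/eqP si|si]; last first.
  apply: sub_sigma_algebra; apply: coded_events_old; exact: measurable_le.
case/lastP: i si => // i j; rewrite size_rcons => -[si].
(* A resolution at which [i] is listed and the level is still dyadic. *)
pose l' := (l + (pickle i).+1)%N.
have il' : i \in individuals n l' by rewrite mem_individuals si eqxx /= /l' addnS ltnS leq_addl.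
pose qq := (q * 2 ^ (pickle i).+1)%N.
have qql : (qq <= 2 ^ l')%N by rewrite /qq /l' expnD leq_mul2r ql orbT.
pose Kf (K : seq (seq nat)) i := nth [::] K (index i (individuals n l')).
pose F (K : seq (seq nat)) : set births :=
  if (all (fun i => valid_code l' (Kf K i)) (individuals n l')) &&
     (j < size (Kf K i))%N && (nth 0%N (Kf K i) j < qq)%N
  then atom n l' (Kf K) else set0.
rewrite (_ : mkset _ = [set x | exists K, F K x]).
  apply: (@measurable_exists _ (g_sigma_algebraType (coded_events n))) => K.
  rewrite /F; case: ifP; last by move=> _; exact: measurable0.
  move=> /andP[/andP[/allP vK _] _]; apply: sub_sigma_algebra.
  exists l', (Kf K), setT; split => //; last by rewrite setTI.
  exact: (@measurableT _ (births_to n)).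
rewrite (dyad_refine _ l (pickle i).+1) -/l' -/qq.
apply/seteqP; split => x /=.
  rewrite code_le// => /andP[h1 h2].
  pose K := [seq code l' x i' | i' <- individuals n l'].
  have KE i' : i' \in individuals n l' -> Kf K i' = code l' x i'.
    move=> h; rewrite /Kf /K (nth_map [::]) ?index_mem// nth_index//.
  exists K; rewrite /F KE// h1 h2 !andbT ifT.
    by move=> i' h; rewrite KE.
  by apply/allP => i' h; rewrite KE//; exact: code_valid.
move=> [K]; rewrite /F; case: ifP => // /andP[/andP[_ h1] h2] ax.
by rewrite code_le// ax ?h1 ?h2.
Qed.

Section model.
Context d (T : measurableType d) (P : probability T R) dG (G : measurableType dG).

Definition marks_in (g : seq nat -> T -> G) (s : seq (seq nat)) (D : seq nat -> set G) : set T :=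
  [set w | forall i, i \in s -> D i (g i w)].

(** Positions [z] and marks [g] such that, given the positions in generations up
    to [n] and all marks, the broods of generation [n] are independent, and an
    individual at [u] with mark [y] has a brood of code [s] with conditional
    probability [f l s u y]. The marks are independent of each other and of the
    root. [W] is the average of [f] over the mark. [br_step] is the
    conditional law integrated over an event about the generations up to [n] and
    the marks of later generations; this is the form in which the induction of
    [generation_independent] uses it. *)
Record branching (z : T -> births) (g : seq nat -> T -> G)
   (f : nat -> seq nat -> R -> G -> \bar R) (W : nat -> seq nat -> R -> \bar R) : Prop := {
  br_births : forall i, measurable_fun setT (fun w => z w i);
  br_marks : forall i, measurable_fun setT (g i);
  br_root : forall (E : set R) s D, measurable E -> uniq s -> (forall i, measurable (D i)) ->
    P ([set w | E (z w [::])] `&` marks_in g s D) =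
      (P [set w | E (z w [::])] * \prod_(i <- s) P (g i @^-1` D i))%E;
  br_kernel : forall l s, measurable_fun setT (fun xy => f l s xy.1 xy.2);
  br_kernel0 : forall l s (u : R) y, (0 <= f l s u y)%E;
  br_step : forall n l K s D E, <<s @born_before R n >> E -> valid_codes n l K ->
    uniq s -> {in s, forall i, (n < size i)%N} -> (forall i, measurable (D i)) ->
    P ((z @^-1` E `&` marks_in g s D) `&` z @^-1` atom n l K) =
    (\int[P]_(w in z @^-1` E `&` marks_in g s D)
       \prod_(i <- individuals n l) f l (K i) (z w i) (g i w))%E;
  br_mean : forall l s i (u : R), valid_code l s -> 0 < u ->
    (\int[P]_w f l s u (g i w))%E = W l s u }.

Variables (z : T -> births) (g : seq nat -> T -> G)
   (f : nat -> seq nat -> R -> G -> \bar R) (W : nat -> seq nat -> R -> \bar R).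
Hypothesis br : branching z g f W.

Lemma measurable_births_fun n : measurable_fun setT (z : T -> births_to n).
Proof.
apply: measurable_fun_generated => _ [i [l [q [_ _ ->]]]].
have := br_births br i measurableT (measurable_itv `]-oo, (dyad R l q)]).
by rewrite setTI; congr measurable; apply/seteqP; split => w /=; rewrite in_itv.
Qed.

Lemma measurable_births_pre n E : <<s @born_before R n >> E -> measurable (z @^-1` E).
Proof. by move=> mE; have := measurable_births_fun (n := n) measurableT mE; rewrite setTI. Qed.

Lemma measurable_marks s D : (forall i, measurable (D i)) -> measurable (marks_in g s D).
Proof. move=> mD; apply: measurable_forall_in => //; exact: (br_marks br). Qed.

Lemma mean_births_ge0 l s i x : valid_code l s -> (0 <= W l s (x i))%E.
Proof.
move=> vs; rewrite -(br_mean br i vs (births_gt0 x i)).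
by apply: integral_ge0 => w _; exact: (br_kernel0 br).
Qed.

Lemma measurable_mean_births n l s i : (size i <= n)%N -> valid_code l s ->
  measurable_fun setT (fun x : births_to n => W l s (x i)).
Proof.
move=> sin vs.
apply: (eq_measurable_fun (fun x : births_to n => (\int[P]_w f l s (x i) (g i w))%E)).
  by move=> x _; apply: (br_mean br) => //; exact: births_gt0.
apply: (@measurable_integral_param _ _ _ P _ (births_to n) _ _ (g i) (fun x y => f l s (x i) y)).
- exact: (br_marks br).
- apply: (measurable_fun_comp2 (br_kernel br l s)) => //.
  exact: (measurableT_comp (measurable_births sin)).
- by move=> *; exact: (br_kernel0 br).
Qed.

Definition mean_product n l (K : seq nat -> seq nat) (x : births_to n) : \bar R :=
  (\prod_(i <- individuals n l) W l (K i) (x i))%E.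

Lemma mean_product_ge0 n l K x : valid_codes n l K -> (0 <= mean_product l K (x : births_to n))%E.
Proof.
move=> vK; rewrite /mean_product big_seq prode_ge0// => i il.
exact: mean_births_ge0 (vK _ il).
Qed.

Lemma measurable_mean_product n l K : valid_codes n l K ->
  measurable_fun setT (@mean_product n l K).
Proof.
move=> vK.
pose F i : births_to n -> \bar R :=
  if i \in individuals n l then (fun x => W l (K i) (x i)) else cst 0%E.
apply: (eq_measurable_fun (fun x : births_to n => \prod_(i <- individuals n l) F i x)%E).
  by move=> x _; apply: eq_big_seq => i il; rewrite /F il.
apply: emeasurable_prod => i; rewrite /F; case: ifPn => // il.
apply: measurable_mean_births; last exact: vK.
by move: il; rewrite mem_individuals => /andP[/eqP->].
Qed.

(** Under the conditional law of [br_step], the marks of generation [n] can be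
    averaged and those of later generations factor out, provided that these marks
    are independent of the generations up to [n]. *)
Lemma step_product n l K s D E : <<s @born_before R n >> E -> valid_codes n l K ->
    uniq s -> {in s, forall i, (n < size i)%N} -> (forall i, measurable (D i)) ->
  jointly_independent P (z : T -> births_to n) g (individuals n l ++ s) ->
  P ((z @^-1` E `&` marks_in g s D) `&` z @^-1` atom n l K) =
  ((\int[P]_(w in z @^-1` E) mean_product l K (z w : births_to n)) *
    \prod_(i <- s) P (g i @^-1` D i))%E.
Proof.
move=> mE vK us sn mD ind; rewrite (br_step br)//.
have mzE := measurable_births_pre mE; have mM := measurable_marks s mD.
have msz i : i \in individuals n l -> (size i <= n)%N.
  by rewrite mem_individuals => /andP[/eqP->].
have us' : uniq (individuals n l ++ s).
  rewrite cat_uniq individuals_uniq us andbT /=; apply/hasPn => i /sn ni.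
  by rewrite mem_individuals; apply/negP => /andP[/eqP e]; rewrite e ltnn in ni.
pose F i : births_to n -> G -> \bar R := if i \in individuals n l
  then (fun x y => f l (K i) (x i) y) else (fun x y => (\1_(D i) y)%:E).
have mF i : measurable_fun setT (fun xy : births_to n * G => F i xy.1 xy.2).
  rewrite /F; case: ifPn => il.
    apply: (measurable_fun_comp2 (br_kernel br l (K i))) => //.
    by apply: (measurableT_comp (measurable_births (msz _ il))).
  apply/measurable_EFinP; apply: (measurableT_comp (measurable_indic (mD i))).
  exact: measurable_snd.
have F0 i x y : (0 <= F i x y)%E.
  by rewrite /F; case: ifP => _; [exact: (br_kernel0 br)|rewrite lee_fin].
pose phi : births_to n -> \bar R := fun x => (\1_E x)%:E.
have mphi : measurable_fun setT phi.
  by apply/measurable_EFinP; exact: measurable_indic.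
transitivity (\int[P]_w (phi (z w) * \prod_(i <- individuals n l ++ s) F i (z w) (g i w)))%E.
  rewrite integral_mkcond; apply: eq_integral => w _.
  rewrite patchE big_cat /= [X in (_ = phi _ * (_ * X))%E](_ : _ = (\1_(marks_in g s D) w)%:E); last first.
    rewrite -prod_indic_marks; apply: eq_big_seq => i /sn ni; rewrite /F ifN// mem_individuals.
    by apply/negP => /andP[/eqP e]; rewrite e ltnn in ni.
  rewrite [X in (_ = phi _ * (X * _))%E](_ : _ =
      \prod_(i <- individuals n l) f l (K i) (z w i) (g i w))%E; last first.
    by apply: eq_big_seq => i il; rewrite /F il.
  rewrite muleCA -EFinM /phi !indicE -natrM mulnb.
  rewrite (_ : (z w \in E) && (w \in marks_in g s D) = (w \in z @^-1` E `&` marks_in g s D)).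
    by case: ifP => _; rewrite ?mule1 ?mule0.
  by rewrite in_setI.
rewrite (@integrate_out _ _ _ P _ _ _ g _ (br_marks br) us' _ (births_to n) z phi F)//; last 2 first.
- exact: measurable_births_fun.
- by move=> x; rewrite lee_fin.
pose c := (\prod_(i <- s) P (g i @^-1` D i))%E.
transitivity (\int[P]_w (c * (phi (z w) * mean_product l K (z w : births_to n))))%E.
  apply: eq_integral => w _; rewrite big_cat /= muleA [RHS]muleC; congr (_ * _ * _)%E.
    apply: eq_big_seq => i il; rewrite /F il; apply: (br_mean br); [exact: vK|exact: births_gt0].
  apply: eq_big_seq => i /sn ni; rewrite /F ifN; last first.
    by rewrite mem_individuals; apply/negP => /andP[/eqP e]; rewrite e ltnn in ni.
  have mgD : measurable (g i @^-1` D i).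
    by rewrite -[X in measurable X]setTI; exact: (br_marks br).
  transitivity (\int[P]_w' (\1_(g i @^-1` D i) w')%:E)%E.
    by apply: eq_integral => w' _; rewrite !indicE.
  by rewrite integral_indic// setIT.
have mg i : measurable (g i @^-1` D i).
  by rewrite -[X in measurable X]setTI; exact: (br_marks br).
have mW : measurable_fun setT (fun w => (phi (z w) * mean_product l K (z w : births_to n))%E).
  apply: emeasurable_funM; first exact: (measurableT_comp mphi (@measurable_births_fun n)).
  exact: (measurableT_comp (measurable_mean_product vK) (@measurable_births_fun n)).
rewrite ge0_integralZl//; last 2 first.
- by move=> w _; rewrite mule_ge0 ?lee_fin//; exact: mean_product_ge0.
- exact: prode_ge0.
rewrite muleC; congr (_ * _)%E.
rewrite [RHS]integral_mkcond; apply: eq_integral => w _.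
rewrite patchE /phi indicE.
rewrite (_ : (w \in z @^-1` E) = (z w \in E))//.
by case: ifP => _; rewrite ?mul1e ?mul0e.
Qed.

(** By induction on [n]: generation [n + 1] is built from the generations up to
    [n] and the marks of generation [n], hence remains independent of the marks of
    later individuals. *)
Lemma generation_independent n s : uniq s -> {in s, forall i, (n <= size i)%N} ->
  jointly_independent P (z : T -> births_to n) g s.
Proof.
elim: n s => [|n IH] s us sn E D mE mD.
  have [E' mE' <-] : preimage_set_system setT (fun x : births => x [::]) measurable E.
    move: mE; apply: smallest_sub; first exact/sigma_algebra_preimage/sigma_algebra_measurable.
    move=> _ [i [l [q [si ql ->]]]]; exists `]-oo, dyad R l q]%classic => //.
    by case: i si => // _; rewrite setTI; apply/seteqP; split => x /=; rewrite in_itv.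
  by rewrite setTI; exact: (br_root br).
have mg i : measurable (g i @^-1` D i).
  by rewrite -[X in measurable X]setTI; exact: (br_marks br).
have p0 : (0 <= \prod_(i <- s) P (g i @^-1` D i))%E by exact: prode_ge0.
have pfin : (\prod_(i <- s) P (g i @^-1` D i))%E \is a fin_num.
  by rewrite prode_fin_num// => i _; exact: fin_num_measure.
rewrite muleC -(fineK pfin) -[fine _]/(NngNum (fine_ge0 p0))%:num.
have mcells A : coded_events n A -> measurable (z @^-1` A).
  by move=> /coded_events_measurable; exact: measurable_births_pre.
apply: (@laws_agree R births (coded_events n) _ _ d T P d T P z z _ (NngNum (fine_ge0 p0)) _ _ _ _ _ E) => //.
- exact: coded_events_setI.
- by apply: coded_events_old; exact: (@measurableT _ (births_to n)).
- by apply: (le_lt_trans (probability_le1 P measurableT)); rewrite ltry.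
- exact: measurable_marks.
- move=> _ [l [K [A [mA vK ->]]]].
  have sn' : {in s, forall i, (n < size i)%N} by [].
  have ind s' : uniq s' -> {in s', forall i, (n < size i)%N} ->
      jointly_independent P (z : T -> births_to n) g (individuals n l ++ s').
    move=> us' sn''; apply: IH.
      rewrite cat_uniq individuals_uniq us' andbT /=; apply/hasPn => i /sn'' ni.
      by rewrite mem_individuals; apply/negP => /andP[/eqP e]; rewrite e ltnn in ni.
    move=> i; rewrite mem_cat mem_individuals => /orP[/andP[/eqP->]//|/sn'']; exact: ltnW.
  rewrite /= preimage_setI setIAC [LHS](step_product mA vK us sn' mD (ind _ us sn')).
  rewrite muleC fineK//; congr (_ * _)%E.
  have ind0 := ind [::] isT (fun _ h => ltac:(by [])).
  have := @step_product n l K [::] D A mA vK isT (fun _ h => ltac:(by [])) mD ind0.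
  rewrite big_nil mule1 => <-; congr (P (_ `&` _)).
  by rewrite [marks_in _ _ _](_ : _ = setT) ?setIT//; apply/seteqP; split.
- exact: born_before_coded_events.
Qed.

(** A Markov property from which the marks have disappeared: the codes of
    generation [n] have conditional law [W] given the previous generations. *)
Lemma generation_step n l K E : <<s @born_before R n >> E -> valid_codes n l K ->
  P (z @^-1` E `&` z @^-1` atom n l K) =
  (\int[P]_(w in z @^-1` E) mean_product l K (z w : births_to n))%E.
Proof.
move=> mE vK.
have ind : jointly_independent P (z : T -> births_to n) g (individuals n l ++ [::]).
  apply: generation_independent; first by rewrite cats0 individuals_uniq.
  by move=> i; rewrite cats0 mem_individuals => /andP[/eqP->].
have := @step_product n l K [::] (fun=> setT) E mE vK isT (fun _ h => ltac:(by [])) (fun=> measurableT) ind.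
rewrite big_nil mule1 => <-; congr (P (_ `&` _)).
by rewrite [marks_in _ _ _](_ : _ = setT) ?setIT//; apply/seteqP; split.
Qed.

End model.

Lemma branching_unique_succ (W : nat -> seq nat -> R -> \bar R)
  d1 (T1 : measurableType d1) (P1 : probability T1 R) e1 (G1 : measurableType e1)
  (z1 : T1 -> births) (g1 : seq nat -> T1 -> G1) f1
  d2 (T2 : measurableType d2) (P2 : probability T2 R) e2 (G2 : measurableType e2)
  (z2 : T2 -> births) (g2 : seq nat -> T2 -> G2) f2 :
  branching P1 z1 g1 f1 W -> branching P2 z2 g2 f2 W ->
  forall n, (forall E, <<s @born_before R n >> E -> P1 (z1 @^-1` E) = P2 (z2 @^-1` E)) ->
  forall E, <<s @born_before R n.+1 >> E -> P1 (z1 @^-1` E) = P2 (z2 @^-1` E).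
Proof.
move=> br1 br2 n IH E mE.
suff h : P1 (z1 @^-1` E `&` setT) = (1%:E * P2 (z2 @^-1` E))%E.
  by move: h; rewrite setIT mul1e.
apply: (@laws_agree R births (coded_events n) _ _ d1 T1 P1 d2 T2 P2 z1 z2 setT 1%:nng _ _ _ _ _ E) => //.
- exact: coded_events_setI.
- by apply: coded_events_old; exact: (@measurableT _ (births_to n)).
- by apply: (le_lt_trans (probability_le1 P1 measurableT)); rewrite ltry.
- by move=> A /coded_events_measurable; exact: (measurable_births_pre br1).
- by move=> A /coded_events_measurable; exact: (measurable_births_pre br2).
- move=> _ [l [K [A [mA vK ->]]]].
  rewrite setIT mul1e !preimage_setI.
  rewrite [LHS](generation_step br1 mA vK) [RHS](generation_step br2 mA vK).
  pose F (x : births_to n) := (mean_product W l K x * (\1_A x)%:E)%E.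
  have mF : measurable_fun setT F.
    apply: emeasurable_funM; first exact: (measurable_mean_product br1 vK).
    by apply/measurable_EFinP; exact: measurable_indic.
  have F0 x : (0 <= F x)%E.
    by apply: mule_ge0; [exact: (mean_product_ge0 br1 x vK)|rewrite lee_fin].
  have key d (T : measurableType d) (P : probability T R) (z : T -> births)
      (mz : measurable_fun setT (z : T -> births_to n)) :
      (\int[P]_(w in z @^-1` A) mean_product W l K (z w : births_to n) =
       \int[image_law P mz]_x F x)%E.
    rewrite ge0_integral_image_law// [LHS]integral_mkcond; apply: eq_integral => w _.
    rewrite patchE /F indicE (_ : (w \in z @^-1` A) = (z w \in A))//.
    by case: ifP => _; rewrite ?mule1 ?mule0.
  rewrite (key _ _ _ _ (measurable_births_fun br1 (n := n))).
  rewrite (key _ _ _ _ (measurable_births_fun br2 (n := n))).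
  by apply: eq_measure_integral => B mB _; exact: IH.
- exact: born_before_coded_events.
Qed.

(** The kernel [W] and the law of the root determine the law of all generations,
    whatever the marks and the probability space. *)
Lemma branching_unique (W : nat -> seq nat -> R -> \bar R)
  d1 (T1 : measurableType d1) (P1 : probability T1 R) e1 (G1 : measurableType e1)
  (z1 : T1 -> births) (g1 : seq nat -> T1 -> G1) f1
  d2 (T2 : measurableType d2) (P2 : probability T2 R) e2 (G2 : measurableType e2)
  (z2 : T2 -> births) (g2 : seq nat -> T2 -> G2) f2 :
  branching P1 z1 g1 f1 W -> branching P2 z2 g2 f2 W ->
  (forall l q, (q <= 2 ^ l)%N ->
    P1 [set w | z1 w [::] <= dyad R l q] = P2 [set w | z2 w [::] <= dyad R l q]) ->
  forall n E, <<s @born_before R n >> E -> P1 (z1 @^-1` E) = P2 (z2 @^-1` E).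
Proof.
move=> br1 br2 root; elim => [|n IH] E mE; last first.
  exact: (branching_unique_succ br1 br2 IH mE).
pose G : set (set births) := [set A | A = setT \/ @born_before R 0 A].
have GE : <<s G >> E.
  move: mE; apply: smallest_sub; first exact: smallest_sigma_algebra.
  by move=> A bA; apply: sub_sigma_algebra; right.
have rootE A : @born_before R 0 A -> exists l q, (q <= 2 ^ l)%N /\
    A = [set x : births | x [::] <= dyad R l q].
  by move=> [i [l [q [si ql ->]]]]; exists l, q; split => //; case: i si.
suff h : P1 (z1 @^-1` E `&` setT) = (1%:E * P2 (z2 @^-1` E))%E.
  by move: h; rewrite setIT mul1e.
have mG d (T : measurableType d) (P : probability T R) (z : T -> births) e (GG : measurableType e)
    (g : seq nat -> T -> GG) f (br : branching P z g f W) A : G A -> measurable (z @^-1` A).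
  move=> [->|bA]; first by rewrite preimage_setT.
  by apply: (measurable_births_pre br (n := 0%N)); exact: sub_sigma_algebra.
apply: (@laws_agree R births G _ _ d1 T1 P1 d2 T2 P2 z1 z2 setT 1%:nng _ _ _ _ _ E) => //.
- move=> A B [->|bA]; first by rewrite setTI.
  move=> [->|bB]; first by rewrite setIT; right.
  have [l [q [ql AE]]] := rootE _ bA; have [l' [q' [ql' BE]]] := rootE _ bB.
  right; have [dd|dd] := leP (dyad R l q) (dyad R l' q').
    rewrite (_ : A `&` B = A)//; apply/setIidPl; rewrite AE BE => x /= h; exact: le_trans dd.
  rewrite (_ : A `&` B = B)//; apply/setIidPr; rewrite AE BE => x /= h.
  exact: le_trans (ltW dd).
- by left.
- by apply: (le_lt_trans (probability_le1 P1 measurableT)); rewrite ltry.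
- by move=> A; exact: (mG _ _ _ _ _ _ _ _ br1 A).
- by move=> A; exact: (mG _ _ _ _ _ _ _ _ br2 A).
- move=> A [->|/rootE[l [q [ql ->]]]].
    by rewrite setIT mul1e !preimage_setT [LHS]probability_setT [RHS]probability_setT.
  by rewrite setIT mul1e; exact: root.
Qed.

End generations.

(** * The common law of a brood *)

Section formula.
Context (R : realType).
Implicit Types (a u : R) (l q : nat) (s : seq nat).

(** Length of the part of cell [q] that lies above [u]. *)
Definition overlap l q u : R := Num.max u (dyad R l q.+1) - Num.max u (dyad R l q).

(** Volume of the set of nondecreasing sequences of positions above [u] with
    code [s]. *)
Definition volume l s u : R :=
  \prod_(q < 2 ^ l) (overlap l q u ^+ count_mem (q : nat) s / (count_mem (q : nat) s)`!%:R).

(** Probability that an individual at [u] has a brood of code [s], [a] being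
    the initial rate of reproduction. The minimum with 1 serves the individuals
    placed at 2: they have no children, with probability 1. *)
Definition offspring_law a l s u : R :=
  Num.min u 1 `^ a * (\prod_(k < size s) (a + k%:R)) * volume l s u.

Lemma overlap_ge0 l q u : 0 <= overlap l q u.
Proof. by rewrite /overlap subr_ge0 le_max2// ler_dyad. Qed.

Lemma overlap_passed l q u : dyad R l q.+1 <= u -> overlap l q u = 0.
Proof.
move=> qu; rewrite /overlap !max_l ?subrr//; apply: le_trans qu.
by rewrite ler_dyad.
Qed.

Lemma volume_nil l u : volume l [::] u = 1.
Proof. by rewrite /volume big1// => q _; rewrite expr0 divr1. Qed.

Lemma volume_ge0 l s u : 0 <= volume l s u.
Proof. by apply: prodr_ge0 => q _; rewrite divr_ge0// exprn_ge0// overlap_ge0. Qed.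

Lemma volume_passed l q s u : (q < 2 ^ l)%N -> dyad R l q.+1 <= u ->
  volume l (q :: s) u = 0.
Proof.
move=> ql qu; rewrite /volume (bigD1 (Ordinal ql))//= eqxx overlap_passed//.
by rewrite expr0n /= !mul0r.
Qed.

(** As long as [u] is below the top of cell [q], and [s] has no cell below [q],
    the [q]-th factor is the only one in the volume that depends on [u]. *)
Definition upper_volume l q s : R :=
  \prod_(r < 2 ^ l | (r : nat) != q)
     ((2 ^- l) ^+ count_mem (r : nat) s / (count_mem (r : nat) s)`!%:R).

Lemma volume_split l q s u : (q < 2 ^ l)%N -> all (leq q) s -> u <= dyad R l q.+1 ->
  volume l s u =
  overlap l q u ^+ count_mem q s / (count_mem q s)`!%:R * upper_volume l q s.
Proof.
move=> ql qs uq; rewrite /volume (bigD1 (Ordinal ql))//=; congr (_ * _).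
apply: eq_bigr => r; rewrite -val_eqE /= => rq; have [rltq|] := ltnP r q.
  have -> : count_mem (r : nat) s = 0%N.
    apply/eqP; rewrite -leqn0 leqNgt -has_count; apply/hasPn => k /(allP qs) qk /=.
    by apply/eqP; lia.
  by rewrite !expr0.
rewrite leq_eqVlt eq_sym (negbTE rq) /= => qr; congr (_ ^+ _ / _).
rewrite /overlap !max_r; last 2 first.
- by apply: le_trans uq _; rewrite ler_dyad.
- by apply: le_trans uq _; rewrite ler_dyad ltnW.
by rewrite /dyad -mulrBl -natrB// subSnn mul1r.
Qed.

Lemma volume_cons l q s u : (q < 2 ^ l)%N -> all (leq q) s -> u <= dyad R l q.+1 ->
  volume l (q :: s) u =
  overlap l q u ^+ (count_mem q s).+1 / (count_mem q s).+1`!%:R * upper_volume l q s.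
Proof.
move=> ql qs uq; rewrite (volume_split (q := q))//= ?leqnn//.
rewrite eqxx add1n; congr (_ * _); apply: eq_bigr => r rq.
by rewrite /= eq_sym (negbTE rq) add0n.
Qed.

(** The fundamental theorem of calculus for an interval that may be degenerate
    and may contain its end points or not. *)
Lemma integral_derivative (F f : R -> R) (x y : R) (b0 b1 : bool) : x <= y ->
  (forall t : R, x <= t <= y -> is_derive t 1 F (f t)) ->
  (forall t : R, x <= t <= y -> {for t, continuous f}) ->
  (\int[lebesgue_measure]_(t in [set` Interval (BSide b0 x) (BSide b1 y)]) (f t)%:E =
   (F y - F x)%:E)%E.
Proof.
rewrite le_eqVlt => /orP[/eqP <- _ _|xy dF cf].
  by rewrite subrr; case: b0; case: b1; rewrite !set_itvE ?integral_set0 ?integral_set1.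
have cw : {within `[x, y], continuous f}.
  by apply: continuous_in_subspaceT => t; rewrite inE /= in_itv; exact: cf.
have cF t : x <= t <= y -> {for t, continuous F}.
  by move=> /dF h; apply: differentiable_continuous; apply/derivable1_diffP; exact: ex_derive.
have mf : measurable_fun `[x, y] f.
  by apply: subspace_continuous_measurable_fun => //; exact: measurable_itv.
rewrite integral_itv_bndoo; last first.
  by apply/measurable_EFinP; apply: measurable_funS mf => //; exact: subset_itv_oo_cc.
rewrite -(integral_itv_bndoo true false); last first.
  by apply/measurable_EFinP; apply: measurable_funS mf => //; exact: subset_itv_oo_cc.
rewrite (continuous_FTC2 (F := F)) ?EFinB//.
  split.
  - move=> t; rewrite in_itv /= => /andP[h1 h2].
    by have := dF t; rewrite !ltW// => /(_ isT) h; exact: ex_derive.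
  - by apply: cvg_at_right_filter; apply: cF; rewrite lexx ltW.
  - by apply: cvg_at_left_filter; apply: cF; rewrite lexx ltW.
move=> t; rewrite in_itv /= => /andP[h1 h2].
by rewrite derive1E; apply: derive_val; apply: dF; rewrite !ltW.
Qed.

Lemma is_derive_cell (u hi : R) n (t : R) :
 is_derive t 1 (fun x : R => - ((hi - u * expR x) ^+ n.+1 / n.+1`!%:R)) ((hi - u * expR t) ^+ n / n`!%:R * (u * expR t)).
Proof.
have h1 : is_derive t 1 (fun x : R => hi - u * expR x) (- (u * expR t)).
  have := @is_deriveB _ _ _ (cst hi) (u \*: (expR : R -> R)) t 1 0 (u *: expR t) _ _.
  rewrite sub0r; apply.
have h2 : is_derive t 1 (fun x : R => (hi - u * expR x) ^+ n.+1) ((n.+1%:R * (hi - u * expR t) ^+ n) *: (- (u * expR t))).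
  rewrite (_ : (fun x => _) = (fun x : R => hi - u * expR x) ^+ n.+1).
    exact: is_deriveX.
  by apply/funext => x; rewrite fctE.
rewrite (_ : (fun x => _) = (- (n.+1`!%:R^-1)) \*: (fun x : R => (hi - u * expR x) ^+ n.+1)).
  apply: is_derive_eq.
  have f0 : n`!%:R != 0 :> R by rewrite pnatr_eq0 -lt0n fact_gt0.
  have s0 : n.+1%:R != 0 :> R by rewrite pnatr_eq0.
  rewrite /GRing.scale /= factS natrM; move: (n.+1%:R : R) s0 => N s0.
  by field; rewrite f0 s0.
by apply/funext => x; rewrite -[RHS]/(_ * _) mulNr mulrC.
Qed.

(** Integration over the position [v = u * expR x >= u] of a first child in the
    cell from [lo] to [hi]: in the variable [v] this is the integral of
    [(hi - v) ^ n / n!] from [max u lo] to [hi]. *)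
Lemma cell_integral (u lo hi : R) n : 0 < u -> 0 <= lo -> lo < hi -> u <= hi ->
  (\int[lebesgue_measure]_(x in [set x : R | (0 <= x)%R /\ (lo < u * expR x <= hi)%R])
     ((hi - u * expR x) ^+ n / n`!%:R * (u * expR x))%:E =
   ((hi - Num.max u lo) ^+ n.+1 / n.+1`!%:R)%:E)%E.
Proof.
move=> u0 lo0 lohi uhi.
have hi0 : 0 < hi by exact: le_lt_trans lohi.
pose x1 := ln (Num.max u lo / u); pose x2 := ln (hi / u).
have m0 : 0 < Num.max u lo by rewrite lt_max u0.
have e1 : u * expR x1 = Num.max u lo.
  by rewrite /x1 lnK ?posrE ?divr_gt0// mulrC divfK// gt_eqF.
have e2 : u * expR x2 = hi by rewrite /x2 lnK ?posrE ?divr_gt0// mulrC divfK// gt_eqF.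
have le_x (x y : R) : (x <= y) = (u * expR x <= u * expR y) by rewrite ler_pM2l// ler_expR.
have lt_x (x y : R) : (x < y) = (u * expR x < u * expR y) by rewrite ltr_pM2l// ltr_expR.
have -> : [set x : R | 0 <= x /\ lo < u * expR x <= hi] =
    [set` Interval (BSide (lo < u) x1) (BSide false x2)].
  case: (ltP lo u) => lu; apply/seteqP; split => x /=; rewrite in_itv /=.
  - move=> [x0 /andP[lx xh]]; rewrite (le_x x1 x) (le_x x x2) e1 e2 xh andbT max_l ?(ltW lu)//.
    by rewrite ler_peMr ?(ltW u0)// -expR0 ler_expR.
  - rewrite (le_x x1 x) (le_x x x2) e1 e2 max_l ?(ltW lu)// => /andP[h ->].
    by rewrite (lt_le_trans lu h); split => //; rewrite le_x expR0 mulr1.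
  - by move=> [x0 /andP[lx xh]]; rewrite (lt_x x1 x) (le_x x x2) e1 e2 xh andbT max_r.
  - rewrite (lt_x x1 x) (le_x x x2) e1 e2 max_r// => /andP[h ->]; rewrite h; split => //.
    by rewrite le_x expR0 mulr1 (le_trans lu)// ltW.
pose F x : R := - ((hi - u * expR x) ^+ n.+1 / n.+1`!%:R).
transitivity ((F x2 - F x1)%:E); last first.
  by rewrite /F e1 e2 subrr expr0n /= mul0r oppr0 opprK add0r.
apply: integral_derivative.
- by rewrite le_x e1 e2 ge_max uhi ltW.
- by move=> t _; exact: is_derive_cell.
- move=> t _; apply: cvgM; last by apply: cvgM; [exact: cvg_cst|exact: continuous_expR].
  apply: cvgM; last exact: cvg_cst.
  apply: (continuous_comp (f := fun x : R => hi - u * expR x) (g := fun y : R => y ^+ n)); last exact: exprn_continuous.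
  apply: cvgB; first exact: cvg_cst.
  by apply: cvgM; [exact: cvg_cst|exact: continuous_expR].
Qed.

End formula.

(** * Exponential spacings *)

Section streams.
Context (R : realType).

(** Finite-dimensional cylinders; they generate the product sigma-algebra. *)
Definition coordinates : set (set (nat -> R)) :=
  [set A | exists s (B : nat -> set R), uniq s /\ (forall k, measurable (B k)) /\
     A = [set h | forall k, k \in s -> B k (h k)]].

Local Notation stream := (g_sigma_algebraType coordinates).

Lemma measurable_coordinate k : measurable_fun setT (fun h : stream => h k).
Proof.
move=> _ B mB; rewrite setTI; apply: sub_sigma_algebra.
exists [:: k], (fun=> B); split=> //; split => //.
by apply/seteqP; split => h /= Bh; [move=> j; rewrite inE => /eqP->|apply: Bh; rewrite inE].
Qed.

Lemma measurable_to_stream d (T : measurableType d) (X : T -> nat -> R) :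
  (forall k, measurable_fun setT (fun w => X w k)) ->
  measurable_fun setT (X : T -> stream).
Proof.
move=> mX; apply: measurable_fun_generated => _ [s [B [us [mB ->]]]].
exact: (measurable_forall_in (g := fun k w => X w k)).
Qed.

Lemma coordinates_setI : setI_closed coordinates.
Proof.
move=> _ _ [s1 [B1 [us1 [mB1 ->]]]] [s2 [B2 [us2 [mB2 ->]]]].
exists (undup (s1 ++ s2)), (fun k => (if k \in s1 then B1 k else setT) `&`
   (if k \in s2 then B2 k else setT)); split; first exact: undup_uniq.
split; first by move=> k; apply: measurableI; case: ifP.
apply/seteqP; split => h /=.
  by move=> [h1 h2] k; rewrite mem_undup mem_cat => ks; split; case: ifP => // ?; [exact: h1|exact: h2].
move=> H; split => k ks; have := H k; rewrite mem_undup mem_cat ks ?orbT => /(_ isT) [].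
  by [].
by move=> _.
Qed.

Lemma coordinatesT : coordinates setT.
Proof. by exists [::], (fun=> setT); split=> //; split => //; apply/seteqP; split. Qed.

Definition shift (h : nat -> R) : nat -> R := fun k => h k.+1.

Lemma measurable_shift : measurable_fun setT (shift : stream -> stream).
Proof. by apply: measurable_to_stream => k; exact: measurable_coordinate. Qed.

(** The positions [u e^(h 0)], [u e^(h 0 + h 1)], ... fall successively in the
    cells of [s], then beyond 1. *)
Fixpoint visits (l : nat) (s : seq nat) (u : R) (h : nat -> R) : Prop :=
  if s is q :: s' then in_cell l q (u * expR (h 0%N)) /\ visits l s' (u * expR (h 0%N)) (shift h)
  else 1 < u * expR (h 0%N).

Lemma visitsE l s u h : visits l s u h <->
  (forall j, (j < size s)%N -> in_cell l (nth 0%N s j) (u * expR (\sum_(k < j.+1) h k))) /\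
  1 < u * expR (\sum_(k < (size s).+1) h k).
Proof.
elim: s u h => [|q s IH] u h /=.
  by rewrite big_ord1; split => [|[]].
have E j : u * expR (\sum_(k < j.+2) h k) = u * expR (h 0%N) * expR (\sum_(k < j.+1) shift h k).
  by rewrite big_ord_recl expRD mulrA.
rewrite IH E; split => [[h1 [h2 h3]]|[h1 h2]].
  split => // -[_|j js] /=; first by rewrite big_ord1.
  by rewrite E; exact: h2.
split; first by have := h1 0%N isT; rewrite big_ord1.
by split => // j js; rewrite -E; exact: (h1 j.+1).
Qed.

Lemma measurable_in_cell d (T : measurableType d) l q (v : T -> R) :
  measurable_fun setT v -> measurable [set w | in_cell l q (v w)].
Proof.
move=> mv; have := mv measurableT _ (measurable_itv `](dyad R l q), (dyad R l q.+1)]).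
by rewrite setTI; congr measurable; apply/seteqP; split => w /=; rewrite in_itv.
Qed.

Lemma measurable_visits l s d (T : measurableType d) (u : T -> R) (h : T -> stream) :
  measurable_fun setT u -> measurable_fun setT h ->
  measurable [set w | visits l s (u w) (h w)].
Proof.
elim: s u h => [|q s IH] u h mu mh /=.
  have mv : measurable_fun setT (fun w => u w * expR (h w 0%N)).
    apply: measurable_funM => //; apply: measurableT_comp => //.
    exact: (measurableT_comp (measurable_coordinate 0%N)).
  have := mv measurableT _ (measurable_itv `]1, +oo[).
  by rewrite setTI; congr measurable; apply/seteqP; split => w /=; rewrite in_itv /= andbT.
have mv : measurable_fun setT (fun w => u w * expR (h w 0%N)).
  apply: measurable_funM => //; apply: measurableT_comp => //.
  exact: (measurableT_comp (measurable_coordinate 0%N)).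
rewrite (_ : mkset _ = [set w | in_cell l q (u w * expR (h w 0%N))] `&`
   [set w | visits l s (u w * expR (h w 0%N)) (shift (h w))])//.
apply: measurableI; first exact: measurable_in_cell.
apply: (IH (fun w => u w * expR (h w 0%N)) (fun w => shift (h w))) => //.
exact: (measurableT_comp measurable_shift).
Qed.

Section law.
Context d (T : measurableType d) (P : probability T R).

(** Spacings of a pure birth process that jumps at rate [a + k] in state [k]. *)
Definition exponential_stream (a : R) (X : T -> nat -> R) : Prop :=
  [/\ forall k, measurable_fun setT (fun w => X w k),
      forall s (B : nat -> set R), uniq s -> (forall k, measurable (B k)) ->
        P [set w | forall k, k \in s -> B k (X w k)] =
          (\prod_(k <- s) P [set w | B k (X w k)])%E
    & forall k (B : set R), measurable B ->
        P [set w | B (X w k)] = exponential_prob (a + k%:R) B ].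

Lemma exponential_stream_shift a X : exponential_stream a X ->
  exponential_stream (a + 1) (fun w => shift (X w)).
Proof.
move=> [mX indX lawX]; split=> [k|s B us mB|k B mB].
- exact: mX.
- have := indX (map S s) (fun k => B k.-1).
  rewrite map_inj_uniq; last by move=> ? ? [].
  move=> /(_ us (fun k => mB k.-1)).
  rewrite big_map /= => <-; congr (P _); apply/seteqP; split => w /= h k.
    by move=> /mapP[j js ->] /=; exact: h.
  by move=> ks; apply: (h k.+1); rewrite map_f.
- by rewrite [LHS](lawX k.+1)// -natr1 [k%:R + 1]addrC addrA.
Qed.

(** Together with [exponential_stream_shift] this is the renewal property at the
    first jump: the spacings that follow are those of a process of initial
    rate [a + 1]. *)
Lemma shift_independent a X : exponential_stream a X ->
  forall (E : set R) (D : set stream), measurable E -> measurable D ->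
    P ([set w | E (X w 0%N)] `&` [set w | D (shift (X w))]) =
    (P [set w | E (X w 0%N)] * P [set w | D (shift (X w))])%E.
Proof.
move=> [mX indX lawX] E D mE mD.
have mE0 : measurable [set w | E (X w 0%N)].
  by have := mX 0%N measurableT _ mE; rewrite setTI.
have pf : P [set w | E (X w 0%N)] \is a fin_num by exact: fin_num_measure.
have c0 : 0 <= fine (P [set w | E (X w 0%N)]) by exact: fine_ge0.
rewrite setIC -(fineK pf) -[fine _]/(NngNum c0)%:num.
have mS : measurable_fun setT (fun w => shift (X w) : stream).
  by apply: measurable_to_stream => k; exact: mX.
have mC A : coordinates A -> measurable ((fun w => shift (X w)) @^-1` A).
  move=> cA; have := mS measurableT A; rewrite setTI; apply; exact: sub_sigma_algebra.
apply: (@laws_agree R (nat -> R) coordinates coordinates_setI coordinatesT d T P d T P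
  (fun w => shift (X w)) (fun w => shift (X w)) _ (NngNum c0) _ _ mC mC _ D) => //.
  by apply: (le_lt_trans (probability_le1 P measurableT)); rewrite ltry.
move=> _ [s [B [us [mB ->]]]].
rewrite /= fineK// setIC.
have u0 : uniq (0%N :: map S s).
  rewrite /= map_inj_uniq ?us ?andbT; last by move=> ? ? [].
  by apply/mapP => -[].
have := indX (0%N :: map S s) (fun k => if k is k'.+1 then B k' else E) u0.
rewrite big_cons big_map /= => h.
have u1 : uniq (map S s) by case/andP: u0.
have := indX (map S s) (fun k => if k is k'.+1 then B k' else E) u1.
rewrite big_map /= => h'.
have mB' : forall k, measurable (match k with 0%N => E | k'.+1 => B k' end) by case.
move: h h' => /(_ mB') h /(_ mB') h'.
transitivity (P [set w | forall k, k \in 0%N :: [seq j.+1 | j <- s] ->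
        match k with 0%N => E | k'.+1 => B k' end (X w k)]).
  congr (P _); apply/seteqP; split => w /=.
    move=> [Ew Bw] k; rewrite inE => /orP[/eqP->//|/mapP[j js ->]]; exact: Bw.
  move=> H; split; first by apply: (H 0%N); rewrite inE.
  by move=> k ks; apply: (H k.+1); rewrite inE /= map_f.
rewrite h -h'; congr (_ * P _)%E; apply/seteqP; split => w /=.
  by move=> H k ks; apply: (H k.+1); rewrite map_f.
by move=> H _ /mapP[j js ->]; exact: H.
Qed.

Lemma exponential_tail (a t : R) : 0 < a -> 0 <= t ->
  exponential_prob a `]t, +oo[%classic = (expR (- a * t))%:E.
Proof.
move=> a0 t0; rewrite /exponential_prob integral_itv_obnd_cbnd; last first.
  by apply/measurable_EFinP/measurable_funTS; exact: measurable_exponential_pdf.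
rewrite (ge0_continuous_FTC2y (F := fun x => - expR (- a * x)) (l := 0)).
- by rewrite -EFinB sub0r opprK.
- by move=> x _; apply: exponential_pdf_ge0; exact: ltW.
- apply: (@continuous_subspaceW R^o _ _ [set` `[0, +oo[%R]);
    last exact: within_continuous_exponential_pdf.
  by move=> x /=; rewrite !in_itv /= !andbT; exact: le_trans.
- rewrite -oppr0; apply: cvgN.
  rewrite (_ : (fun x => expR (- a * x)) =
               (fun z => expR (- z)) \o (fun z => a * z)); last first.
    by apply: eq_fun => x; rewrite mulNr.
  apply: (@cvg_comp _ _ _ _ _ _ (pinfty_nbhs R)); last exact: cvgr_expR.
  exact: gt0_cvgMry.
- by move=> x _; exact: ex_derive.
- apply: cvgN; apply/cvg_at_right_filter; apply: continuous_comp; last exact: continuous_expR.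
  by apply: cvgM; [exact: cvg_cst|exact: cvg_id].
- move=> x xt; apply: derive1_exponential_pdf.
  by move: xt; rewrite !in_itv /= !andbT; exact: le_lt_trans.
Qed.

(** By induction on the code. The first spacing has density [a e^(- a x)]. If it
    leads from [u] to [v = u e^x], then [e^(- a x) = (u / v) ^ a], while the
    induction hypothesis at [v], with [a + 1] in place of [a], contributes
    [v ^ (a + 1)]. The product is [a u ^ a] times [v], the Jacobian of [x] to [v],
    so that only the volume remains to be integrated. *)
Lemma visits_law l s a (X : T -> nat -> R) u : 0 < a -> 0 < u -> valid_code l s ->
  exponential_stream a X ->
  P [set w | visits l s u (X w)] = (offspring_law a l s u)%:E.
Proof.
elim: s a X u => [|q s IH] a X u a0 u0 vs eX.
  have mV : measurable [set w | visits l [::] u (X w)].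
    apply: (@measurable_visits l [::] _ _ (fun=> u) (X : T -> stream)) => //.
    by apply: measurable_to_stream => k; case: eX.
  rewrite /offspring_law /= big_ord0 volume_nil !mulr1.
  have [mX indX lawX] := eX.
  have [u1|u1] := leP u 1.
    rewrite [X in P X](_ : _ = [set w | `]- ln u, +oo[%classic (X w 0%N)]); last first.
      apply/seteqP; split => w /=; rewrite in_itv /= andbT.
        rewrite -{1}(lnK (x := u)) ?posrE// -expRD => h.
        by rewrite -subr_gt0 opprK addrC -ltr_expR expR0.
      move=> h; rewrite -{1}(lnK (x := u)) ?posrE// -expRD -expR0 ltr_expR; lra.
    rewrite lawX// addr0 exponential_tail ?oppr_ge0 ?ln_le0//.
    by rewrite mulrNN /powR gt_eqF.
  rewrite powR1.
  apply/eqP; rewrite eq_le probability_le1//=.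
  have <- : P [set w | `]0, +oo[%classic (X w 0%N)] = 1%E.
    by rewrite lawX// addr0 exponential_tail// mulr0 expR0.
  apply: le_measure; rewrite ?inE.
  - by have := mX 0%N measurableT _ (measurable_itv `]0, +oo[); rewrite setTI.
  - exact: mV.
  - move=> w /=; rewrite in_itv /= andbT => X0.
    by rewrite (lt_le_trans u1)// ler_peMr ?(ltW u0)// -expR0 ler_expR ltW.
have mV : measurable [set w | visits l (q :: s) u (X w)].
  apply: (@measurable_visits l (q :: s) _ _ (fun=> u) (X : T -> stream)) => //.
  by apply: measurable_to_stream => k; case: eX.
have [mX indX lawX] := eX.
have /andP[] := vs; rewrite /= => qs_sorted /andP[ql sl].
have qs : all (leq q) s by rewrite (order_path_min leq_trans).
have vs' : valid_code l s by rewrite /valid_code sl andbT (path_sorted qs_sorted).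
have eS := exponential_stream_shift eX.
have a10 : 0 < a + 1 by rewrite addr_gt0.
have mS : measurable_fun setT (fun w => shift (X w) : stream).
  by apply: measurable_to_stream => k; exact: mX.
pose A (z : R * stream) := in_cell l q (u * expR z.1) /\ visits l s (u * expR z.1) z.2.
pose f (z : R * stream) : \bar R := (\1_[set z | A z] z)%:E.
have mu1 : measurable_fun setT (fun z : R * stream => u * expR z.1).
  by apply: measurable_funM => //; exact: measurableT_comp.
have mA : measurable [set z | A z].
  apply: measurableI; first exact: measurable_in_cell.
  by apply: (measurable_visits l s mu1); exact: measurable_snd.
have mf : measurable_fun setT f by apply/measurable_EFinP; exact: measurable_indic.
have f0 z : (0 <= f z)%E by rewrite lee_fin.
transitivity (\int[P]_w f (X w 0%N, shift (X w)))%E.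
  rewrite (prob_integral P mV).
  apply: eq_integral => w _; rewrite /f !indicE; congr (_%:R%:E).
rewrite (integral_independent_pair (mX 0%N) mS)//; last first.
  by move=> E D mE mD; exact: (shift_independent eX).
pose h x := (\int[P]_w' f (x, shift (X w')))%E.
have hE x : h x = if in_cell l q (u * expR x) then (offspring_law (a + 1) l s (u * expR x))%:E else 0%E.
  rewrite /h; case: ifPn => cx; last first.
    by rewrite integral0_eq// => w _; rewrite /f indicE memNset// => -[]; rewrite (negbTE cx).
  rewrite -(IH _ (fun w => shift (X w)) _ a10 _ vs' eS) ?mulr_gt0 ?expR_gt0//.
  rewrite prob_integral; last first.
    by apply: (measurable_visits l s (u := fun=> u * expR x) _ mS).
  apply: eq_integral => w _; rewrite /f !indicE; congr ((nat_of_bool _)%:R%:E).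
  by apply/idP/idP => /set_mem vx; apply/mem_set; [case: vx|split].
have h0 x : (0 <= h x)%E by exact: integral_ge0.
have mh : measurable_fun setT h.
  apply: (@measurable_integral_param _ _ _ P _ _ _ _ (fun w => shift (X w) : stream) (fun x g => f (x, g))) => //.
have mX0 : measurable_fun setT ((fun w => X w 0%N) : T -> measurableTypeR R) by exact: mX.
rewrite -(@ge0_integral_image_law _ _ _ _ (measurableTypeR R) P _ mX0 h)//.
rewrite (@integral_density _ (measurableTypeR R) _ (image_law P mX0) lebesgue_measure (exponential_pdf a))//; last 3 first.
- exact: measurable_exponential_pdf.
- by move=> x; apply: exponential_pdf_ge0; exact: ltW.
- by move=> B mB; rewrite [LHS](lawX 0%N)// addr0.
pose n := count_mem q s.
pose lo := dyad R l q; pose hi := dyad R l q.+1.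
have lohi : lo < hi by rewrite /lo /hi /dyad ltr_pM2r ?invr_gt0 ?exprn_gt0// ltr_nat.
have hi1 : hi <= 1 by exact: dyad_le1.
(* What does not depend on the position of the first child. *)
pose c := u `^ a * (a * \prod_(k < size s) (a + 1 + k%:R)) * upper_volume R l q s.
transitivity (\int[lebesgue_measure]_(x in [set x : R | (0 <= x)%R /\ (lo < u * expR x <= hi)%R])
    (c * ((hi - u * expR x) ^+ n / n`!%:R * (u * expR x)))%:E)%E.
  rewrite [RHS]integral_mkcond; apply: eq_integral => x _; rewrite patchE hE.
  have [x0|x0] := ltP x 0.
    rewrite lt0_exponential_pdf// mule0 memNset//= => -[]; rewrite leNgt x0; by [].
  rewrite exponential_pdfE// -/(in_cell l q (u * expR x)).
  case: ifPn => cx; last first.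
    by rewrite mul0e memNset// => -[_]; rewrite -/(in_cell l q _) (negbTE cx).
  rewrite mem_set; last by split.
  have /andP[lx xh] := cx.
  rewrite -EFinM; congr (_%:E).
  rewrite /offspring_law min_l ?(le_trans xh)// (volume_split ql qs xh).
  rewrite /overlap max_r// (max_l (ltW lx)) -/hi -/n.
  rewrite powRD ?powRr1; last 2 first.
  - by rewrite mulr_ge0 ?expR_ge0// ltW.
  - by rewrite (gt_eqF (mulr_gt0 u0 (expR_gt0 x))) implybT.
  rewrite powRM ?expR_ge0 ?(ltW u0)// -expRM /c.
  have : expR (x * a) * expR (- a * x) = 1 by rewrite -expRD mulNr [a * x]mulrC subrr expR0.
  move: (expR (x * a)) (expR (- a * x)) => e1 e2 e12.
  rewrite -[RHS]mul1r -e12; ring.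
have c0 : 0 <= c.
  rewrite /c !mulr_ge0 ?powR_ge0//; first exact: ltW.
    by apply: prodr_ge0 => k _; rewrite addr_ge0// ltW.
  by apply: prodr_ge0 => r _; rewrite divr_ge0// exprn_ge0// invr_ge0 exprn_ge0.
have prodS : \prod_(k < (size s).+1) (a + k%:R) = a * \prod_(k < size s) (a + 1 + k%:R).
  rewrite big_ord_recl addr0; congr (_ * _); apply: eq_bigr => k _.
  by rewrite /= /bump leq0n add1n -natr1; ring.
have [uhi|hiu] := leP u hi; last first.
  rewrite /offspring_law volume_passed ?(ltW hiu)// mulr0.
  rewrite (_ : mkset _ = set0) ?integral_set0//; apply/seteqP; split => // x /= [x0 /andP[_ xh]].
  have : u <= u * expR x by rewrite ler_peMr ?(ltW u0)// -expR0 ler_expR.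
  by move=> h1; have := lt_le_trans hiu (le_trans h1 xh); rewrite ltxx.
under eq_integral => x _ do rewrite EFinM.
have mux : measurable_fun setT (fun x : R => u * expR x) by exact: measurable_funM.
have mS0 : measurable [set x : R | 0 <= x /\ lo < u * expR x <= hi].
  rewrite (_ : mkset _ = `[0, +oo[ `&` [set x : R | in_cell l q (u * expR x)]).
    by apply: measurableI => //; exact: measurable_in_cell.
  by apply/seteqP; split => x /=; rewrite in_itv /= andbT.
rewrite ge0_integralZl//; last 2 first.
- apply/measurable_EFinP/measurable_funTS; apply: measurable_funM => //.
  by apply: measurable_funM => //; apply: measurable_funX; exact: measurable_funB.
- move=> x [_ /andP[lx xh]]; rewrite lee_fin mulr_ge0 ?divr_ge0 ?exprn_ge0 ?subr_ge0//.
  by rewrite mulr_ge0 ?expR_ge0 ?ltW.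
rewrite cell_integral ?dyad_ge0// -EFinM; congr (_%:E).
rewrite /offspring_law (volume_cons ql qs uhi) min_l ?(le_trans uhi)// /= prodS /overlap (max_r uhi).
by rewrite /c -[LHS]mulrA [X in _ * X]mulrC.
Qed.

End law.
End streams.

(** * Spacings of a pure birth process *)

Section pure_birth.
Context (R : realType) d (T : measurableType d) (P : probability T R).
Local Notation stream := (g_sigma_algebraType (@coordinates R)).
Variables (rate : nat -> R) (Y : R -> T -> nat).
Hypothesis pb : pure_birth_process P rate Y.

(** The infimum is attained because the paths are right-continuous. *)
Lemma jump_timeE k w (t : R) : 0 <= t ->
  (jump_time Y k w <= t%:E)%E = (k <= Y t w)%N.
Proof.
move=> t0; have [_ _ mono rc _] := pb.
apply/idP/idP => [|kY]; last by apply: ereal_inf_lbound; exists t.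
apply: contraLR; rewrite -ltnNge -ltNge => Yk.
have [e /= e0 he] := rc w t t0.
have lt_t : t < t + e / 2 by rewrite ltrDl divr_gt0.
apply: (@lt_le_trans _ _ (t + e / 2)%:E); first by rewrite lte_fin.
apply: le_ereal_inf_tmp => _ [s [s0 ks] <-]; rewrite lee_fin leNgt; apply/negP => st.
suff : (Y s w <= Y t w)%N by move: ks Yk; lia.
have [/(mono w _ _ s0)//|ts] := leP s t.
rewrite (he s) ?leqnn// /ball /= distrC ger0_norm ?subr_ge0 ?ltW//; lra.
Qed.

Lemma jump_time_ge0 k w : (0 <= jump_time Y k w)%E.
Proof. by apply: le_ereal_inf_tmp => _ [s [s0 ks] <-]; rewrite lee_fin. Qed.

Lemma jump_time0 w : jump_time Y 0 w = 0%E.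
Proof.
apply/eqP; rewrite eq_le jump_time_ge0 andbT; apply: ereal_inf_lbound.
by exists 0 => //; split.
Qed.

Definition spacings (w : T) : nat -> R := fun k => fine (holding_time Y k w).

(** Only the values at nonnegative times are constrained by the model, and the
    clock is independent of these only. *)
Definition observed : set (set T) := \bigcup_(t in [set t | 0 <= t]) sigma_of (Y t).

Local Notation T0 := (g_sigma_algebraType observed).

Lemma observed_measurable A : <<s observed >> A -> measurable A.
Proof.
apply: smallest_sub; first exact: sigma_algebra_measurable.
move=> _ [t t0 [B _ <-]]; have [mY _ _ _ _] := pb.
by apply: mY.
Qed.

Lemma measurable_jump_time k : measurable_fun setT (jump_time Y k : T0 -> \bar R).
Proof.
apply: (measurability (@ErealGenOInfty.G R)).
  exact: ErealGenOInfty.measurableE.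
move=> _ [_ [g ->] <-]; rewrite setTI.
have [g0|g0] := ltP g 0.
  rewrite (_ : _ @^-1` _ = setT)//; apply/seteqP; split => w //= _.
  by rewrite in_itv /= andbT (lt_le_trans _ (jump_time_ge0 k w))// lte_fin.
rewrite (_ : _ @^-1` _ = ~` (Y g @^-1` [set n | (k <= n)%N])).
  apply: measurableC; apply: sub_sigma_algebra; exists g => //.
  by exists [set n | (k <= n)%N] => //; rewrite setTI.
by apply/seteqP; split => w /=; rewrite in_itv /= andbT ltNge jump_timeE// => /negP.
Qed.

Lemma measurable_holding_time k : measurable_fun setT (holding_time Y k : T0 -> \bar R).
Proof. by apply: emeasurable_funB; exact: measurable_jump_time. Qed.

Lemma measurable_spacing k : measurable_fun setT (fun w : T0 => spacings w k).
Proof.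
apply: (@measurableT_comp _ _ _ _ _ _ (@fine R)) => //.
exact: measurable_holding_time.
Qed.

Lemma measurable_spacings : measurable_fun setT (spacings : T0 -> stream).
Proof. by apply: measurable_to_stream => k; exact: measurable_spacing. Qed.

Lemma from_observed dS (S : measurableType dS) (X : T -> S) :
  measurable_fun setT (X : T0 -> S) -> measurable_fun setT X.
Proof. by move=> mX _ B mB; apply: observed_measurable; exact: mX. Qed.

Lemma spacing_law k (B : set R) : (0 < rate k) -> measurable B ->
  P [set w | B (spacings w k)] = exponential_prob (rate k) B.
Proof.
move=> r0 mB; have [_ _ _ _ [_ law]] := pb.
rewrite -law//; apply: prob_ae_eq.
- have := from_observed (measurable_spacing k) measurableT mB.
  by rewrite setTI.
- rewrite -[X in measurable X]setTI.
  apply: (from_observed (measurable_holding_time k)) => //.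
  apply: measurable_image_EFin; exact: mB.
have fin_ae : {ae P, forall w, (holding_time Y k @^-1` (EFin @` setT)) w}.
  apply: ae_prob1.
    rewrite -[X in measurable X]setTI.
    apply: (from_observed (measurable_holding_time k)) => //.
    apply: measurable_image_EFin; exact: (@measurableT _ (measurableTypeR R)).
  by rewrite law// /exponential_prob integral_exponential_pdf.
apply: filterS fin_ae => w [x _ xE]; rewrite /spacings /= -xE /=.
by split => [Bx|[y By [<-]]//]; exists x.
Qed.

Lemma spacings_stream (a : R) : 0 < a -> (forall k, rate k = a + k%:R) ->
  exponential_stream P a spacings.
Proof.
move=> a0 rE.
have r0 k : 0 < rate k by rewrite rE ltr_pwDl.
split.
- by move=> k; apply: from_observed; exact: measurable_spacing.
- move=> s B us mB; have [_ _ _ _ [ind _]] := pb.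
  have := ind s (fun k => [set w | B k (spacings w k)]) us.
  apply => k ks; exists (@fine R @^-1` B k); last by rewrite setTI.
  have mf : measurable_fun setT (@fine R) by [].
  by have := mf measurableT _ (mB k); rewrite setTI.
- by move=> k B mB; rewrite spacing_law// rE.
Qed.

(** Excludes the null event that some holding time is infinite or negative. *)
Definition regular w := forall k,
  jump_time Y k w = (\sum_(j < k) spacings w j)%:E /\ 0 <= spacings w k.

Lemma ae_regular : (forall k, 0 < rate k) -> {ae P, forall w, regular w}.
Proof.
move=> r0; have [_ _ _ _ [_ law]] := pb.
have : {ae P, forall w, forall k, (holding_time Y k @^-1` (EFin @` `[0, +oo[%classic)) w}.
  apply: ae_forall_countable => k; apply: ae_prob1.
    rewrite -[X in measurable X]setTI.
    apply: (from_observed (measurable_holding_time k)) => //.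
    apply: measurable_image_EFin; exact: measurable_itv.
  rewrite law; last exact: measurable_itv.
  rewrite /exponential_prob -integral_itv_obnd_cbnd.
    by rewrite [LHS](exponential_tail (r0 k))// mulr0 expR0.
  by apply/measurable_EFinP/measurable_funTS; exact: measurable_exponential_pdf.
apply: filterS => w h.
have hk k : holding_time Y k w = (spacings w k)%:E /\ 0 <= spacings w k.
  have [x /= x0 xE] := h k; rewrite /spacings -xE /=; split => //.
  by move: x0; rewrite in_itv /= andbT.
move=> k; split; last by case: (hk k).
elim: k => [|k IH]; first by rewrite big_ord0 jump_time0.
have [hE _] := hk k; move: hE; rewrite /holding_time IH big_ord_recr /=.
by case: (jump_time Y k.+1 w) => // x [<-]; rewrite addrC subrK.
Qed.

End pure_birth.

(** * The Yule tree *)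

Section yule_tree.
Context (R : realType) d (T : measurableType d) (P : probability T R).
Variables (alpha : R) (Y : label -> R -> T -> nat) (b : label -> T -> \bar R).
Hypothesis yc : yule_ctbp P alpha Y b.
Hypothesis alpha_gt : 0 < 1 + alpha.

Let pb (i : label) : pure_birth_process P (fun y => y%:R + 1 + alpha) (Y i).
Proof. by have [h _ _] := yc; exact: h. Qed.

Lemma yule_birth_root w : b [::] w = 0%E.
Proof. by case: yc => _ _ [-> _]. Qed.

(** Before [b i w] there is no reproduction, and from then on the process of [i]
    runs on its own clock. *)
Lemma yule_birth_child_aux (i : seq nat) j w : (0 <= b i w)%E ->
  b (rcons i j) w = (b i w + jump_time (Y i) j.+1 w)%E.
Proof.
move=> b0; have [_ _ [_ ->]] := yc.
have J0 := jump_time_ge0 (Y i) j.+1 w.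
case E: (b i w) b0 => [r| |]// b0; last first.
  rewrite (_ : mkset _ = set0); last by apply/seteqP; split => // t [].
  by rewrite image_set0 ereal_inf0 addye// gt_eqF// (lt_le_trans _ J0)// ltNy0.
rewrite /=; apply/eqP; rewrite eq_le; apply/andP; split; last first.
  apply: le_ereal_inf_tmp => _ [t [rt jt] <-].
  rewrite lee_fin in rt; rewrite -leeBrDl// -EFinB (jump_timeE (pb i)) ?subr_ge0//.
  by move: jt; rewrite lee_fin ler_nat.
case E' : (jump_time (Y i) j.+1 w) J0 => [s| |]// J0; last by rewrite addey// leey.
rewrite lee_fin in J0.
apply: ereal_inf_lbound; exists (r + s) => //; split; first by rewrite lee_fin lerDl.
rewrite lee_fin ler_nat [r + s]addrC addrK -(jump_timeE (pb i))//.
by rewrite E'.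
Qed.

Lemma yule_birth_ge0 (i : seq nat) w : (0 <= b i w)%E.
Proof.
elim/last_ind: i => [|i j IH]; first by rewrite yule_birth_root.
by rewrite yule_birth_child_aux// adde_ge0// jump_time_ge0.
Qed.

Lemma yule_birth_child (i : seq nat) j w :
  b (rcons i j) w = (b i w + jump_time (Y i) j.+1 w)%E.
Proof. exact/yule_birth_child_aux/yule_birth_ge0. Qed.

Lemma measurable_yule_birth (i : seq nat) : measurable_fun setT (b i).
Proof.
elim/last_ind: i => [|i j IH].
  by apply: (eq_measurable_fun (cst 0%E)) => // w _; rewrite yule_birth_root.
apply: (eq_measurable_fun (fun w => b i w + jump_time (Y i) j.+1 w)%E).
  by move=> w _; rewrite yule_birth_child.
apply: emeasurable_funD => //; apply: (from_observed (pb i)).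
exact: (measurable_jump_time (pb i)).
Qed.

Variables (tau : {RV P >-> R}).

Lemma measurable_yule_born (i : seq nat) : measurable [set w | (b i w <= (tau w)%:E)%E].
Proof.
rewrite -[X in measurable X]setTI; apply: emeasurable_fun_le => //.
  exact: measurable_yule_birth.
exact/measurable_EFinP.
Qed.

Definition yule_position (w : T) (i : label) : R :=
  if (b i w <= (tau w)%:E)%E then expR (fine (b i w) - tau w) else 2.

Lemma yule_position_range w i : 0 < yule_position w i <= 1 \/ yule_position w i = 2.
Proof.
rewrite /yule_position; case: ifPn => bt; [left|by right].
rewrite expR_gt0 -expR0 ler_expR subr_le0 /=.
by move: bt (yule_birth_ge0 i w); case: (b i w).
Qed.

Lemma yule_position_mono w (i : label) j :
  yule_position w (rcons i j) <= yule_position w (rcons i j.+1).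
Proof.
have le_b : (b (rcons i j) w <= b (rcons i j.+1) w)%E.
  rewrite !yule_birth_child leeD2l//.
  apply: le_ereal_inf => _ [s [s0 js] <-]; exists s => //; split => //.
  exact: leq_trans js.
have [bt|bt] := boolP (b (rcons i j.+1) w <= (tau w)%:E)%E; last first.
  rewrite [leRHS]/yule_position (negbTE bt).
  by have [/andP[_ h]|->//] := yule_position_range w (rcons i j); lra.
rewrite /yule_position (le_trans le_b bt) bt ler_expR lerD2r.
move: le_b bt (yule_birth_ge0 (rcons i j) w).
by case: (b (rcons i j) w) => [x| |] //; case: (b (rcons i j.+1) w).
Qed.

Lemma yule_position_late w (i : label) : exists j, yule_position w (rcons i j) == 2.
Proof.
have [bt|bt] := leP (b i w) (tau w)%:E; last first.
  exists 0%N; rewrite /yule_position ifN// yule_birth_child -ltNge.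
  by rewrite (lt_le_trans bt)// leeDl// jump_time_ge0.
move: bt (yule_birth_ge0 i w); case E: (b i w) => [r| |]//.
rewrite !lee_fin => rt r0; exists (Y i (tau w - r) w).
rewrite /yule_position ifN// yule_birth_child E -leeBrDl// -EFinB.
by rewrite (jump_timeE (pb i)) ?subr_ge0// ltnn.
Qed.

Definition yule_births (w : T) : births R :=
  Births (yule_position_range w) (yule_position_mono w) (yule_position_late w).

Lemma measurable_yule_position i : measurable_fun setT (fun w => yule_position w i).
Proof.
rewrite /yule_position; apply: measurable_fun_ifT => //.
- apply: (measurable_fun_bool true); rewrite setTI.
  exact: measurable_yule_born.
- apply: measurableT_comp => //; apply: measurable_funB => //.
  by apply: measurableT_comp => //; exact: measurable_yule_birth.
Qed.

Lemma yule_born (i : label) w : (b i w <= (tau w)%:E)%E <-> yule_births w i <= 1.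
Proof.
rewrite /= /yule_position; case: ifPn => bt; last by split => //; lra.
split => // _; rewrite -expR0 ler_expR subr_le0.
by move: bt (yule_birth_ge0 i w); case: (b i w).
Qed.

(** The spacings determine the brood, so the conditional probability is an
    indicator. *)
Definition yule_kernel (l : nat) (s : seq nat) (u : R) (h : nat -> R) : \bar R :=
  if valid_code l s then (\1_[set h | visits l s u h] h)%:E else 0%E.

(** On the logarithmic scale the children follow their parent at the partial sums
    of the spacings; the second alternative is due to the convention that 2 stands
    for all positions beyond 1. *)
Lemma yule_position_child (i : label) j w : regular (Y i) w ->
  let p := yule_position w i * expR (\sum_(k < j.+1) spacings (Y i) w k) in
  yule_position w (rcons i j) = p \/ 1 < yule_position w (rcons i j) /\ 1 < p.
Proof.
move=> reg /=; have [J S] := reg j.+1; rewrite /yule_position yule_birth_child J.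
have S0 : 0 <= \sum_(k < j.+1) spacings (Y i) w k.
  by apply: sumr_ge0 => k _; have [_] := reg k.
move: (\sum_(k < j.+1) _) S0 => s s0.
case: ifPn => [bst|bst].
  have bt : (b i w <= (tau w)%:E)%E by apply: le_trans bst; rewrite leeDl.
  rewrite bt; left; move: bt (yule_birth_ge0 i w); case: (b i w) => // r _ _.
  by rewrite -expRD /=; congr expR; ring.
case: ifPn => [bt|bt]; right.
  split; first by lra.
  move: bt bst (yule_birth_ge0 i w); case: (b i w) => //= r _ rs _.
  rewrite -expRD -expR0 ltr_expR; move: rs; rewrite lee_fin -ltNge; lra.
split; first by lra.
have : 1 <= expR s by rewrite -expR0 ler_expR.
lra.
Qed.

Lemma yule_code l s (i : label) w : regular (Y i) w -> valid_code l s ->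
  code l (yule_births w) i = s <-> visits l s (yule_births w i) (spacings (Y i) w).
Proof.
move=> reg vs; have sb := valid_code_bound vs.
have in_cell_child j q : (q < 2 ^ l)%N ->
    in_cell l q (yule_births w (rcons i j)) =
    in_cell l q (yule_births w i * expR (\sum_(k < j.+1) spacings (Y i) w k)).
  move=> ql; have hi1 : dyad R l q.+1 <= 1 by exact: dyad_le1.
  have [/= ->//|[h1 h2]] := yule_position_child j reg.
  rewrite /in_cell /=; apply/andP/andP => -[_ h]; exfalso.
    by have := le_trans h hi1; rewrite leNgt h1.
  by have := le_trans h hi1; rewrite leNgt h2.
have gt1_child j : (1 < yule_births w (rcons i j)) =
    (1 < yule_births w i * expR (\sum_(k < j.+1) spacings (Y i) w k)).
  by have [/= ->//|[h1 h2]] := yule_position_child j reg; apply/idP/idP.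
rewrite visitsE; split => [/eqP/(codeP _ _ sb)[h1 h2]|[h1 h2]].
  split; last by rewrite -gt1_child.
  move=> j js; rewrite -in_cell_child; first exact: h1.
  exact: (allP sb _ (mem_nth _ js)).
apply/eqP/codeP => //; split; last by rewrite gt1_child.
move=> j js; rewrite in_cell_child; first exact: h1.
exact: (allP sb _ (mem_nth _ js)).
Qed.

Variable r : R.
Hypothesis clock : exp_clock r Y tau.

Local Notation stream := (g_sigma_algebraType (@coordinates R)).

Lemma spacings_observed (i : label) (D : set stream) : measurable D ->
  sigma_of_process (Y i) (spacings (Y i) @^-1` D).
Proof. by move=> mD; have := measurable_spacings (pb i) measurableT mD; rewrite setTI. Qed.

Lemma yule_root_independent (E : set R) (s : seq (seq nat)) (D : seq nat -> set stream) :
  measurable E -> uniq s -> (forall i, measurable (D i)) ->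
  P ([set w | E (yule_births w [::])] `&`
      marks_in (fun i w => spacings (Y i) w : stream) s D) =
  (P [set w | E (yule_births w [::])] *
    \prod_(i <- s) P ((fun w => spacings (Y i) w) @^-1` D i))%E.
Proof.
move=> mE us mD; have [_ indY _] := yc; have [_ indT] := clock.
rewrite -indY//; last by move=> i _; exact: spacings_observed.
apply: indT.
  exists [set t | E (if (0 <= t)%R then expR (- t) else 2)].
    have mf : measurable_fun setT (fun t : R => if 0 <= t then expR (- t) else 2).
      apply: measurable_fun_ifT => //; first exact: measurable_fun_ler.
      by apply: measurableT_comp => //; exact: measurable_oppr.
    by have := mf measurableT _ mE; rewrite setTI.
  rewrite setTI; apply/seteqP; split => w /=; rewrite /yule_position yule_birth_root lee_fin /=;
    by rewrite sub0r.
pose sig := <<s \bigcup_(i : label) sigma_of_process (Y i) >>.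
rewrite (_ : marks_in _ s D = \bigcap_(i in [set` s]) ((fun w => spacings (Y i) w) @^-1` D i)).
  apply: (@fin_bigcap_measurable _ (g_sigma_algebraType (\bigcup_(i : label) sigma_of_process (Y i)))) => // i _.
  by apply: sub_sigma_algebra; exists i => //; exact: spacings_observed.
by apply/seteqP; split.
Qed.

Lemma yule_branching : branching P yule_births (fun i w => spacings (Y i) w : stream)
  yule_kernel (fun l s u => (offspring_law (1 + alpha) l s u)%:E).
Proof.
have mspac i : measurable_fun setT (spacings (Y i) : T -> stream).
  apply: (from_observed (pb i)); exact: measurable_spacings (pb i).
have mvis l s : measurable [set ug : R * stream | visits l s ug.1 ug.2].
  by apply: measurable_visits; [exact: measurable_fst|exact: measurable_snd].
have rE k : k%:R + 1 + alpha = 1 + alpha + k%:R :> R by ring.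
have r0 k : 0 < k%:R + 1 + alpha :> R by rewrite rE ltr_pwDl.
split.
- by move=> i; exact: measurable_yule_position.
- by move=> i; exact: mspac.
- by move=> E s D mE us mD; exact: yule_root_independent.
- move=> l s; rewrite /yule_kernel; case: (valid_code l s); last exact: measurable_cst.
  apply: (eq_measurable_fun (fun ug => (\1_[set ug : R * stream | visits l s ug.1 ug.2] ug)%:E)).
    by move=> ug _; rewrite !indicE.
  by apply/measurable_EFinP; exact: measurable_indic.
- by move=> l s u h; rewrite /yule_kernel; case: ifP => _ //; rewrite lee_fin.
- move=> n l K s D E mE vK us sn mD.
  have mM : measurable (marks_in (fun i w => spacings (Y i) w : stream) s D).
    by apply: (@measurable_forall_in _ T _ _ stream (fun i w => spacings (Y i) w) s D) => // i; exact: mspac.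
  have mZ m A : <<s @born_before R m >> A -> measurable (yule_births @^-1` A).
    move=> mA.
    have mB : measurable_fun setT (yule_births : T -> g_sigma_algebraType (@born_before R m)).
      apply: measurable_fun_generated => _ [i [l' [q [_ _ ->]]]].
      have := measurable_yule_position i measurableT (measurable_itv `]-oo, (dyad R l' q)]).
      by rewrite setTI; congr measurable; apply/seteqP; split => w /=; rewrite in_itv.
    by have := mB measurableT _ mA; rewrite setTI.
  pose V := [set w | forall i, i \in individuals n l -> visits l (K i) (yule_births w i) (spacings (Y i) w)].
  have mV : measurable V.
    rewrite (_ : V = \bigcap_(i in [set` individuals n l])
        [set w | visits l (K i) (yule_births w i) (spacings (Y i) w)]).
      apply: fin_bigcap_measurable => // i _; apply: measurable_visits; last exact: mspac.
      exact: measurable_yule_position.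
    by apply/seteqP; split.
  have mA : measurable (yule_births @^-1` E `&` marks_in (fun i w => spacings (Y i) w : stream) s D).
    by apply: measurableI => //; exact: mZ mE.
  transitivity (P ((yule_births @^-1` E `&` marks_in (fun i w => spacings (Y i) w : stream) s D) `&` V)).
    apply: prob_ae_eq.
    - by apply: measurableI => //; apply: (mZ n.+1); exact: measurable_atom.
    - exact: measurableI.
    - have := ae_forall_countable (fun i : seq nat => ae_regular (pb i) r0).
      apply: filterS => w reg; split => -[h1 h2]; split => // i il.
        by apply/(yule_code (reg i) (vK _ il)); exact: h2.
      by apply/(yule_code (reg i) (vK _ il)); exact: h2.
  rewrite prob_integral; last exact: measurableI.
  rewrite [RHS]integral_mkcond; apply: eq_integral => w _.
  rewrite indicI patchE /= EFinM indicE.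
  case: ifPn => wA; rewrite ?mul0e// mul1e.
  rewrite -(@prod_indic_marks R _ T _ _ T (fun _ => idfun) (individuals n l)
    (fun i => [set w | visits l (K i) (yule_births w i) (spacings (Y i) w)]) w).
  by apply: eq_big_seq => i il; rewrite /yule_kernel vK// !indicE.
- move=> l s i u vs u0; rewrite /yule_kernel vs.
  rewrite -(visits_law alpha_gt u0 vs (spacings_stream (pb i) alpha_gt rE)).
  rewrite prob_integral; last first.
    by apply: (measurable_visits l s (u := fun=> u) (h := spacings (Y i) : T -> stream)).
  by apply: eq_integral => w _; rewrite !indicE.
Qed.

End yule_tree.

(** * Gamma integrals *)

Section gamma_integral.
Context (R : realType).
Local Notation mu := (@lebesgue_measure R).
Implicit Types (p M x t : R).

Definition laplace_power p M : \bar R :=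
  (\int[mu]_(x in `[0%R, +oo[) (x `^ p * expR (- M * x))%:E)%E.

Lemma powR_cvg_at_right0 p : 0 <= p -> (fun x => x `^ p) x @[x --> 0^'+] --> 0 `^ p.
Proof.
rewrite le_eqVlt => /orP[/eqP <-|p0].
  by under eq_fun do rewrite powRr0; rewrite powRr0; exact: cvg_cst.
by rewrite powR0 ?gt_eqF//; exact: powR_cvg0.
Qed.

Lemma continuous_powR_pos p x : 0 < x -> {for x, continuous (fun x => x `^ p)}.
Proof.
move=> x0; apply: differentiable_continuous; apply/derivable1_diffP.
by apply: derivable_powR; rewrite in_itv /= x0.
Qed.

Lemma integral_powR p y : 0 <= p -> 0 < y ->
  (\int[mu]_(t in `[0%R, y]) ((p + 1) * t `^ p)%:E = (y `^ (p + 1))%:E)%E.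
Proof.
move=> p0 y0.
have p10 : 0 < p + 1 by lra.
rewrite (continuous_FTC2 (F := fun t => t `^ (p + 1)))//.
- by rewrite -EFinB powR0 ?subr0// gt_eqF.
- apply/(continuous_within_itvP _ y0); split.
  + move=> t; rewrite in_itv /= => /andP[t0 _].
    by apply: cvgM; [exact: cvg_cst|exact: continuous_powR_pos].
  + by apply: cvgM; [exact: cvg_cst|exact: powR_cvg_at_right0].
  + apply/cvg_at_left_filter; apply: cvgM; [exact: cvg_cst|exact: continuous_powR_pos].
- split.
  + by move=> t; rewrite in_itv /= => /andP[t0 _]; apply: derivable_powR; rewrite in_itv /= t0.
  + by apply: powR_cvg_at_right0; exact: ltW.
  + by apply/cvg_at_left_filter; exact: continuous_powR_pos.
- move=> t; rewrite in_itv /= => /andP[t0 _].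
  by rewrite powR_derive1 ?in_itv /= ?t0// addrK.
Qed.

Lemma measurable_power_exp p M : measurable_fun setT (fun x => x `^ p * expR (- M * x)).
Proof.
by apply: measurable_funM => //; apply: measurableT_comp => //; exact: measurable_funM.
Qed.

Lemma laplace_power_scale p M : 0 <= p -> 0 < M ->
  laplace_power p M = ((M `^ (- (p + 1)))%:E * laplace_power p 1)%E.
Proof.
move=> p0 M0.
pose F x : R := M * x.
have dF x : is_derive x 1 F M.
  rewrite /F; have := @is_deriveZ _ _ _ (idfun : R -> R) M x 1 1 _.
  by rewrite /GRing.scale /= mulr1; apply.
have F'E : (F^`())%classic = cst M by apply/funext => x; rewrite derive1E derive_val.
have -> : laplace_power p 1 =
    (\int[mu]_(x in `[F 0%R, +oo[) (x `^ p * expR (- 1 * x))%:E)%E.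
  by rewrite /F mulr0.
rewrite (increasing_ge0_integration_by_substitutiony (F := F)).
- rewrite F'E -ge0_integralZl//.
  + rewrite /laplace_power; apply: eq_integral => x; rewrite inE /= in_itv /= andbT => x0.
    rewrite -EFinM; congr (_%:E); rewrite !fctE /F /= mulN1r -mulNr powRM ?(ltW M0)//.
    rewrite powRN powRD ?powRr1 ?(ltW M0)//; last by rewrite (gt_eqF M0) implybT.
    have : M `^ p != 0 by rewrite gt_eqF// powR_gt0.
    by move: (M `^ p) => N N0; field; rewrite N0 gt_eqF.
  + apply/measurable_EFinP/measurable_funTS.
    apply: measurable_funM => //; apply: (measurableT_comp (measurable_power_exp p 1)).
    exact: measurable_funM.
  + move=> x _; rewrite lee_fin -[X in _ <= X]/((F x `^ p * expR (-1 * F x)) * M).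
    by rewrite mulr_ge0 ?(ltW M0)// mulr_ge0 ?powR_ge0 ?expR_ge0.
  + by rewrite lee_fin powR_ge0.
- by move=> x y _ _ xy; rewrite /F ltr_pM2l.
- by move=> x _; rewrite F'E; exact: cst_continuous.
- by rewrite F'E; exact: is_cvg_cst.
- by rewrite F'E; exact: is_cvg_cst.
- split; first by move=> x _; exact: ex_derive.
  apply: cvg_at_right_filter; apply: differentiable_continuous; apply/derivable1_diffP.
  exact: ex_derive.
- exact: gt0_cvgMry.
- have cexp x : {for x, continuous (fun x => expR (- 1 * x))}.
    apply: continuous_comp; last exact: continuous_expR.
    by apply: cvgM; [exact: cvg_cst|exact: cvg_id].
  rewrite /F mulr0; apply/continuous_within_itvcyP; split.
  + move=> x; rewrite in_itv /= andbT => x0.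
    by apply: cvgM; [exact: continuous_powR_pos|exact: cexp].
  + by apply: cvgM; [exact: powR_cvg_at_right0|apply: cvg_at_right_filter; exact: cexp].
- by move=> x _; rewrite mulr_ge0 ?powR_ge0 ?expR_ge0.
Qed.

(** Write [x ^ (p + 1)] as the integral of [(p + 1) t ^ p] over [0, x] and
    exchange the integrals: the inner one is an exponential tail. All integrands
    being nonnegative, no finiteness has to be known beforehand. *)
Lemma laplace_power_succ p M : 0 <= p -> 0 < M ->
  laplace_power (p + 1) M = (((p + 1) / M)%:E * laplace_power p M)%E.
Proof.
move=> p0 M0.
have p10 : 0 < p + 1 by lra.
(* The region 0 <= t <= x over which the double integral is taken. *)
pose S : set (R * R) := [set z | 0 <= z.2 <= z.1].
pose f (z : R * R) : \bar R := (\1_S z * ((p + 1) * z.2 `^ p * expR (- M * z.1)))%:E.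
have mS : measurable S.
  have mb : measurable_fun setT (fun z : R * R => (0 <= z.2) && (z.2 <= z.1)).
    by apply: measurable_and; apply: measurable_fun_ler.
  by have := mb measurableT [set true] I; rewrite setTI.
have f0 z : (0 <= f z)%E.
  by rewrite lee_fin !mulr_ge0 ?powR_ge0 ?expR_ge0// ltW.
have mf : measurable_fun setT f.
  apply/measurable_EFinP; apply: measurable_funM; first exact: measurable_indic.
  apply: measurable_funM.
    by apply: measurable_funM => //; apply: (@measurableT_comp _ _ _ _ _ _ (@powR R ^~ p)) => //.
  apply: measurableT_comp => //; exact: measurable_funM.
have mP : measurable_fun setT (fun t => (p + 1) * t `^ p) by exact: measurable_funM.
have mE x : measurable_fun setT (fun x => expR (- M * x)).
  by apply: measurableT_comp => //; exact: measurable_funM.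
transitivity (\int[mu]_x \int[mu]_t f (x, t))%E.
  rewrite /laplace_power integral_mkcond; apply: eq_integral => x _.
  transitivity (\int[mu]_(t in `[0%R, x]) ((expR (- M * x))%:E * ((p + 1) * t `^ p)%:E))%E; last first.
    rewrite integral_mkcond; apply: eq_integral => t _; rewrite patchE /f indicE.
    rewrite (_ : (t \in `[0, x]%classic) = ((x, t) \in S)).
      by case: ifP => _; rewrite ?mul1r ?mul0r// -EFinM mulrC.
    by apply/idP/idP => /set_mem h; apply/mem_set; move: h; rewrite /S /= in_itv.
  rewrite ge0_integralZl//; last 2 first.
  - exact/measurable_EFinP/measurable_funTS.
  - by move=> t _; rewrite lee_fin mulr_ge0 ?powR_ge0 ?ltW.
  rewrite patchE; have [x0|x0|<-] := ltgtP 0 x.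
  - rewrite mem_set /= ?in_itv /= ?andbT ?ltW// integral_powR// -EFinM mulrC //.
  - rewrite memNset; last by rewrite /= in_itv /= andbT leNgt x0.
    by rewrite set_itv_ge ?integral_set0 ?mule0// bnd_simp -ltNge.
  - rewrite mem_set /= ?in_itv /= ?lexx// set_itv1 integral_set1 mule0 powR0 ?mul0r//.
    by rewrite gt_eqF.
rewrite (fubini_tonelli (m1 := mu) (m2 := mu) f)//.
rewrite /laplace_power -ge0_integralZl//; last 3 first.
- by apply/measurable_EFinP/measurable_funTS; exact: measurable_power_exp.
- by move=> x _; rewrite lee_fin mulr_ge0 ?powR_ge0 ?expR_ge0.
- by rewrite lee_fin divr_ge0 ?ltW.
rewrite [RHS]integral_mkcond; apply: eq_integral => t _; rewrite patchE.
case: ifPn => [|t0]; last first.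
  apply: integral0_eq => x _; rewrite /f indicE memNset ?mul0r// => -[/andP[t0' _]].
  by case/negP: t0; apply/mem_set; rewrite /= in_itv /= andbT.
rewrite inE /= in_itv /= andbT => t0.
transitivity (\int[mu]_(x in `]t, +oo[) (((p + 1) * t `^ p / M)%:E * (exponential_pdf M x)%:E))%E.
  rewrite integral_itv_obnd_cbnd; last first.
    apply/measurable_EFinP/measurable_funTS.
    by apply: measurable_funM => //; exact: measurable_exponential_pdf.
  rewrite [RHS]integral_mkcond; apply: eq_integral => x _; rewrite patchE /f indicE.
  rewrite (_ : (x \in `[t, +oo[%classic) = ((x, t) \in S)); last first.
    by apply/idP/idP => /set_mem h; apply/mem_set; move: h; rewrite /S /= in_itv /= ?andbT ?t0//=; case/andP.
  case: ifPn => [/set_mem /= /andP[_ tx]|_]; rewrite ?mul0r// mul1r.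
  rewrite exponential_pdfE ?(le_trans t0)// -EFinM; congr (_%:E).
  by field; rewrite gt_eqF.
rewrite ge0_integralZl//; last 3 first.
- by apply/measurable_EFinP/measurable_funTS; exact: measurable_exponential_pdf.
- by move=> x _; rewrite lee_fin exponential_pdf_ge0// ltW.
- by rewrite lee_fin divr_ge0 ?mulr_ge0 ?powR_ge0 ?ltW.
rewrite [X in (_ * X)%E](exponential_tail M0 t0) -!EFinM; congr (_%:E).
by field; rewrite gt_eqF.
Qed.

(** The Gamma function stays a common factor on both sides; only its ratios are
    computed. *)
Lemma laplace_power_add p M n : 0 <= p -> 0 < M ->
  laplace_power (p + n%:R) M =
  ((M `^ (- (p + 1 + n%:R)) * \prod_(k < n) (p + 1 + k%:R))%:E * laplace_power p 1)%E.
Proof.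
move=> p0 M0; elim: n => [|n IH].
  by rewrite !addr0 big_ord0 mulr1 laplace_power_scale.
rewrite -natr1 addrA laplace_power_succ ?addr_ge0// IH muleA -EFinM; congr (_%:E * _)%E.
rewrite big_ord_recr /= [p + 1 + (n%:R + 1)]addrA.
rewrite !powRN [in RHS]powRD ?powRr1 ?(ltW M0)//; last by rewrite (gt_eqF M0) implybT.
have : M `^ (p + 1 + n%:R) != 0 by rewrite gt_eqF// powR_gt0.
by move: (M `^ _) (\prod_(_ < _) _) => N Q N0; field; rewrite N0 gt_eqF.
Qed.

End gamma_integral.

(** * Gamma mixtures of Poisson processes *)

Section mixed_poisson.
Context (R : realType).
Local Notation mu := (@lebesgue_measure R).
Implicit Types (a u g : R) (l k : nat) (s : seq nat).

Lemma poisson_probE g k n : 0 <= g ->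
  poisson_prob g n [set k] = (g ^+ k / k`!%:R * expR (- g))%:E.
Proof.
rewrite le_eqVlt => /orP[/eqP <-|g0]; rewrite /poisson_prob.
  rewrite ltxx diracE oppr0 expR0 mulr1; congr (_%:E).
  have [->|k0] := eqVneq k 0%N; first by rewrite mem_set// expr0 divr1.
  by rewrite memNset ?expr0n ?(negbTE k0) ?mul0r//= => /eqP; rewrite eq_sym (negbTE k0).
by rewrite g0 esum_set1 ?lee_fin ?poisson_pmf_ge0// /poisson_pmf g0.
Qed.

Lemma measurable_poisson_prob1 k n : measurable_fun setT (fun g => poisson_prob g n [set k]).
Proof.
apply: (eq_measurable_fun (fun g => if 0 < g then (poisson_pmf g k)%:E else (\d_0%N [set k] : \bar R))).
  by move=> g _; rewrite /poisson_prob; case: ifP => // _; rewrite esum_set1 ?lee_fin ?poisson_pmf_ge0.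
apply: measurable_fun_ifT => //; first exact: measurable_fun_ltr.
by apply/measurable_EFinP; exact: measurable_poisson_pmf.
Qed.

(** On the scale of positions a child process with parameter [g] has intensity
    [g / u] above [u]. The power [u `^ (-1)] is [1 / u] for [u > 0]. *)
Definition polya_kernel l s u g : \bar R :=
  (\prod_(q < 2 ^ l) poisson_prob (g * overlap l q u * u `^ (-1)) 0%N [set count_mem (q : nat) s])%E.

Lemma polya_kernel_ge0 l s u g : (0 <= polya_kernel l s u g)%E.
Proof. by apply: prode_ge0 => q _; exact: measure_ge0. Qed.

Lemma measurable_overlap l q : measurable_fun setT (overlap l q : R -> R).
Proof. by apply: measurable_funB; apply: measurable_maxr. Qed.

Lemma measurable_polya_kernel l s :
  measurable_fun setT (fun ug : R * R => polya_kernel l s ug.1 ug.2).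
Proof.
apply: emeasurable_prod => q.
apply: (measurableT_comp (measurable_poisson_prob1 (count_mem (q : nat) s) 0)).
apply: measurable_funM.
  apply: measurable_funM => //.
  by apply: (@measurableT_comp _ _ _ _ _ _ (@overlap R l q)) => //; exact: measurable_overlap.
by apply: (@measurableT_comp _ _ _ _ _ _ (@powR R ^~ (-1))).
Qed.

Lemma sum_overlap l u : 0 < u -> \sum_(q < 2 ^ l) overlap l q u = Num.max u 1 - u.
Proof.
move=> u0; rewrite /overlap.
rewrite -(big_mkord xpredT (fun q => Num.max u (dyad R l q.+1) - Num.max u (dyad R l q))).
rewrite telescope_sumr// dyad_top dyad0.
by congr (_ - _); rewrite max_l// ltW.
Qed.

Lemma sum_count l s : all (fun q => q < 2 ^ l)%N s ->
  (\sum_(q < 2 ^ l) count_mem (q : nat) s = size s)%N.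
Proof.
elim: s => [|p s IH] /=; first by rewrite big1.
move=> /andP[pl sl]; rewrite big_split /= IH// (bigD1 (Ordinal pl))//= eqxx.
rewrite big1 ?addn0 ?add1n// => q; rewrite -val_eqE /= eq_sym => qp.
by rewrite (negbTE qp).
Qed.

(** The powers of the Poisson means multiply to [(g / u) ^ N] times the volume, and
    their exponents add up to the mass of the whole interval [u, 1]. *)
Lemma polya_kernelE l s u g : valid_code l s -> 0 < u -> 0 <= g ->
  polya_kernel l s u g =
  ((g / u) ^+ size s * volume l s u * expR (- ((g / u) * (Num.max u 1 - u))))%:E.
Proof.
move=> /valid_code_bound sl u0 g0; rewrite /polya_kernel (powR_inv1 (ltW u0)).
under eq_bigr => q _ do rewrite poisson_probE ?divr_ge0 ?mulr_ge0 ?overlap_ge0 ?(ltW u0)//.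
rewrite prodEFin; congr (_%:E).
rewrite big_split /= -expR_sum sumrN; congr (_ * expR (- _)); last first.
  by rewrite -(sum_overlap l u0) mulr_sumr; apply: eq_bigr => q _; rewrite mulrAC.
rewrite -(sum_count sl) expr_sum /volume -big_split /=; apply: eq_bigr => q _.
by rewrite mulrA -exprMn mulrAC.
Qed.

Section mean.
Context d (T : measurableType d) (P : probability T R) (a : R) (X : {RV P >-> R}).
Hypothesis a1 : 1 <= a.
Hypothesis lawX : has_law P X (gamma_prob a).

Let gamma_pdf x : R := if 0 < x then x `^ (a - 1) * expR (- x) / gamma_fun a else 0.

Lemma gamma_fun_ge0 : 0 <= gamma_fun a.
Proof. by apply: Rintegral_ge0 => x _; rewrite mulr_ge0 ?powR_ge0 ?expR_ge0. Qed.

Lemma laplace_power_open p M : laplace_power p M =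
  (\int[mu]_(x in `]0%R, +oo[) (x `^ p * expR (- M * x))%:E)%E.
Proof.
rewrite integral_itv_obnd_cbnd//; apply/measurable_EFinP/measurable_funTS.
exact: measurable_power_exp.
Qed.

(** [gamma_fun] is a real number even if the integral diverges; that
    [gamma_prob] has total mass 1 forces the integral to be finite and nonzero. *)
Lemma laplace_power_gamma : laplace_power (a - 1) 1 = (gamma_fun a)%:E /\ 0 < gamma_fun a.
Proof.
have L0 : (0 <= laplace_power (a - 1) 1)%E.
  by apply: integral_ge0 => x _; rewrite lee_fin mulr_ge0 ?powR_ge0 ?expR_ge0.
have gE : gamma_fun a = fine (laplace_power (a - 1) 1).
  rewrite laplace_power_open /gamma_fun /Rintegral; congr fine.
  by apply: eq_integral => x _; rewrite mulN1r.
have := lawX measurableT; rewrite preimage_setT probability_setT /gamma_prob setTI.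
under eq_integral => x _ do rewrite -[- x]mulN1r mulrC EFinM.
rewrite ge0_integralZl//; last 3 first.
- by apply/measurable_EFinP/measurable_funTS; exact: measurable_power_exp.
- by move=> x _; rewrite lee_fin mulr_ge0 ?powR_ge0 ?expR_ge0.
- by rewrite lee_fin invr_ge0 gamma_fun_ge0.
rewrite -laplace_power_open gE; move: L0; case: (laplace_power _ _) => [r| |]//=.
  rewrite lee_fin => r0; rewrite -EFinM => -[h]; split => //.
  rewrite lt_neqAle r0 andbT eq_sym; apply/eqP => r00; move: h.
  by rewrite r00 mulr0 => /eqP; rewrite oner_eq0.
by move=> _; rewrite invr0 mul0e => -[] /eqP; rewrite oner_eq0.
Qed.

(** For [u <= 1] and [N] the size of [s], integrating
    [(g / u) ^ N e^(- g (1 / u - 1))] against the density of [g] gives the Laplace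
    transform of [g ^ (a - 1 + N)] at [1 / u], that is
    [u ^ (a + N) a (a + 1) ... (a + N - 1)] times the normalization; the powers
    [u ^ N] cancel. *)
Lemma polya_kernel_mean l s u : valid_code l s -> 0 < u ->
  (\int[P]_w polya_kernel l s u (X w))%E = (offspring_law a l s u)%:E.
Proof.
move=> vs u0; have [LE G0] := laplace_power_gamma.
have mX : measurable_fun setT (X : T -> measurableTypeR R) by have h : measurable_fun setT X by []; exact: h.
have mK : measurable_fun setT (fun g => polya_kernel l s u g).
  exact: (measurable_fun_comp2 (measurable_polya_kernel l s) (a := fun=> u)).
rewrite -(@ge0_integral_image_law _ _ _ _ (measurableTypeR R) P _ mX (polya_kernel l s u))//; last first.
  by move=> x; exact: polya_kernel_ge0.
have mpdf : measurable_fun setT gamma_pdf.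
  apply: measurable_fun_ifT => //; first exact: measurable_fun_ltr.
  apply: measurable_funM => //; apply: measurable_funM => //.
  exact: measurableT_comp.
have pdf0 x : 0 <= gamma_pdf x.
  by rewrite /gamma_pdf; case: ifP => // _; rewrite divr_ge0 ?mulr_ge0 ?powR_ge0 ?expR_ge0 ?gamma_fun_ge0.
rewrite (@integral_density _ (measurableTypeR R) _ (image_law P mX) mu gamma_pdf)//; last 2 first.
- move=> B mB; rewrite [LHS](lawX mB) /gamma_prob integral_mkcondr.
  apply: eq_integral => x _; rewrite patchE /gamma_pdf.
  case: ifPn => [/set_mem|/negP x0]; first by rewrite /= in_itv /= andbT => ->.
  by rewrite ifF//; apply/negP => h; apply/x0/mem_set; rewrite /= in_itv /= andbT.
- by move=> x; exact: polya_kernel_ge0.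
(* Rate of the exponential: the density of the gamma law contributes 1 and
   the total mass of the Poisson mean [(max u 1 - u) / u]. *)
pose M := Num.max u 1 / u.
have M0 : 0 < M by rewrite divr_gt0// lt_max u0.
pose c := volume l s u / (u ^+ size s * gamma_fun a).
have c0 : 0 <= c by rewrite divr_ge0 ?volume_ge0// mulr_ge0 ?exprn_ge0 ?ltW.
transitivity (\int[mu]_(x in `]0%R, +oo[) (c%:E * (x `^ (a - 1 + (size s)%:R) * expR (- M * x))%:E))%E.
  rewrite [RHS]integral_mkcond; apply: eq_integral => x _; rewrite patchE /gamma_pdf.
  case: ifPn => x0; last first.
    by rewrite mule0 memNset//= in_itv /= andbT; exact/negP.
  rewrite mem_set; last by rewrite /= in_itv /= andbT.
  rewrite polya_kernelE// ?(ltW x0)// -!EFinM; congr (_%:E).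
  rewrite [x `^ (_ + (size s)%:R)]powRD; last by rewrite (gt_eqF x0) implybT.
  rewrite powR_mulrn ?(ltW x0)//.
  have -> : expR (- M * x) = expR (- (x / u * (Num.max u 1 - u))) * expR (- x).
    by rewrite -expRD; congr expR; rewrite /M; field; rewrite gt_eqF.
  rewrite /c expr_div_n.
  have u1 : u ^+ size s != 0 by rewrite expf_neq0// gt_eqF.
  move: (expR (- (x / u * _))) (expR (- x)) (x `^ _) (x ^+ _) (u ^+ _) u1 => e1 e2 x1 x2 u1 u10.
  by field; rewrite u10 gt_eqF.
rewrite ge0_integralZl//; last 2 first.
- by apply/measurable_EFinP/measurable_funTS; exact: measurable_power_exp.
- by move=> x _; rewrite lee_fin mulr_ge0 ?powR_ge0 ?expR_ge0.
rewrite -laplace_power_open laplace_power_add ?subr_ge0// LE -!EFinM; congr (_%:E).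
rewrite /c /offspring_law subrK.
have [u1|u1] := leP u 1; last first.
  have [->|sN] := eqVneq s [::].
    rewrite !big_ord0 volume_nil !mulr1 expr0 mul1r /= /M max_l ?(ltW u1)//.
    rewrite (divff (lt0r_neq0 u0)).
    by rewrite !powR1 !mul1r mulVf ?gt_eqF.
  have -> : volume l s u = 0; last by rewrite !(mulr0, mul0r).
  case: s vs sN {mK c c0} => // q s vs _.
  have ql : (q < 2 ^ l)%N by have /valid_code_bound /= /andP[] := vs.
  by rewrite volume_passed//; apply: le_trans (ltW u1); exact: dyad_le1.
rewrite /M max_r// powRN div1r (powRD (r := a)); last by rewrite invr_eq0 (gt_eqF u0) implybT.
rewrite powR_mulrn ?invr_ge0 ?(ltW u0)// -(powR_inv1 (ltW u0)) -powRAC (powR_inv1 (powR_ge0 _ _)).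
rewrite (powR_inv1 (ltW u0)).
have ua : u `^ a != 0 by rewrite gt_eqF// powR_gt0.
have us : u ^+ size s != 0 by rewrite expf_neq0// gt_eqF.
rewrite exprVn.
move: (\prod_(_ < _) _) (u `^ a) ua (u ^+ _) us (volume l s u) => Q U U0 V V0 v.
by field; rewrite U0 V0 gt_eqF.
Qed.

End mean.
End mixed_poisson.

(** * The Polya tree *)

Lemma le_powR (R : realType) (a x y : R) : 0 < a -> 0 <= x -> 0 <= y ->
  (x `^ a <= y `^ a) = (x <= y).
Proof.
move=> a0 x0 y0; apply/idP/idP => [|h]; last by rewrite ge0_ler_powR ?nnegrE ?(ltW a0).
by rewrite leNgt; apply: contraTT; rewrite negbK -ltNge => h; rewrite gt0_ltr_powR ?nnegrE.
Qed.

Section polya_tree.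
Context (R : realType) d (T : measurableType d) (P : probability T R).
Variables (m : nat) (beta : R) (U : {RV P >-> R}) (gam : label -> {RV P >-> R})
  (Xi : label -> T -> {measure set (measurableTypeR R) -> \bar R})
  (b : label -> T -> \bar R).
Hypothesis pc : polya_ctbp m beta U gam Xi b.
Hypotheses (m1 : (1 <= m)%N) (beta0 : 0 <= beta).

Let chi : R := (m%:R + beta) / (2 * m%:R + beta).
Let psi : R := (1 - chi) / chi.

Let mR0 : 0 < m%:R :> R. Proof. by rewrite ltr0n. Qed.

Lemma chi_gt0 : 0 < chi.
Proof. by rewrite /chi divr_gt0// ltr_wpDr// mulr_gt0. Qed.

Lemma psi_gt0 : 0 < psi.
Proof.
rewrite /psi divr_gt0 ?chi_gt0// subr_gt0 /chi ltr_pdivrMr ?ltr_wpDr ?mulr_gt0//.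
by rewrite mul1r ltrD2r mulrDl mul1r ltrDr.
Qed.

Definition arrivals i w (t : R) : \bar R := Xi i w [set x | x <= t].

Lemma arrivals_le i w (s t : R) : s <= t -> (arrivals i w s <= arrivals i w t)%E.
Proof.
move=> st; apply: le_measure; rewrite ?inE.
- by have := measurable_itv `]-oo, s]; rewrite set_itvE.
- by have := measurable_itv `]-oo, t]; rewrite set_itvE.
- by move=> x /= xs; exact: le_trans st.
Qed.

Lemma polya_birth_root w : b [::] w = (U w `^ chi)%:E.
Proof. by case: pc => _ _ _ _ [-> _]. Qed.

Lemma polya_birth_child (i : seq nat) j w : b (rcons i j) w =
  ereal_inf [set t%:E | t in [set t : R | (b i w <= t%:E)%E /\ (j.+1%:R%:E <= arrivals i w t)%E]].
Proof. by case: pc => _ _ _ _ [_ ->]. Qed.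

Lemma polya_birth_parent (i : seq nat) j w : (b i w <= b (rcons i j) w)%E.
Proof.
by rewrite polya_birth_child; apply: le_ereal_inf_tmp => _ [t [bt _] <-].
Qed.

Lemma polya_birth_from_root (i : seq nat) w : (b [::] w <= b i w)%E.
Proof.
elim/last_ind: i => [//|i j IH]; exact: le_trans IH (polya_birth_parent _ _ _).
Qed.

Lemma polya_birth_ge0 (i : seq nat) w : (0 <= b i w)%E.
Proof.
by apply: le_trans (polya_birth_from_root i w); rewrite polya_birth_root lee_fin powR_ge0.
Qed.

Lemma polya_birth_mono (i : seq nat) j w : (b (rcons i j) w <= b (rcons i j.+1) w)%E.
Proof.
rewrite !polya_birth_child; apply: le_ereal_inf => _ [t [bt jt] <-]; exists t => //; split => //.
by apply: le_trans jt; rewrite lee_fin ler_nat.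
Qed.

(** A countable form of the infimum that defines the birth time; it makes the
    birth times measurable. *)
Lemma polya_birth_ltE (i : seq nat) j w (g : R) : (b (rcons i j) w < g%:E)%E <->
  exists t : rat, [/\ ratr t < g, (b i w <= (ratr t)%:E)%E & (j.+1%:R%:E <= arrivals i w (ratr t))%E].
Proof.
rewrite polya_birth_child; split => [|[t [tg bt jt]]]; last first.
  by apply: le_lt_trans (_ : ((ratr t)%:E < g%:E)%E); [apply: ereal_inf_lbound; exists (ratr t)|rewrite lte_fin].
move=> /ereal_inf_lt[_ [t [bt jt] <-]]; rewrite lte_fin => tg.
have [q] := rat_in_itvoo tg; rewrite in_itv /= => /andP[tq qg].
exists q; split => //.
  by apply: le_trans bt _; rewrite lee_fin ltW.
by apply: le_trans jt _; apply: arrivals_le; exact: ltW.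
Qed.

Lemma measurable_arrivals i t : measurable_fun setT (fun w => arrivals i w t).
Proof.
case: pc => _ _ mXi _ _; apply: mXi.
by have := measurable_itv `]-oo, t]; rewrite set_itvE.
Qed.

Lemma measurable_polya_birth (i : seq nat) : measurable_fun setT (b i).
Proof.
elim/last_ind: i => [|i j IH].
  apply: (eq_measurable_fun (fun w => (U w `^ chi)%:E)).
    by move=> w _; rewrite polya_birth_root.
  apply/measurable_EFinP; apply: (@measurableT_comp _ _ _ _ _ _ (@powR R ^~ chi)) => //.
apply: (measurability (@ErealGenInftyO.G R)).
  exact: ErealGenInftyO.measurableE.
move=> _ [_ [g ->] <-]; rewrite setTI.
rewrite (_ : _ @^-1` _ = [set w | exists t : rat, (if ratr t < g then
   [set w | (b i w <= (ratr t)%:E)%E] `&` [set w | (j.+1%:R%:E <= arrivals i w (ratr t))%E] else set0) w]).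
  apply: measurable_exists => t; case: ifP => _; last exact: measurable0.
  apply: measurableI; rewrite -[X in measurable X]setTI.
    by apply: emeasurable_fun_infty_c => //.
  by apply: emeasurable_fun_c_infty => //; exact: measurable_arrivals.
apply/seteqP; split => w /=; rewrite in_itv /=.
  by move/polya_birth_ltE => [t [tg bt jt]]; exists t; rewrite tg.
move=> [t]; case: ifP => // tg [bt jt].
by apply/polya_birth_ltE; exists t.
Qed.

(** Almost surely every brood is finite up to time 1, but [births] has to be
    finite everywhere; the members of an infinite brood are discarded. *)
Definition finite_brood w (i : seq nat) : Prop :=
  if i is [::] then True
  else exists j, (1 < b (rcons (take (size i).-1 i) j) w)%E.

Lemma finite_brood_rcons w i j :
  finite_brood w (rcons i j) <-> exists j', (1 < b (rcons i j') w)%E.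
Proof.
rewrite /finite_brood size_rcons /= -cats1 take_size_cat//.
by case: i.
Qed.

Definition properly_born w (i : seq nat) : Prop :=
  [/\ (0 < b [::] w)%E, (b i w <= 1)%E & finite_brood w i].

Definition polya_position (w : T) (i : label) : R :=
  if `[< properly_born w i >] then fine (b i w) `^ psi else 2.

Lemma polya_position_range w i : 0 < polya_position w i <= 1 \/ polya_position w i = 2.
Proof.
rewrite /polya_position; case: asboolP => [[b0 b1 _]|_]; [left|by right].
have bi0 : (0 < b i w)%E by exact: lt_le_trans (polya_birth_from_root i w).
move: bi0 b1; case: (b i w) => // r; rewrite lte_fin lee_fin => r0 r1.
rewrite powR_gt0//=; have := @ge0_ler_powR R psi (ltW psi_gt0) r 1.
by rewrite powR1 !nnegrE; apply => //; exact: ltW.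
Qed.

Lemma polya_position_mono w (i : label) j :
  polya_position w (rcons i j) <= polya_position w (rcons i j.+1).
Proof.
have [/asboolP bt|bt] := boolP `[< properly_born w (rcons i j.+1) >]; last first.
  rewrite [leRHS]/polya_position (negbTE bt).
  by have [/andP[_ h]|->//] := polya_position_range w (rcons i j); lra.
have bt' : properly_born w (rcons i j).
  have [h0 h1 /finite_brood_rcons h2] := bt; split => //.
    exact: le_trans (polya_birth_mono _ _ _) h1.
  exact/finite_brood_rcons.
rewrite /polya_position !asboolT//.
have [_ h1 _] := bt.
move: (polya_birth_mono i j w) h1 (polya_birth_ge0 (rcons i j) w).
case: (b (rcons i j) w) => [x| |]//; case: (b (rcons i j.+1) w) => [y| |]//.
rewrite !lee_fin /= => xy _ x0.
by rewrite ge0_ler_powR ?nnegrE ?(ltW psi_gt0)// (le_trans x0).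
Qed.

Lemma polya_position_late w (i : label) : exists j, polya_position w (rcons i j) == 2.
Proof.
have [[j hj]|nex] := pselect (exists j, (1 < b (rcons i j) w)%E).
  exists j; rewrite /polya_position asboolF// => -[_ h _].
  by move: hj; rewrite ltNge h.
exists 0%N; rewrite /polya_position asboolF// => -[_ _ /finite_brood_rcons]; exact: nex.
Qed.

Definition polya_births (w : T) : births R :=
  Births (polya_position_range w) (polya_position_mono w) (polya_position_late w).

(** The generators of [history], in the notation of this section. *)
Definition past (n : nat) : set (set T) :=
  (\bigcup_i sigma_of (gam i)) `|`
  (\bigcup_(i in [set i : label | (size i <= n)%N]) sigma_of (b i)).

Local Notation past_type n := (g_sigma_algebraType (past n)).

Lemma past_measurable n A : <<s past n >> A -> measurable A.
Proof.
apply: smallest_sub; first exact: sigma_algebra_measurable.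
move=> _ [[i _ [B mB <-]]|[i _ [B mB <-]]]; first exact: measurable_funPT.
exact: measurable_polya_birth.
Qed.

Lemma from_past n dS (S : measurableType dS) (X : T -> S) :
  measurable_fun setT (X : past_type n -> S) -> measurable_fun setT X.
Proof. by move=> mX _ B mB; apply: (@past_measurable n); exact: mX. Qed.

Lemma past_birth n (i : seq nat) : (size i <= n)%N ->
  measurable_fun setT (b i : past_type n -> \bar R).
Proof. by move=> sin _ B mB; apply: sub_sigma_algebra; right; exists i => //; exists B. Qed.

Lemma past_mark n i : measurable_fun setT (gam i : past_type n -> R).
Proof. by move=> _ B mB; apply: sub_sigma_algebra; left; exists i => //; exists B. Qed.

Lemma past_gt n (i : seq nat) (c : R) : (size i <= n)%N ->
  measurable ([set w | (c%:E < b i w)%E] : set (past_type n)).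
Proof.
move=> sin; rewrite -[X in measurable X]setTI.
by apply: emeasurable_fun_o_infty => //; exact: past_birth.
Qed.

Lemma past_le n (i : seq nat) (c : R) : (size i <= n)%N ->
  measurable ([set w | (b i w <= c%:E)%E] : set (past_type n)).
Proof.
move=> sin; rewrite -[X in measurable X]setTI.
by apply: emeasurable_fun_infty_c => //; exact: past_birth.
Qed.

Lemma past_properly_born n (i : seq nat) : (size i <= n)%N ->
  measurable ([set w | properly_born w i] : set (past_type n)).
Proof.
move=> sin.
have mfb : measurable ([set w | finite_brood w i] : set (past_type n)).
  case/lastP: i sin => [|i j] sin.
    by rewrite (_ : mkset _ = setT) //; apply/seteqP; split.
  rewrite (_ : mkset _ = [set w | exists j', (1%:E < b (rcons i j') w)%E]).
    apply: (@measurable_exists _ (past_type n) _ (fun k => [set w | (1%:E < b (rcons i k) w)%E])) => k.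
    by apply: past_gt; move: sin; rewrite !size_rcons.
  apply/seteqP; split => w /=; first by move=> /finite_brood_rcons.
  by move=> h; apply: (iffRL (finite_brood_rcons w i j)).
rewrite (_ : mkset _ = [set w | (0%:E < b [::] w)%E] `&` [set w | (b i w <= 1%:E)%E] `&`
   [set w | finite_brood w i]).
  by apply: measurableI => //; apply: measurableI; [exact: past_gt|exact: past_le].
by apply/seteqP; split => w; [case|move=> [[]]].
Qed.

Lemma past_power n (i : seq nat) : (size i <= n)%N ->
  measurable_fun setT (fun w : past_type n => fine (b i w) `^ psi).
Proof.
move=> sin; apply: (@measurableT_comp _ _ _ _ _ _ (@powR R ^~ psi)) => //.
by apply: measurableT_comp => //; exact: past_birth.
Qed.

Lemma past_position n (i : seq nat) : (size i <= n)%N ->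
  measurable_fun setT (fun w : past_type n => polya_position w i).
Proof.
move=> sin; apply: measurable_fun_ifT => //; last exact: past_power.
apply: (measurable_fun_bool true); rewrite setTI.
rewrite (_ : _ @^-1` _ = [set w | properly_born w i]); first exact: past_properly_born.
by apply/seteqP; split => w /= /asboolP.
Qed.

Lemma past_births n : measurable_fun setT
  (polya_births : past_type n -> g_sigma_algebraType (@born_before R n)).
Proof.
apply: measurable_fun_generated => _ [i [l' [q [sin _ ->]]]].
have := past_position sin measurableT (measurable_itv `]-oo, (dyad R l' q)]).
by rewrite setTI; congr measurable; apply/seteqP; split => w /=; rewrite in_itv.
Qed.

(** The position without the correction for infinite broods. It is a function of
    the birth time alone, as are the Poisson mean measures; it agrees with
    [polya_position] almost surely. *)
Definition raw_position w (i : seq nat) : R :=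
  if ((0 < b i w)%E && (b i w <= 1)%E) then fine (b i w) `^ psi else 2.

Lemma past_raw_position n (i : seq nat) : (size i <= n)%N ->
  measurable_fun setT (fun w : past_type n => raw_position w i).
Proof.
move=> sin; apply: measurable_fun_ifT => //; last exact: past_power.
apply: measurable_and.
  apply: (measurable_fun_bool true); rewrite setTI; exact: (past_gt 0 sin).
apply: (measurable_fun_bool true); rewrite setTI; exact: (past_le 1 sin).
Qed.

(** The time whose position is the dyadic number [q / 2 ^ l]. *)
Definition level l q : R := dyad R l q `^ psi^-1.

Lemma level_power l q : level l q `^ psi = dyad R l q.
Proof.
by rewrite /level -powRrM mulVf ?gt_eqF ?psi_gt0// powRr1// dyad_ge0.
Qed.

Lemma level_ge0 l q : 0 <= level l q. Proof. exact: powR_ge0. Qed.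

Lemma le_power (x y : R) : 0 <= x -> 0 <= y -> (x `^ psi <= y `^ psi) = (x <= y).
Proof. exact: (le_powR psi_gt0). Qed.

Lemma le_level l q r : (level l q <= level l r) = (q <= r)%N.
Proof. by rewrite -le_power ?level_ge0// !level_power ler_dyad. Qed.

Lemma level0 l : level l 0 = 0.
Proof. by rewrite /level dyad0 powR0// gt_eqF// invr_gt0 psi_gt0. Qed.

Lemma level_top l : level l (2 ^ l) = 1.
Proof. by rewrite /level dyad_top powR1. Qed.

Definition birth_cell l q : set R := `]level l q, level l q.+1]%classic.

Lemma birth_cell_trivIset l : trivIset setT (fun q : 'I_(2 ^ l) => birth_cell l q).
Proof.
apply/trivIsetP => /= q r _ _ qr.
wlog : q r qr / (q < r)%N.
  move=> H; have [/H|rq|e] := ltngtP q r; first exact.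
    by rewrite setIC; apply: H => //; rewrite eq_sym.
  by rewrite (val_inj e) eqxx in qr.
move=> qltr; apply/seteqP; split => // v []; rewrite /birth_cell /= !in_itv /= => /andP[_ h1] /andP[h2 _].
have : level l q.+1 <= level l r by rewrite le_level.
by move=> h; have := lt_le_trans h2 (le_trans h1 h); rewrite ltxx.
Qed.

(** The mean measure has the antiderivative [g v ^ psi / s ^ psi], so that it is
    proportional to length on the scale of positions. *)
Lemma polya_meanE (g : R) i w l q : (q < 2 ^ l)%N ->
  polya_mean psi g (b i w) (birth_cell l q) =
  (g * overlap l q (raw_position w i) * (raw_position w i) `^ (-1))%:E.
Proof.
move=> ql; rewrite /polya_mean.
have hi1 : level l q.+1 <= 1 by rewrite -(level_top l) le_level.
have dhi1 : dyad R l q.+1 <= 1 by exact: dyad_le1.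
have [b1|] := boolP (b i w <= 1)%E; last first.
  rewrite -ltNge => b1; rewrite /raw_position leNgt b1 andbF.
  rewrite overlap_passed; last by apply: le_trans dhi1 _; rewrite ler1n.
  rewrite mulr0 mul0r (_ : _ `&` _ = set0) ?integral_set0//.
  apply/seteqP; split => // v [_ /= [bv v1]].
  by have := lt_le_trans b1 (le_trans bv v1); rewrite ltxx.
move: b1 (polya_birth_ge0 i w); rewrite /raw_position; case: (b i w) => [s| |]//.
rewrite !lee_fin lte_fin => s1 s0; rewrite s1 andbT /=.
move: s0; rewrite le_eqVlt => /orP[/eqP <-|s0].
  rewrite ltxx overlap_passed; last by apply: le_trans dhi1 _; rewrite ler1n.
  rewrite mulr0 mul0r; apply: integral0_eq => v _.
  by rewrite powR0 ?gt_eqF ?psi_gt0// invr0 mulr0.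
rewrite s0.
have sp0 : 0 < s `^ psi by exact: powR_gt0.
have maxE x : Num.max (s `^ psi) (dyad R l x) = Num.max s (level l x) `^ psi.
  rewrite -level_power; have [sx|xs] := leP s (level l x).
    by rewrite max_r// (le_power (ltW s0) (level_ge0 l x)).
  by rewrite max_l// (le_power (level_ge0 l x) (ltW s0)) ltW.
rewrite /overlap !maxE powR_inv1 ?powR_ge0//.
have [sh|hs] := leP s (level l q.+1); last first.
  rewrite (_ : _ `&` _ = set0).
    have hs' : level l q <= s by apply: le_trans (ltW hs); rewrite le_level.
    by rewrite integral_set0 (max_l hs') subrr mulr0 mul0r.
  apply/seteqP; split => // v []; rewrite /birth_cell /= in_itv /= => /andP[_ vh] [sv _].
  by rewrite lee_fin in sv; have := lt_le_trans hs (le_trans sv vh); rewrite ltxx.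
set x := Num.max s (level l q).
have x0 : 0 < x by rewrite lt_max s0.
have xh : x <= level l q.+1 by rewrite ge_max sh le_level leqnSn.
have -> : birth_cell l q `&` [set v | (s%:E <= v%:E)%E /\ (v%:E <= 1)%E] =
    [set` Interval (BSide (level l q < s) x) (BSide false (level l q.+1))].
  rewrite /x; case: (ltP (level l q) s) => qs; apply/seteqP; split => v;
    rewrite /birth_cell /= !in_itv /= ?lee_fin.
  - by move=> [/andP[qv vh] [sv v1]]; rewrite sv vh.
  - by move=> /andP[h vh]; rewrite (lt_le_trans qs h) vh h (le_trans vh).
  - by move=> [/andP[qv vh] [sv v1]]; rewrite qv vh.
  - move=> /andP[h vh]; rewrite h vh (le_trans vh)//; split => //; split => //.
    exact: le_trans qs (ltW h).
pose F (v : R) := g / s `^ psi * v `^ psi.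
transitivity ((F (level l q.+1) - F x)%:E); last first.
  congr (_%:E); rewrite /F /x; move: (_ `^ psi) (_ `^ psi) (s `^ psi) => X1 X2 X3; ring.
apply: integral_derivative => //.
- move=> t /andP[xt _]; have t0 : 0 < t by exact: lt_le_trans xt.
  have := @is_deriveZ _ _ _ (fun v => v `^ psi) (g / s `^ psi) t 1 _ (is_derive1_powR psi t0).
  move=> /(@is_derive_eq _ _ _ _ _ _ _ _); apply.
  by rewrite /GRing.scale /=; ring.
- move=> t /andP[xt _]; have t0 : 0 < t by exact: lt_le_trans xt.
  apply: cvgM; last exact: cvg_cst.
  apply: cvgM; first exact: cvg_cst.
  by apply: cvgM; [exact: cvg_cst|exact: continuous_powR_pos].
Qed.

Lemma Xi_law n (i : seq nat) (A : set T) (B : set R) (c : nat) :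
  size i = n -> <<s past n >> A -> measurable B ->
  P (A `&` [set w | Xi i w B = c%:R%:E]) =
  (\int[P]_(w in A)
    poisson_prob (fine (polya_mean psi (gam i w) (b i w) B)) 0%N [set c])%E.
Proof.
move=> sin mA mB; have [_ _ _ cp _] := pc.
transitivity (P (A `&` [set w | forall (j : seq nat) (q : 'I_1), j \in [:: i] ->
    Xi j w B = c%:R%:E])).
  congr (P (_ `&` _)); apply/seteqP; split => w /=; last first.
    by move=> /(_ i ord0); rewrite inE eqxx; apply.
  by move=> XB j q; rewrite inE => /eqP ->.
rewrite (cp n A [:: i] 1%N (fun _ _ => B) (fun _ _ => c))//; last 2 first.
- by move=> j; rewrite inE => /eqP ->.
- by move=> j; apply/trivIsetP => p q _ _; rewrite !ord1.
by apply: eq_integral => w _; rewrite big_seq1 big_ord1.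
Qed.

Lemma measurable_Xi i (B : set R) : measurable B -> measurable_fun setT (fun w => Xi i w B).
Proof. by case: pc => _ _ mXi _ _; exact: mXi. Qed.

Lemma measurable_Xi_eq i (B : set R) (c : nat) : measurable B ->
  measurable [set w | Xi i w B = c%:R%:E].
Proof.
move=> mB; have := measurable_Xi i mB measurableT (emeasurable_set1 c%:R%:E).
by rewrite setTI.
Qed.

(** A Poisson variable of mean 0 vanishes almost surely. *)
Lemma ae_no_point (i : seq nat) (A : set T) (B : set R) :
  <<s past (size i) >> A -> measurable B ->
  (forall w, A w -> polya_mean psi (gam i w) (b i w) B = 0%E) ->
  {ae P, forall w, A w -> Xi i w B = 0%E}.
Proof.
move=> mA mB AB0.
have mAT := past_measurable mA.
have h := @Xi_law (size i) i A B 0%N erefl mA mB.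
have {}h : P (A `&` [set w | Xi i w B = 0%E]) = P A.
  rewrite [LHS]h (prob_integral P mAT) integral_mkcond; apply: eq_integral => w _.
  rewrite patchE indicE; case: ifPn => // /set_mem Aw; rewrite AB0// poisson_probE// expr0 oppr0 expR0.
  by rewrite divr1 mulr1.
have mZ : measurable [set w | Xi i w B = 0%E] by exact: (measurable_Xi_eq i 0 mB).
exists (A `\` [set w | Xi i w B = 0%E]); split.
- exact: measurableD.
- rewrite measureD//; last by rewrite (le_lt_trans (probability_le1 P mAT))// ltry.
  by rewrite [X in (_ - X)%E]h subee// fin_num_measure.
- by move=> w /= /not_implyP.
Qed.

Lemma birth_cell_measurable l q : measurable (birth_cell l q).
Proof. exact: measurable_itv. Qed.

(** A Poisson process is given only through probabilities of prescribed counts;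
    since these add up to 1, the measure of a cell is a natural number almost
    surely. *)
Lemma ae_natural_count (i : seq nat) l (q : nat) : (q < 2 ^ l)%N ->
  {ae P, forall w, exists c : nat, Xi i w (birth_cell l q) = c%:R%:E}.
Proof.
move=> ql.
pose E c := [set w | Xi i w (birth_cell l q) = c%:R%:E].
have mE c : measurable (E c) by exact: (measurable_Xi_eq i c (birth_cell_measurable l q)).
suff : {ae P, forall w, (\bigcup_c E c) w}.
  by apply: filterS => w [c _ Ec]; exists c.
apply: ae_prob1; first exact: bigcupT_measurable.
rewrite measure_semi_bigcup//; last 2 first.
- apply/trivIsetP => c c' _ _ cc'; apply/seteqP; split => // w [] /=.
  rewrite /E /= => -> [] /eqP; rewrite eqr_nat; exact/negP.
- exact: bigcupT_measurable.
pose lam w := gam i w * overlap l q (raw_position w i) * (raw_position w i) `^ (-1).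
have mlam : measurable_fun setT lam.
  have mraw := from_past (past_raw_position (leqnn (size i))).
  apply: measurable_funM.
    apply: measurable_funM => //.
    by apply: (@measurableT_comp _ _ _ _ _ _ (overlap l q)) => //; exact: measurable_overlap.
  exact: (@measurableT_comp _ _ _ _ _ _ (@powR R ^~ (-1))).
transitivity (\sum_(0 <= c <oo) \int[P]_w poisson_prob (lam w) 0%N [set c])%E.
  apply: eq_eseriesr => c _.
  have := @Xi_law (size i) i setT (birth_cell l q) c erefl _ (birth_cell_measurable l q).
  rewrite setTI => h; rewrite [LHS]h; last exact: (@measurableT _ (past_type (size i))).
  by apply: eq_integral => w _; rewrite polya_meanE.
rewrite -integral_nneseries//; last first.
  by move=> c; apply: (@measurableT_comp _ _ _ _ _ _ (fun g => poisson_prob g 0%N [set c])) => //; exact: measurable_poisson_prob1.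
transitivity (\int[P]_w (cst 1 w))%E; last first.
  by rewrite integral_cst// mul1e; exact: probability_setT.
apply: eq_integral => w _.
rewrite -measure_semi_bigcup//=.
- rewrite [X in poisson_prob _ _ X](_ : _ = setT) ?probability_setT//.
  by apply/seteqP; split => // c _; exists c.
- by apply/trivIsetP => c c' _ _ cc'; apply/seteqP; split => // k [/= -> ] /eqP; exact/negP.
Qed.

(** Holds almost surely: the tree starts after time 0, and the point process of [i]
    counts points, has none before the birth of [i] and none shortly after time 1. *)
Definition regular_brood w (i : seq nat) : Prop :=
  [/\ (0 < b [::] w)%E,
      forall l q, (q < 2 ^ l)%N -> exists c : nat, Xi i w (birth_cell l q) = c%:R%:E,
      forall l q, (q <= 2 ^ l)%N -> ((level l q)%:E < b i w)%E -> arrivals i w (level l q) = 0%E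
    & Xi i w `]1, 2]%classic = 0%E].

Lemma uniform_root (c : R) : 0 < c <= 1 -> P (U @^-1` `]0, c]%classic) = c%:E.
Proof.
move=> /andP[c0 c1]; have [[lawU _] _ _ _ _] := pc.
rewrite (lawU _ (measurable_itv _)) /uniform_prob integral_uniform_pdf.
rewrite (_ : _ `&` _ = `]0, c]%classic); last first.
  apply/seteqP; split => x /=; rewrite !in_itv /=; first by case.
  by move=> /andP[x0 xc]; rewrite x0 xc (ltW x0) (le_trans xc).
rewrite (eq_integral (cst 1%E)) ?integral_cst//=; last first.
  move=> x; rewrite inE /= in_itv /= => /andP[x0 x1].
  by rewrite /uniform_pdf (ltW x0) (le_trans x1)// subr0 invr1.
by rewrite lebesgue_measure_itv /= lte_fin c0 mul1e oppr0 adde0.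
Qed.

Lemma ae_root_gt0 : {ae P, forall w, 0 < U w}.
Proof.
have : {ae P, forall w, (U @^-1` `]0, 1]%classic) w}.
  apply: ae_prob1; first by rewrite -[X in measurable X]setTI; exact: measurable_funPT.
  by rewrite uniform_root ?ltr01 ?lexx.
by apply: filterS => w /=; rewrite in_itv /= => /andP[].
Qed.

Lemma ae_birth_root : {ae P, forall w, (0 < b [::] w)%E}.
Proof. by apply: filterS ae_root_gt0 => w U0; rewrite polya_birth_root lte_fin powR_gt0. Qed.

Lemma ae_regular_brood : {ae P, forall w, forall i : seq nat, regular_brood w i}.
Proof.
apply: ae_forall_countable => i.
have h2 : {ae P, forall w, forall lq : nat * nat, (lq.2 < 2 ^ lq.1)%N ->
    exists c : nat, Xi i w (birth_cell lq.1 lq.2) = c%:R%:E}.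
  apply: ae_forall_countable => -[l q] /=.
  have [ql|_] := boolP (q < 2 ^ l)%N; last exact: aeW.
  by apply: filterS (ae_natural_count i ql) => w h _.
have h3 : {ae P, forall w, forall lq : nat * nat, (lq.2 <= 2 ^ lq.1)%N ->
    ((level lq.1 lq.2)%:E < b i w)%E -> arrivals i w (level lq.1 lq.2) = 0%E}.
  apply: ae_forall_countable => -[l q] /=.
  have [ql|_] := boolP (q <= 2 ^ l)%N; last exact: aeW.
  have mB : measurable [set x : R | x <= level l q].
    by have := measurable_itv `]-oo, (level l q)]; rewrite set_itvE.
  have no_mean w : ((level l q)%:E < b i w)%E ->
      polya_mean psi (gam i w) (b i w) [set x | x <= level l q] = 0%E.
    move=> lb; rewrite /polya_mean (_ : _ `&` _ = set0) ?integral_set0//.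
    apply/seteqP; split => // v /= [vl [bv _]].
    have := lt_le_trans lb bv; rewrite lte_fin => lv.
    by have := lt_le_trans lv vl; rewrite ltxx.
  by apply: filterS (ae_no_point (past_gt (level l q) (leqnn (size i))) mB no_mean) => w h _.
have h4 : {ae P, forall w, Xi i w `]1, 2]%classic = 0%E}.
  have no_mean w : setT w -> polya_mean psi (gam i w) (b i w) `]1, 2]%classic = 0%E.
    move=> _; rewrite /polya_mean (_ : _ `&` _ = set0) ?integral_set0//.
    apply/seteqP; split => // v /=; rewrite in_itv /= => -[/andP[v1 _] [_]].
    by rewrite lee_fin leNgt v1.
  apply: filterS (ae_no_point (@measurableT _ (past_type (size i))) (measurable_itv _) no_mean) => w h.
  exact: h.
apply: filterS2 (filterI h2 h3) (filterI h4 ae_birth_root) => w [g2 g3] [g4 g1]; split => //.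
- by move=> l q; exact: (g2 (l, q)).
- by move=> l q; exact: (g3 (l, q)).
Qed.

Lemma arrivals_measurable_set (t : R) : measurable [set x : measurableTypeR R | x <= t].
Proof. by have := measurable_itv `]-oo, t]; rewrite set_itvE. Qed.

Lemma arrivals_add i w (s t : R) : s <= t ->
  arrivals i w t = (arrivals i w s + Xi i w `]s, t]%classic)%E.
Proof.
move=> st; rewrite /arrivals -measureU//.
- congr (Xi i w _); apply/seteqP; split => x /=; rewrite in_itv /=.
    by move=> xt; have [xs|sx] := leP x s; [left|right; rewrite ?xt].
  by move=> [xs|/andP[]//]; exact: le_trans st.
- exact: arrivals_measurable_set.
- by apply/seteqP; split => // x [/= xs]; rewrite in_itv /= ltNge xs.
Qed.

Section brood.
Variables (w : T) (i : seq nat).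
Hypothesis reg : regular_brood w i.

Lemma natural_arrivals l q : (q <= 2 ^ l)%N ->
  exists C : nat, arrivals i w (level l q) = C%:R%:E.
Proof.
have [b0 nat_cell no_early _] := reg.
elim: q => [|q IH] ql.
  exists 0%N; apply: no_early => //; rewrite level0.
  exact: lt_le_trans b0 (polya_birth_from_root i w).
have [C CE] := IH (ltnW ql); have [c cE] := nat_cell l q ql.
exists (C + c)%N; rewrite (arrivals_add _ _ (s := level l q)) ?le_level//.
by rewrite CE [X in (_ + X)%E]cE natrD.
Qed.

(** Continuity from above of the measure [Xi i w]. It is finite up to time 2, so that
    the argument also covers [t = 1]. *)
Lemma arrivals_right_continuous (t c : R) : t <= 1 ->
  (forall s : R, t < s -> (c%:E <= arrivals i w s)%E) -> (c%:E <= arrivals i w t)%E.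
Proof.
move=> t1 ge_c.
pose F (n : nat) : set (measurableTypeR R) := [set x | x <= t + n.+1%:R^-1].
have FI : \bigcap_n F n = [set x | x <= t].
  apply/seteqP; split => [x Fx|x xt n _] /=; last by rewrite /F /= (le_trans xt)// lerDl invr_ge0.
  rewrite leNgt; apply/negP => tx.
  have [n _ /(_ n (leqnn n))] := near_infty_natSinv_lt (PosNum (ltac:(by rewrite subr_gt0) : 0 < x - t)).
  by rewrite /= => nx; have := Fx n I; rewrite /F /= leNgt -ltrBrDl nx.
have cv : Xi i w (F n) @[n --> \oo] --> Xi i w (\bigcap_n F n).
  apply: nonincreasing_cvg_mu.
  - have [_ _ _ no_late] := reg.
    have [C CE] := natural_arrivals (leqnn (2 ^ 0)).
    apply: (@le_lt_trans _ _ (arrivals i w 2)).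
      apply: arrivals_le; rewrite invr1; lra.
    rewrite (arrivals_add _ _ (s := 1)) ?ler1n//.
    have -> : arrivals i w 1 = C%:R%:E by rewrite -CE level_top.
    by rewrite [X in (_ + X)%E]no_late adde0 ltry.
  - by move=> n; exact: arrivals_measurable_set.
  - by rewrite FI; exact: arrivals_measurable_set.
  - apply/nonincreasing_seqP => n; apply/subsetPset => x /= xn.
    by apply: le_trans xn _; rewrite lerD2l lef_pV2 ?posrE ?ltr0n// ler_nat.
rewrite /arrivals -FI -(cvg_lim _ cv)//; apply: lime_ge; first by apply/cvg_ex; eexists; exact: cv.
by apply: nearW => n; apply: ge_c; rewrite ltrDl invr_gt0 ltr0n.
Qed.

(** Birth times are infima of arrival levels, attained by right continuity. *)
Lemma birth_le_level l q j C : (q <= 2 ^ l)%N -> arrivals i w (level l q) = C%:R%:E ->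
  (b (rcons i j) w <= (level l q)%:E)%E = (j < C)%N.
Proof.
move=> ql CE; have [_ _ no_early _] := reg.
apply/idP/idP => [bl|jC].
  have : (j.+1%:R%:E <= arrivals i w (level l q))%E.
    apply: arrivals_right_continuous; first by rewrite -(level_top l) le_level.
    move=> s ls; have : (b (rcons i j) w < s%:E)%E by rewrite (le_lt_trans bl)// lte_fin.
    move=> /polya_birth_ltE[t [ts _ h]]; apply: le_trans h _.
    by apply: arrivals_le; exact: ltW.
  by rewrite CE lee_fin ler_nat.
rewrite polya_birth_child; apply: ereal_inf_lbound; exists (level l q) => //; split.
  rewrite leNgt; apply/negP => lb; have := no_early l q ql lb.
  by rewrite CE => -[] /eqP; rewrite pnatr_eq0; lia.
by rewrite CE lee_fin ler_nat.
Qed.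

Lemma finite_brood_child j : finite_brood w (rcons i j).
Proof.
have [C CE] := natural_arrivals (leqnn (2 ^ 0)).
apply/finite_brood_rcons; exists C.
have := birth_le_level C (leqnn _) CE; rewrite ltnn level_top => /negbT.
by rewrite -ltNge.
Qed.

Lemma position_le_dyad l q j : (q <= 2 ^ l)%N ->
  (polya_births w (rcons i j) <= dyad R l q) = (b (rcons i j) w <= (level l q)%:E)%E.
Proof.
move=> ql; have [b0 _ _ _] := reg.
have l1 : level l q <= 1 by rewrite -(level_top l) le_level.
rewrite /= /polya_position; case: asboolP => [[_ b1 _]|nb].
  move: b1 (polya_birth_ge0 (rcons i j) w); case: (b (rcons i j) w) => //= r _ r0.
  by rewrite -level_power le_power ?level_ge0.
have b1 : (1 < b (rcons i j) w)%E.
  rewrite ltNge; apply/negP => b1; apply: nb; split => //; exact: finite_brood_child.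
apply/idP/idP => h.
  by have := le_trans h (dyad_le1 R ql); rewrite leNgt ltr1n.
by have := lt_le_trans b1 h; rewrite lte_fin ltNge l1.
Qed.

Lemma count_lt_code l q C : (q <= 2 ^ l)%N -> arrivals i w (level l q) = C%:R%:E ->
  count (fun r => r < q)%N (code l (polya_births w) i) = C.
Proof.
move=> ql CE; have /andP[cs _] := code_valid l (polya_births w) i.
have H j : (j < C)%N = (j < count (fun r => r < q)%N (code l (polya_births w) i))%N.
  rewrite -(birth_le_level j ql CE) -position_le_dyad// code_le//.
  move: (code l _ i) cs => s cs; elim: s cs j => [|r s IH] //= rs [|j] /=.
    case: (ltnP r q) => rq; first by [].
    symmetry; apply/negbTE; rewrite -leqNgt leqn0 add0n -leqn0 leqNgt -has_count.
    apply/hasPn => k ks; rewrite -leqNgt (leq_trans rq)//.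
    by have /allP := order_path_min leq_trans rs; exact.
  rewrite ltnS IH ?(path_sorted rs)//; case: (ltnP r q) => rq; first by rewrite add1n.
  have -> : count (fun r => r < q)%N s = 0%N.
    apply/eqP; rewrite -leqn0 leqNgt -has_count; apply/hasPn => k ks.
    by rewrite -leqNgt (leq_trans rq)//; have /allP := order_path_min leq_trans rs; exact.
  by [].
by apply/eqP; have := H C; have := H (count (fun r => r < q)%N (code l (polya_births w) i)); lia.
Qed.

Lemma Xi_cell_count l q : (q < 2 ^ l)%N ->
  Xi i w (birth_cell l q) = (count_mem q (code l (polya_births w) i))%:R%:E.
Proof.
move=> ql; have [C CE] := natural_arrivals ql; have [C' CE'] := natural_arrivals (ltnW ql).
have [_ nat_cell _ _] := reg; have [c cE] := nat_cell l q ql.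
have := arrivals_add i w (s := level l q) (t := level l q.+1).
rewrite le_level leqnSn => /(_ isT); rewrite CE CE' [X in (_ + X)%E]cE.
rewrite -EFinD -natrD => -[] /eqP; rewrite eqr_nat => /eqP CC.
have h := count_lt_code ql CE; have h' := count_lt_code (ltnW ql) CE'.
rewrite cE; congr (_%:R%:E); apply/eqP; rewrite -(eqn_add2l C') -CC -h -h'; apply/eqP.
rewrite -[RHS]count_predUI [X in (_ + X)%N](_ : _ = 0%N) ?addn0.
  by apply: eq_count => r /=; rewrite ltnS leq_eqVlt orbC.
by apply/eqP; rewrite -leqn0 leqNgt -has_count; apply/hasPn => r _ /=; lia.
Qed.

(** A nondecreasing list is determined by its multiplicities. *)
Lemma polya_code l s : valid_code l s ->
  code l (polya_births w) i = s <->
  forall q : 'I_(2 ^ l), Xi i w (birth_cell l q) = (count_mem (q : nat) s)%:R%:E.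
Proof.
move=> vs; split => [<- q|h]; first exact: Xi_cell_count.
have /andP[cs call] := code_valid l (polya_births w) i.
have /andP[ss sall] := vs.
apply: (sorted_eq leq_trans anti_leq cs ss).
apply/allP => q; rewrite mem_cat => /orP qin /=.
have ql : (q < 2 ^ l)%N by case: qin => [/(allP call)|/(allP sall)].
have := h (Ordinal ql); rewrite Xi_cell_count//= => -[] /eqP.
by rewrite eqr_nat.
Qed.

End brood.

Lemma raw_position_regular w (i : seq nat) : (forall p, regular_brood w p) ->
  raw_position w i = polya_position w i.
Proof.
move=> reg; have [b0 _ _ _] := reg [::].
have fb : finite_brood w i by case/lastP: i => [//|p j]; exact: finite_brood_child (reg p) _.
rewrite /raw_position /polya_position (lt_le_trans b0 (polya_birth_from_root i w)) /=.
by case: asboolP => [[_ -> _]//|nb]; rewrite ifF//; apply/negP => b1; exact: nb.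
Qed.

Lemma measurable_polya_position i : measurable_fun setT (fun w => polya_position w i).
Proof. exact: from_past (past_position (leqnn (size (i : seq nat)))). Qed.

(** [polya_position] of the root as a function of the value of [U], which makes
    it independent of the gamma variables. *)
Definition root_position (x : R) : R :=
  if (0 < x `^ chi) && (x `^ chi <= 1) then (x `^ chi) `^ psi else 2.

Lemma measurable_root_position : measurable_fun setT root_position.
Proof.
have mp : measurable_fun setT (fun x : R => x `^ chi) by exact: measurable_powR.
apply: measurable_fun_ifT => //.
  by apply: measurable_and; [apply: measurable_fun_ltr|apply: measurable_fun_ler].
by apply: (@measurableT_comp _ _ _ _ _ _ (@powR R ^~ psi)).
Qed.

Lemma polya_root_position w : polya_births w [::] = root_position (U w).
Proof.
rewrite /= /polya_position /root_position polya_birth_root /=.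
case: asboolP => [[h1 h2 _]|nb].
  by rewrite polya_birth_root lte_fin in h1; rewrite polya_birth_root lee_fin in h2; rewrite h1 h2.
rewrite ifF//; apply/negP => /andP[h1 h2]; apply: nb.
by split; rewrite ?polya_birth_root.
Qed.

Lemma polya_root_independent (E : set R) (s : seq (seq nat)) (D : seq nat -> set R) :
  measurable E -> uniq s -> (forall i, measurable (D i)) ->
  P ([set w | E (polya_births w [::])] `&` marks_in (fun i w => gam i w) s D) =
  (P [set w | E (polya_births w [::])] * \prod_(i <- s) P (gam i @^-1` D i))%E.
Proof.
move=> mE us mD; have [_ ind _ _ _] := pc.
pose A (o : option (seq nat)) : set T :=
  if o is Some i then gam i @^-1` D i else [set w | E (polya_births w [::])].
have uo : uniq (None :: map Some s) by rewrite /= map_inj_uniq ?us ?andbT; [apply/mapP => -[]|move=> ? ? []].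
have := ind (None :: map Some s) A uo; rewrite big_cons big_map /= => <-.
  congr (P _); apply/seteqP; split => w.
    move=> [Ew Mw] [i|] //; rewrite inE /= => /mapP[j js [->]]; exact: Mw.
  move=> H; split; first by have := H None; rewrite inE; apply.
  by move=> i si; have := H (Some i); apply; rewrite inE /= map_f.
move=> [i|] _ /=; first by exists (D i) => //; rewrite setTI.
exists (root_position @^-1` E); last first.
  rewrite setTI; apply/esym/funext => w.
  by rewrite /mkset (polya_root_position w : polya_position w [::] = _).
by have := measurable_root_position measurableT mE; rewrite setTI.
Qed.

(** The counts prescribed by a code are almost surely the event of
    [polya_code], and the Poisson means are those of [polya_meanE]. *)
Lemma polya_step n l K (s : seq (seq nat)) (D : seq nat -> set R) (E : set (births R)) :
  <<s @born_before R n >> E -> valid_codes n l K -> (forall i, measurable (D i)) ->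
  P ((polya_births @^-1` E `&` marks_in (fun i w => gam i w) s D) `&`
      polya_births @^-1` atom n l K) =
  (\int[P]_(w in polya_births @^-1` E `&` marks_in (fun i w => gam i w) s D)
    \prod_(i <- individuals n l) polya_kernel l (K i) (polya_births w i) (gam i w))%E.
Proof.
move=> mE vK mD; set A := _ `&` marks_in _ _ _.
have mA : <<s past n >> A.
  apply: (@measurableI _ (past_type n)).
    by have := past_births (n := n) measurableT mE; rewrite setTI.
  apply: (@measurable_forall_in _ (past_type n) _ _ _ (fun i w => gam i w)) => // i.
  exact: past_mark.
have mAT := past_measurable mA.
pose V := [set w | forall (i : seq nat) (q : 'I_(2 ^ l)), i \in individuals n l ->
   Xi i w (birth_cell l q) = (count_mem (q : nat) (K i))%:R%:E].
have mV : measurable V.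
  rewrite (_ : V = \bigcap_(i in [set` individuals n l])
      [set w | forall q : 'I_(2 ^ l), Xi i w (birth_cell l q) = (count_mem (q : nat) (K i))%:R%:E]).
    apply: fin_bigcap_measurable => // i _.
    apply: (@measurable_forall _ T 'I_(2 ^ l)) => q.
    exact: (measurable_Xi_eq i _ (birth_cell_measurable l q)).
  apply/seteqP; split => w /= H i; first by move=> il q; exact: H.
  by move=> q il; exact: H.
have mZatom : measurable (polya_births @^-1` atom n l K).
  have := past_births (n := n.+1) measurableT (measurable_atom vK).
  by rewrite setTI => /past_measurable.
transitivity (P (A `&` V)).
  apply: prob_ae_eq; [exact: measurableI|exact: measurableI|].
  apply: filterS ae_regular_brood => w reg; split => -[Aw h]; split => // i.
    by move=> q il; exact: (iffLR (polya_code (reg i) (vK _ il)) (h i il) q).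
  by move=> il; apply: (iffRL (polya_code (reg i) (vK _ il))) => q; exact: h.
have [_ _ _ cp _] := pc.
have size_ind i : i \in individuals n l -> size i = n.
  by rewrite mem_individuals => /andP[/eqP].
rewrite (cp n A (individuals n l) (2 ^ l)%N (fun _ q => birth_cell l q)
  (fun i q => count_mem (q : nat) (K i)) mA (individuals_uniq n l) size_ind); last 2 first.
- by move=> i q; exact: birth_cell_measurable.
- by move=> i; exact: birth_cell_trivIset.
have mker (y : T -> seq nat -> R) : (forall i, measurable_fun setT (fun w => y w i)) ->
    measurable_fun A (fun w => \prod_(i <- individuals n l) polya_kernel l (K i) (y w i) (gam i w))%E.
  move=> my; apply: measurable_funTS; apply: emeasurable_prod => i.
  exact: (measurable_fun_comp2 (measurable_polya_kernel l (K i))).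
transitivity (\int[P]_(w in A)
    \prod_(i <- individuals n l) polya_kernel l (K i) (raw_position w i) (gam i w))%E.
  apply: eq_integral => w _; apply: eq_bigr => i _; apply: eq_bigr => q _.
  by rewrite polya_meanE.
apply: ge0_ae_eq_integral => //.
- by apply: mker => i; exact: from_past (past_raw_position (leqnn (size i))).
- by apply: mker => i; exact: measurable_polya_position.
- by move=> w _; apply: prode_ge0 => i _; exact: polya_kernel_ge0.
- by move=> w _; apply: prode_ge0 => i _; exact: polya_kernel_ge0.
apply: filterS ae_regular_brood => w reg _; apply: eq_bigr => i _.
by rewrite raw_position_regular.
Qed.

Lemma polya_branching : branching P polya_births (fun i w => gam i w)
  (@polya_kernel R) (fun l s u => (offspring_law (m%:R + beta) l s u)%:E).
Proof.
have [[_ lawg] _ _ _ _] := pc.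
split.
- by move=> i; exact: measurable_polya_position.
- by move=> i; exact: measurable_funPT.
- by move=> E s D mE us mD; exact: polya_root_independent.
- by move=> l s; exact: measurable_polya_kernel.
- by move=> l s u y; exact: polya_kernel_ge0.
- by move=> n l K s D E mE vK us sn mD; exact: polya_step.
- move=> l s i u vs u0; apply: polya_kernel_mean => //.
  by rewrite ler_wpDr// ler1n.
Qed.

Lemma polya_born (i : seq nat) : {ae P, forall w,
  (b i w <= 1%:E)%E <-> polya_births w i <= 1}.
Proof.
apply: filterS ae_regular_brood => w reg.
rewrite /= -raw_position_regular// /raw_position.
have [b0 _ _ _] := reg [::].
rewrite (lt_le_trans b0 (polya_birth_from_root i w)) /=.
case: ifPn => b1; last by split => //; rewrite leNgt ltr1n.
split => // _; move: b1 (polya_birth_ge0 i w); case: (b i w) => // r; rewrite !lee_fin /= => r1 r0.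
have := @ge0_ler_powR R psi (ltW psi_gt0) r 1.
by rewrite powR1 !nnegrE; apply.
Qed.

Lemma measurable_polya_born (i : seq nat) : measurable [set w | (b i w <= 1%:E)%E].
Proof. by have := past_measurable (past_le 1 (leqnn (size i))). Qed.

End polya_tree.

(** * Comparison of the two trees *)

Section comparison.
Context (R : realType) (W : nat -> seq nat -> R -> \bar R).
Context d1 (T1 : measurableType d1) (P1 : probability T1 R).
Context e1 (G1 : measurableType e1) (z1 : T1 -> births R) (g1 : seq nat -> T1 -> G1).
Context d2 (T2 : measurableType d2) (P2 : probability T2 R).
Context e2 (G2 : measurableType e2) (z2 : T2 -> births R) (g2 : seq nat -> T2 -> G2).

(** Being born in time is the condition that the position is at most 1, so the
    law of the set of individuals present is part of the law of the positions. *)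
Lemma branching_trees f1 f2 (b1 : label -> T1 -> \bar R) t1 (b2 : label -> T2 -> \bar R) t2 :
  branching P1 z1 g1 f1 W -> branching P2 z2 g2 f2 W ->
  (forall c, 0 < c <= 1 -> P1 [set w | z1 w [::] <= c] = P2 [set w | z2 w [::] <= c]) ->
  (forall i, measurable [set w | (b1 i w <= (t1 w)%:E)%E]) ->
  (forall i, measurable [set w | (b2 i w <= (t2 w)%:E)%E]) ->
  (forall i : seq nat, {ae P1, forall w, (b1 i w <= (t1 w)%:E)%E <-> z1 w i <= 1}) ->
  (forall i : seq nat, {ae P2, forall w, (b2 i w <= (t2 w)%:E)%E <-> z2 w i <= 1}) ->
  eq_in_distribution P1 (tree_at b1 t1) P2 (tree_at b2 t2).
Proof.
move=> br1 br2 root mb1 mb2 born1 born2.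
apply: eq_in_distribution_trees => // s.
pose E : set (births R) := [set x | forall i, i \in s -> x i <= 1].
pose n := (\max_(i <- s) size i)%N.
have mE : <<s @born_before R n >> E.
  rewrite (_ : E = \bigcap_(i in [set` s]) [set x : births R | x i <= 1]).
    apply: (@fin_bigcap_measurable _ (g_sigma_algebraType (@born_before R n))) => // i /= si.
    by apply: measurable_le; rewrite /n (big_rem i)//= leq_max leqnn.
  by apply/seteqP; split.
have key d (T : measurableType d) (P : probability T R) (z : T -> births R)
    (b : label -> T -> \bar R) (t : T -> R) :
    measurable (z @^-1` E) -> (forall i, measurable [set w | (b i w <= (t w)%:E)%E]) ->
    (forall i : seq nat, {ae P, forall w, (b i w <= (t w)%:E)%E <-> z w i <= 1}) ->
    P [set w | forall i, i \in s -> (b i w <= (t w)%:E)%E] = P (z @^-1` E).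
  move=> mzE mb born; apply: prob_ae_eq => //.
    rewrite (_ : mkset _ = \bigcap_(i in [set` s]) [set w | (b i w <= (t w)%:E)%E]).
      by apply: fin_bigcap_measurable.
    by apply/seteqP; split.
  have := ae_forall_countable born; apply: filterS => w bz.
  by split => h i si; apply/bz; exact: h.
rewrite (key _ _ _ z1) ?(key _ _ _ z2)//; last 2 first.
- exact: (measurable_births_pre br2 mE).
- exact: (measurable_births_pre br1 mE).
apply: (branching_unique br1 br2) mE => l q ql.
have [q0|q0] := posnP q; last first.
  by apply: root; rewrite dyad_le1// andbT /dyad divr_gt0 ?ltr0n ?exprn_gt0.
have no T (z : T -> births R) : [set w | z w [::] <= dyad R l q] = set0.
  by apply/seteqP; split => // w /=; rewrite q0 dyad0 leNgt births_gt0.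
by rewrite !no !measure0.
Qed.

End comparison.

Section roots.
Context (R : realType) d (T : measurableType d) (P : probability T R).

Lemma yule_root_law alpha (Y : label -> R -> T -> nat) b (yc : yule_ctbp P alpha Y b)
    (tau : {RV P >-> R}) r c : 0 < r -> exp_clock r Y tau -> 0 < c <= 1 ->
  P [set w | yule_births yc tau w [::] <= c] = (c `^ r)%:E.
Proof.
move=> r0 [lawt _] /andP[c0 c1].
have lc : 0 <= - ln c by rewrite oppr_ge0 ln_le0.
rewrite (_ : mkset _ = tau @^-1` `[(- ln c)%R, +oo[%classic).
  rewrite (lawt _ (measurable_itv _)).
  have := exponential_tail r0 lc.
  rewrite /exponential_prob integral_itv_obnd_cbnd => [->|]; last first.
    by apply/measurable_EFinP/measurable_funTS; exact: measurable_exponential_pdf.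
  by rewrite mulrNN /powR gt_eqF.
apply/seteqP; split => w /=; rewrite /yule_position (yule_birth_root yc) in_itv /= andbT lee_fin sub0r.
  case: ifPn => [t0|_ h]; last by have := le_trans h c1; rewrite leNgt ltr1n.
  by rewrite -{1}(lnK (x := c)) ?posrE// ler_expR lerNl.
move=> ct; rewrite (le_trans lc ct).
by rewrite -[leRHS](lnK (x := c)) ?posrE// ler_expR lerNl.
Qed.

Lemma polya_root_law (m : nat) beta (U : {RV P >-> R}) (gam : label -> {RV P >-> R}) Xi b
   (pc : polya_ctbp m beta U gam Xi b) (m1 : (1 <= m)%N) (beta0 : 0 <= beta) (c : R) : 0 < c <= 1 ->
  P [set w | polya_births pc m1 beta0 w [::] <= c] = (c `^ (2 + beta / m%:R))%:E.
Proof.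
move=> /andP[c0 c1];
have mR0 : 0 < m%:R :> R by rewrite ltr0n.
pose chi : R := (m%:R + beta) / (2 * m%:R + beta).
pose psi : R := (1 - chi) / chi.
have chi0 : 0 < chi := chi_gt0 m1 beta0.
have psi0 : 0 < psi := psi_gt0 m1 beta0.
set r := 2 + _; have r0 : 0 < r by rewrite ltr_wpDr ?divr_ge0 ?ler0n.
(* The root is at position U ^ (chi psi), and this exponent is 1 / r. *)
have power : chi * psi = r^-1.
  rewrite /psi mulrC divfK ?gt_eqF// /chi /r.
  have e1 : 2 * m%:R + beta != 0 by rewrite gt_eqF// ltr_wpDr// mulr_gt0 ?ltr0n.
  have e2 : m%:R != 0 :> R by rewrite gt_eqF.
  have -> : 2 + beta / m%:R = (2 * m%:R + beta) / m%:R by field.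
  by rewrite invf_div; field.
have lec (x : R) : 0 < x -> (root_position m beta x <= c) = (x <= c `^ r).
  move=> x0; have -> : (x <= c `^ r) = ((x `^ chi) `^ psi <= c).
    rewrite -powRrM power -(@le_powR _ r^-1) ?invr_gt0 ?powR_ge0 ?(ltW x0)//.
    by rewrite -[in RHS](powRr1 (ltW c0)) -(mulfV (lt0r_neq0 r0)) powRrM.
  rewrite /root_position -/chi -/psi powR_gt0//=.
  case: ifPn => //; rewrite -ltNge => x1; rewrite !leNgt; congr (~~ _).
  rewrite (le_lt_trans c1 (ltr1n _ 2)); apply/esym/(le_lt_trans c1).
  have <- : 1 `^ psi = 1 :> R by rewrite powR1.
  by rewrite ltNge le_powR ?powR_ge0// -ltNge.
have cr1 : c `^ r <= 1.
  have <- : 1 `^ r = 1 :> R by rewrite powR1.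
  by rewrite le_powR ?(ltW c0).
rewrite -(uniform_root pc) ?powR_gt0//; apply: prob_ae_eq.
- rewrite -[X in measurable X]setTI (_ : mkset _ = (polya_births pc m1 beta0)^~ [::] @^-1` `]-oo, c]).
    by apply: (measurable_polya_position pc [::]) => //; exact: measurable_itv.
  by apply/seteqP; split => w; rewrite /= in_itv.
- by rewrite -[X in measurable X]setTI; exact: measurable_funPT.
apply: filterS (ae_root_gt0 pc) => w U0.
by rewrite /mkset polya_root_position lec//= in_itv /= U0.
Qed.

End roots.

Theorem theorem5p1 (R : realType) (m : nat) (beta : R)
    (m_ge1 : (1 <= m)%N) (beta_ge0 : 0 <= beta)
    (d : measure_display) (T : measurableType d) (P : probability T R)
    (Gstar : T -> drgraph) (Gstar_m : is_Gstar P m beta Gstar)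
    (d' : measure_display) (T' : measurableType d') (P' : probability T' R)
    (Y : label -> R -> T' -> nat) (b : label -> T' -> \bar R)
    (tau : {RV P' >-> R})
    (B_ctbp : yule_ctbp P' (m%:R - 1 + beta) Y b)
    (tau_exp : exp_clock (2 + beta / m%:R) Y tau) :
  eq_in_distribution P Gstar P' (tree_at b tau).
Proof.
have rate0 : 0 < 2 + beta / m%:R by rewrite ltr_wpDr ?divr_ge0.
have shape : 1 + (m%:R - 1 + beta) = m%:R + beta by ring.
have alpha_gt : 0 < 1 + (m%:R - 1 + beta) by rewrite shape ltr_wpDr// ltr0n.
have br := yule_branching B_ctbp alpha_gt tau_exp; rewrite shape in br.
have meas i := measurable_yule_born B_ctbp tau i.
have born (i : seq nat) : {ae P', forall w, (b i w <= (tau w)%:E)%E <->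
    yule_births B_ctbp tau w i <= 1} by apply: aeW => w; exact: yule_born.
move: Gstar_m; rewrite /is_Gstar; case: eqP => [m_eq1|_].
  move=> [Y1 [b1 [tau1 [yc1 clock1 ->]]]].
  have rate1 : 2 + beta = 2 + beta / m%:R by rewrite m_eq1 divr1.
  have shape1 : 1 + beta = m%:R + beta by rewrite m_eq1.
  have beta_gt : 0 < 1 + beta by rewrite ltr_wpDr.
  have br1 := yule_branching yc1 beta_gt clock1; rewrite shape1 in br1.
  rewrite rate1 in clock1.
  apply: (branching_trees br1 br) => //.
  - by move=> c c01; rewrite (yule_root_law yc1 rate0 clock1 c01)
      (yule_root_law B_ctbp rate0 tau_exp c01).
  - by move=> i; exact: (measurable_yule_born yc1).
  - by move=> i; apply: aeW => w; exact: (yule_born yc1).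
move=> [U [gam [Xi [b1 [pc ->]]]]].
apply: (branching_trees (polya_branching pc m_ge1 beta_ge0) br) => //.
- by move=> c c01; rewrite (polya_root_law pc m_ge1 beta_ge0 c01)
    (yule_root_law B_ctbp rate0 tau_exp c01).
- exact: (measurable_polya_born pc).
- exact: (polya_born pc).
Qed.
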